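(* Let $A$ and $B$ be two-point subsets of the open unit disc $\mathbb D$ such that $0\notin A$, $0\notin B$ and $l_{\mathbb D}(A,0)=l_{\mathbb D}(B,0)$. Then $$l_{\mathbb D}(A,0)=l_{\mathbb D^2}(A\times B,(0,0))$$ if and only if there is a rotation sending $A$ to $B$. In addition, if $B=e^{i\theta}A$ with $\theta\in\mathbb R$, then the $l_{\mathbb D^2}(A\times B,(0,0))$-extremal discs are of the form $(r,e^{i\theta}r)$, where $r$ is a rotation.
   Context: $\mathbb D$ is the open unit disc in $\mathbb C$, $\mathbb D^2=\mathbb D\times\mathbb D$, and $\mathcal O(\mathbb D,\Omega)$ is the set of holomorphic maps $\mathbb D\to\Omega$. For a domain $\Omega\subset\mathbb C^k$, a point $x\in\Omega$ and a nonempty at most countable set $S\subset\Omega$, the Lempert function with poles at $S$ is $$l_\Omega(S,x)=\inf\Big\{\prod_{s\in S}|\lambda_s|\Big\},$$ the infimum being over all families $(\lambda_s)_{s\in S}$ in $\mathbb D$ for which there is $\phi\in\mathcal O(\mathbb D,\Omega)$ with $\phi(0)=x$ and $\phi(\lambda_s)=s$ for all $s\in S$. A map $\phi\in\mathcal O(\mathbb D,\Omega)$ is an $l_\Omega(S,x)$-extremal disc if $\phi(0)=x$ and there exist a nonempty subset $T\subset S$ and points $\lambda_s\in\mathbb D$ ($s\in T$) with $\phi(\lambda_s)=s$ for all $s\in T$ and $l_\Omega(S,x)=\prod_{s\in T}|\lambda_s|$. A rotation is a map $\mathbb D\to\mathbb D$, $\zeta\mapsto e^{it}\zeta$, with $t\in\mathbb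 R$.
   Formalization: For A = −A the claim with the given θ fails, since (ζ, −e^{iθ}ζ) is also extremal; so it is proved for that θ when A ≠ −A, and for every A the extremal discs are exactly the (r, e^{iθ'}r) with r a rotation and B = e^{iθ'}A. *)

(* Defs.v *)
From Stdlib Require Import Reals List.
From Coquelicot Require Import Coquelicot.

Open Scope R_scope.

Definition unit_disc (z : C) : Prop := Cmod z < 1.

Definition bidisc (p : C * C) : Prop := unit_disc (fst p) /\ unit_disc (snd p).

Definition cis (t : R) : C := (cos t, sin t).

Section Lempert.

(* The ambient space is an arbitrary complex normed space, so that C and C * C
   are instances.  [ex_derive] is complex differentiability because the scalars
   are C. *)
Context {V : NormedModule C_AbsRing}.

(* A holomorphic map from the unit disc to Omega is represented by a total
   function on C, whose values outside the disc play no role. *)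
Definition hol_disc (Omega : V -> Prop) (phi : C -> V) : Prop :=
  forall z : C, unit_disc z -> ex_derive (K := C_AbsRing) phi z /\ Omega (phi z).

(* Product over S of a family with values in [0, 1], as the infimum of its
   finite subproducts: the usual product for finite S, and the value of the
   (unconditionally convergent) infinite product for countable S. *)
Definition prod_over (S : V -> Prop) (f : V -> R) : Rbar :=
  Glb_Rbar (fun p : R => exists l : list V,
    NoDup l /\ (forall s : V, In s l -> S s) /\
    p = fold_right Rmult 1 (map f l)).

Definition passes_through (phi : C -> V) (S : V -> Prop) (lam : V -> C) : Prop :=
  forall s : V, S s -> unit_disc (lam s) /\ phi (lam s) = s.

(* Meant for S a nonempty, at most countable subset of the domain Omega.  The
   value is in Rbar so that an infimum over no disc at all would be +oo. *)
Definition lempert (Omega S : V -> Prop) (x : V) : Rbar :=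
  Glb_Rbar (fun p : R => exists (phi : C -> V) (lam : V -> C),
    hol_disc Omega phi /\ phi (RtoC 0) = x /\ passes_through phi S lam /\
    Finite p = prod_over S (fun s : V => Cmod (lam s))).

Definition extremal_disc (Omega S : V -> Prop) (x : V) (phi : C -> V) : Prop :=
  hol_disc Omega phi /\ phi (RtoC 0) = x /\
  exists (T : V -> Prop) (lam : V -> C),
    (exists s : V, T s) /\ (forall s : V, T s -> S s) /\
    passes_through phi T lam /\
    lempert Omega S x = prod_over T (fun s : V => Cmod (lam s)).

End Lempert.

Definition lempert_disc : (C -> Prop) -> C -> Rbar :=
  lempert (V := C_NormedModule) unit_disc.

Definition lempert_bidisc : (C * C -> Prop) -> C * C -> Rbar :=
  lempert (V := prod_NormedModule C_AbsRing C_NormedModule C_NormedModule) bidisc.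

Definition extremal_bidisc : (C * C -> Prop) -> C * C -> (C -> C * C) -> Prop :=
  extremal_disc (V := prod_NormedModule C_AbsRing C_NormedModule C_NormedModule)
    bidisc.

Definition two_points (A : C -> Prop) : Prop :=
  exists a b : C, a <> b /\ forall z : C, A z <-> z = a \/ z = b.

Definition cartesian (A B : C -> Prop) (p : C * C) : Prop := A (fst p) /\ B (snd p).

Definition maps_onto (f : C -> C) (A B : C -> Prop) : Prop :=
  forall w : C, B w <-> exists z : C, A z /\ w = f z.

(* As for [hol_disc], only the values on the disc matter. *)
Definition rotation (r : C -> C) : Prop :=
  exists t : R, forall z : C, unit_disc z -> r z = Cmult (cis t) z.

(* phi = (r, e^{i theta} r) on the disc, for some rotation r. *)
Definition rotation_pair (theta : R) (phi : C -> C * C) : Prop :=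
  exists r : C -> C, rotation r /\
    forall z : C, unit_disc z -> phi z = (r z, Cmult (cis theta) (r z)).

(* Main.v *)
Require Import Defs.
From Stdlib Require Import Reals Lra List Classical ClassicalEpsilon.
From Coquelicot Require Import Coquelicot.

(** By the Schwarz lemma the Lempert function of a two-point set is the product
    of the moduli of its points, so the hypothesis reads |a1 a2| = |b1 b2|.  Let
    (f, g) be a disc that vanishes at 0 and meets (a1,b1), (a1,b2), (a2,b1),
    (a2,b2) at p, q, r, s.  As f takes the value a1 at p and at q, the function
    mobius a1 (f z) can be divided by the Blaschke factors of p and q and stays
    bounded by 1; at 0 this says |a1| <= |p q| ([fibre_product]).  Similarly
    |a2| <= |r s|, hence l >= |a1 a2| whatever A and B are.

    Suppose that l = |a1 a2|.  The infimum is over non-compact data, but normal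
    families can be avoided: the Schwarz-Pick inequalities for f(z)/z and for the
    quotient above become, after clearing denominators, closed polynomial
    inequalities between the nodes and the values ([fibre_constraints]), which
    pass to a limit of the nodes in the closed disc ([rotation_of_small_products]).
    In the limit |a1| = |p q|, |a2| = |r s|, |b1| = |p r|, |b2| = |q s|.
    If all nodes are inside the disc, the quotients are constant, so
    mobius p * mobius q agrees at r and s while mobius p * mobius r agrees at q
    and s; moving p to 0 makes these two equations linear in the image of s, and contradictory
    ([fibre_equations_incompatible]).  If a node is on the circle, say |q| = 1,
    then |p| = |a1| and |s| = |b2|: equality holds in the Schwarz lemma for f at p
    and for g at s, so both coordinates act on p and s as rotations and B is a
    rotation of A ([rotation_of_boundary_limit]).

    Conversely, let B = u A.  The disc z |-> (z, u z) meets only two of the four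
    points, with the right product |a1 a2|.  It is replaced by (z h(z), u z k(z)),
    where h and k take a value rho < 1 at a1/rho and a2/rho and are chosen so that
    the two other points are met at t and -t.  Such h and k exist once t is close to
    1, and the product is then at most |a1 a2| / rho^2
    ([almost_rotation_through_four_points]).

    For an extremal disc meeting the points of a subset T of A x B, the same
    inequalities hold with equality for each row and each column of A x B.  All
    four points are excluded by the interior case above.  A row or column with a
    single point forces equality in the Schwarz lemma, hence a rotation, which is
    injective; so T is a diagonal and both coordinates are rotations
    ([extremal_components]).

    The Schwarz-Pick lemma itself rests on nothing but complex differentiability.
    Goursat's bisection argument on rectangles, applied to H(exp w), gives the
    mean value property on circles.  It is proved for functions that are
    differentiable off a finite set, so that it applies to quotients by Blaschke
    factors without a theorem on removable singularities. *)

(** * Goursat's theorem for closed real differential forms *)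

(** The form P dx + Q dy is differentiable at the point, with dP/dy = dQ/dx = k.
    No continuity of the partial derivatives is asked for, which is what complex
    differentiability provides. *)
Definition closed_form_at (P Q : R -> R -> R) (x y : R) : Prop :=
  exists px k qy : R, forall eps : R, 0 < eps -> exists delta : R, 0 < delta /\
    forall x' y' : R, Rabs (x' - x) < delta -> Rabs (y' - y) < delta ->
      Rabs (P x' y' - P x y - (px * (x' - x) + k * (y' - y)))
        <= eps * (Rabs (x' - x) + Rabs (y' - y)) /\
      Rabs (Q x' y' - Q x y - (k * (x' - x) + qy * (y' - y)))
        <= eps * (Rabs (x' - x) + Rabs (y' - y)).

(** The integral of P dx + Q dy along the boundary of [a,b] x [c,d].  Opposite sides
    are grouped under one integral, so that for an affine closed form both
    integrands are constant and their integrals cancel. *)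
Definition circulation (P Q : R -> R -> R) (a b c d : R) : R :=
  RInt (fun x => P x c - P x d) a b + RInt (fun y => Q b y - Q a y) c d.

Lemma continuous_of_affine_bound (f : R -> R) (x m : R) :
  (exists delta : R, 0 < delta /\ forall x', Rabs (x' - x) < delta ->
     Rabs (f x' - f x - m * (x' - x)) <= Rabs (x' - x)) ->
  continuous f x.
Proof.
intros [delta [Hd H]].
apply continuity_pt_filterlim.
intros eps Heps.
set (M := Rabs m + 1).
assert (HM : 0 < M) by (unfold M; generalize (Rabs_pos m); lra).
exists (Rmin delta (eps / M)); split.
  apply Rmin_glb_lt; [exact Hd | now apply Rdiv_lt_0_compat].
intros x' [_ Hx']; simpl in *; unfold R_dist in *.
assert (H1 := Rlt_le_trans _ _ _ Hx' (Rmin_l _ _)).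
assert (H2 := Rlt_le_trans _ _ _ Hx' (Rmin_r _ _)).
specialize (H x' H1).
replace (f x' - f x) with ((f x' - f x - m * (x' - x)) + m * (x' - x)) by ring.
apply Rle_lt_trans with (1 := Rabs_triang _ _).
rewrite Rabs_mult.
apply Rle_lt_trans with (M * Rabs (x' - x)); [unfold M; lra|].
apply Rlt_le_trans with (M * (eps / M)); [now apply Rmult_lt_compat_l|].
right; field; lra.
Qed.

Lemma closed_form_continuous (P Q : R -> R -> R) (x y : R) :
  closed_form_at P Q x y ->
  continuous (fun t => P t y) x /\ continuous (fun t => Q x t) y.
Proof.
intros [px [k [qy H]]].
destruct (H 1 Rlt_0_1) as [delta [Hd H1]].
split.
- apply continuous_of_affine_bound with px.
  exists delta; split; [exact Hd|]; intros x' Hx'.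
  destruct (H1 x' y Hx') as [H2 _].
    now rewrite Rminus_diag, Rabs_R0.
  rewrite Rminus_diag, Rabs_R0 in H2.
  replace (px * (x' - x)) with (px * (x' - x) + k * 0) by ring. lra.
- apply continuous_of_affine_bound with qy.
  exists delta; split; [exact Hd|]; intros y' Hy'.
  destruct (H1 x y') as [_ H2]; [now rewrite Rminus_diag, Rabs_R0 | exact Hy' |].
  rewrite Rminus_diag, Rabs_R0 in H2.
  replace (qy * (y' - y)) with (k * 0 + qy * (y' - y)) by ring. lra.
Qed.

Lemma RInt_near_constant (f : R -> R) (a b m e : R) :
  a <= b -> ex_RInt f a b ->
  (forall x, a <= x <= b -> Rabs (f x - m) <= e) ->
  Rabs (RInt f a b - m * (b - a)) <= e * (b - a).
Proof.
intros Hab Hf H.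
replace (RInt f a b - m * (b - a)) with (RInt (fun x => f x - m) a b).
- apply Rle_trans with ((b - a) * e); [|lra].
  apply abs_RInt_le_const; auto.
  apply @ex_RInt_minus; [exact Hf | apply ex_RInt_const].
- rewrite (RInt_minus (V := R_CompleteNormedModule)); [|exact Hf | apply ex_RInt_const].
  rewrite RInt_const; unfold minus, plus, opp, scal; simpl; unfold mult; simpl; ring.
Qed.

Section Goursat.
Variables (P Q : R -> R -> R) (a b c d : R).
Hypotheses (Hab : a <= b) (Hcd : c <= d).
Hypothesis H : forall x y, a <= x <= b -> c <= y <= d -> closed_form_at P Q x y.

Lemma ex_RInt_horizontal a' b' y : a <= a' -> a' <= b' -> b' <= b -> c <= y <= d ->
  ex_RInt (fun x => P x y) a' b'.
Proof.
intros H1 H2 H3 Hy. apply @ex_RInt_continuous.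
intros x; rewrite Rmin_left, Rmax_right by lra; intros Hx.
apply (closed_form_continuous P Q x y), H; lra.
Qed.

Lemma ex_RInt_vertical c' d' x : c <= c' -> c' <= d' -> d' <= d -> a <= x <= b ->
  ex_RInt (fun y => Q x y) c' d'.
Proof.
intros H1 H2 H3 Hx. apply @ex_RInt_continuous.
intros y; rewrite Rmin_left, Rmax_right by lra; intros Hy.
apply (closed_form_continuous P Q x y), H; lra.
Qed.

Lemma ex_RInt_P_diff a' b' y y' : a <= a' -> a' <= b' -> b' <= b -> c <= y <= d ->
  c <= y' <= d -> ex_RInt (fun x => P x y - P x y') a' b'.
Proof. intros. apply @ex_RInt_minus; now apply ex_RInt_horizontal. Qed.

Lemma ex_RInt_Q_diff c' d' x x' : c <= c' -> c' <= d' -> d' <= d -> a <= x <= b ->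
  a <= x' <= b -> ex_RInt (fun y => Q x y - Q x' y) c' d'.
Proof. intros. apply @ex_RInt_minus; now apply ex_RInt_vertical. Qed.

Lemma circulation_split_x a' m b' c' d' :
  a <= a' -> a' <= m -> m <= b' -> b' <= b -> c <= c' -> c' <= d' -> d' <= d ->
  circulation P Q a' b' c' d' = circulation P Q a' m c' d' + circulation P Q m b' c' d'.
Proof.
intros; unfold circulation.
rewrite <- (RInt_Chasles (fun x => P x c' - P x d') a' m b') by (apply ex_RInt_P_diff; lra).
assert (E : RInt (fun y => Q b' y - Q a' y) c' d' =
  RInt (fun y => Q b' y - Q m y) c' d' + RInt (fun y => Q m y - Q a' y) c' d').
  rewrite <- (RInt_plus (V := R_CompleteNormedModule)) by (apply ex_RInt_Q_diff; lra).
  apply RInt_ext; intros y _; unfold plus; simpl; ring.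
rewrite E; unfold plus; simpl; ring.
Qed.

Lemma circulation_split_y a' b' c' m d' :
  a <= a' -> a' <= b' -> b' <= b -> c <= c' -> c' <= m -> m <= d' -> d' <= d ->
  circulation P Q a' b' c' d' = circulation P Q a' b' c' m + circulation P Q a' b' m d'.
Proof.
intros; unfold circulation.
rewrite <- (RInt_Chasles (fun y => Q b' y - Q a' y) c' m d') by (apply ex_RInt_Q_diff; lra).
assert (E : RInt (fun x => P x c' - P x d') a' b' =
  RInt (fun x => P x c' - P x m) a' b' + RInt (fun x => P x m - P x d') a' b').
  rewrite <- (RInt_plus (V := R_CompleteNormedModule)) by (apply ex_RInt_P_diff; lra).
  apply RInt_ext; intros y _; unfold plus; simpl; ring.
rewrite E; unfold plus; simpl; ring.
Qed.

Let w (n : nat) := (b - a) / 2 ^ n.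
Let h (n : nat) := (d - c) / 2 ^ n.
Let K (n : nat) (p : R * R) :=
  Rabs (circulation P Q (fst p) (fst p + w n) (snd p) (snd p + h n)).
Let inside (n : nat) (p : R * R) :=
  a <= fst p /\ fst p + w n <= b /\ c <= snd p /\ snd p + h n <= d.

Lemma w_half n : w n = 2 * w (S n).
Proof. unfold w; simpl; field. apply pow_nonzero; lra. Qed.
Lemma h_half n : h n = 2 * h (S n).
Proof. unfold h; simpl; field. apply pow_nonzero; lra. Qed.
Lemma w_pos n : 0 <= w n.
Proof. unfold w; apply Rdiv_le_0_compat; [lra | apply pow_lt; lra]. Qed.
Lemma h_pos n : 0 <= h n.
Proof. unfold h; apply Rdiv_le_0_compat; [lra | apply pow_lt; lra]. Qed.

(** Halving both sides splits the circulation into four; the largest part is at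
    least a quarter of the whole. *)
Lemma worst_quarter n p : inside n p ->
  {q : R * R | inside (S n) q /\ K n p <= 4 * K (S n) q /\
     fst p <= fst q /\ fst q + w (S n) <= fst p + w n /\
     snd p <= snd q /\ snd q + h (S n) <= snd p + h n}.
Proof.
destruct p as [x y]; unfold inside, K; simpl fst; simpl snd; intros [H1 [H2 [H3 H4]]].
assert (Hw := w_half n); assert (Hh := h_half n).
assert (Hw0 := w_pos (S n)); assert (Hh0 := h_pos (S n)).
set (w' := w (S n)) in *; set (h' := h (S n)) in *.
assert (E : circulation P Q x (x + w n) y (y + h n) =
   circulation P Q x (x + w') y (y + h') +
   circulation P Q x (x + w') (y + h') (y + h' + h') +
   circulation P Q (x + w') (x + w' + w') y (y + h') +
   circulation P Q (x + w') (x + w' + w') (y + h') (y + h' + h')).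
  rewrite (circulation_split_x x (x + w') (x + w n)) by lra.
  rewrite (circulation_split_y x (x + w') y (y + h') (y + h n)) by lra.
  rewrite (circulation_split_y (x + w') (x + w n) y (y + h') (y + h n)) by lra.
  replace (x + w n) with (x + w' + w') by lra.
  replace (y + h n) with (y + h' + h') by lra. ring.
rewrite E; clear E.
set (k1 := circulation P Q x (x + w') y (y + h')).
set (k2 := circulation P Q x (x + w') (y + h') (y + h' + h')).
set (k3 := circulation P Q (x + w') (x + w' + w') y (y + h')).
set (k4 := circulation P Q (x + w') (x + w' + w') (y + h') (y + h' + h')).
assert (T : Rabs (k1 + k2 + k3 + k4) <= Rabs k1 + Rabs k2 + Rabs k3 + Rabs k4).
  repeat (apply Rle_trans with (1 := Rabs_triang _ _); apply Rplus_le_compat_r).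
  apply Rle_refl.
destruct (Rle_dec (Rabs (k1 + k2 + k3 + k4)) (4 * Rabs k1)) as [L1|L1].
  exists (x, y); simpl; fold k1; repeat split; try lra.
destruct (Rle_dec (Rabs (k1 + k2 + k3 + k4)) (4 * Rabs k2)) as [L2|L2].
  exists (x, y + h'); simpl; fold k2; repeat split; try lra.
destruct (Rle_dec (Rabs (k1 + k2 + k3 + k4)) (4 * Rabs k3)) as [L3|L3].
  exists (x + w', y); simpl; fold k3; repeat split; try lra.
exists (x + w', y + h'); simpl; fold k4; repeat split; try lra.
Qed.

Lemma nested_quarters : exists u : nat -> R * R,
  (forall n, inside n (u n) /\ K 0 (a, c) <= 4 ^ n * K n (u n)) /\
  (forall n, fst (u n) <= fst (u (S n)) /\ fst (u (S n)) + w (S n) <= fst (u n) + w n /\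
     snd (u n) <= snd (u (S n)) /\ snd (u (S n)) + h (S n) <= snd (u n) + h n).
Proof.
assert (I0 : inside 0 (a, c)).
  unfold inside, w, h; simpl; lra.
set (v := nat_rect (fun n => {p : R * R | inside n p}) (exist _ (a, c) I0)
  (fun n s => exist _ (proj1_sig (worst_quarter n _ (proj2_sig s)))
                (proj1 (proj2_sig (worst_quarter n _ (proj2_sig s)))))).
exists (fun n => proj1_sig (v n)).
assert (step : forall n, K n (proj1_sig (v n)) <= 4 * K (S n) (proj1_sig (v (S n))) /\
   fst (proj1_sig (v n)) <= fst (proj1_sig (v (S n))) /\
   fst (proj1_sig (v (S n))) + w (S n) <= fst (proj1_sig (v n)) + w n /\
   snd (proj1_sig (v n)) <= snd (proj1_sig (v (S n))) /\
   snd (proj1_sig (v (S n))) + h (S n) <= snd (proj1_sig (v n)) + h n).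
  intros n; exact (proj2 (proj2_sig (worst_quarter n _ (proj2_sig (v n))))).
split; [|intros n; apply step].
intros n; split; [exact (proj2_sig (v n))|].
induction n as [|n IH]; [simpl; lra|].
apply Rle_trans with (1 := IH).
replace (4 ^ S n) with (4 ^ n * 4) by (simpl; ring).
rewrite Rmult_assoc.
apply Rmult_le_compat_l; [apply pow_le; lra | apply step].
Qed.

Lemma nested_intervals (u l : nat -> R) :
  (forall n, 0 <= l n) ->
  (forall n, u n <= u (S n) /\ u (S n) + l (S n) <= u n + l n) ->
  exists x, forall n, u n <= x <= u n + l n.
Proof.
intros Hl Hu.
assert (G : forall n m, (n <= m)%nat -> u n <= u m /\ u m + l m <= u n + l n).
  intros n m Hnm; induction Hnm as [|m Hm IH]; [lra|].
  destruct (Hu m); lra.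
destruct (completeness (fun y => exists n, y = u n)) as [x [Hx1 Hx2]].
- exists (u 0%nat + l 0%nat). intros y [n ->].
  destruct (G 0%nat n (Nat.le_0_l n)); specialize (Hl n); lra.
- exists (u 0%nat); now exists 0%nat.
- exists x; intros n; split; [apply Hx1; now exists n|].
  apply Hx2; intros y [m ->].
  destruct (Nat.le_ge_cases n m) as [L|L]; destruct (G _ _ L).
    specialize (Hl m); lra. specialize (Hl n); lra.
Qed.

(** Up to the error of the affine approximation at (x, y), the two integrands are
    -k (d' - c') and k (b' - a'), whose integrals cancel. *)
Lemma small_circulation x y eps : a <= x <= b -> c <= y <= d -> 0 < eps ->
  exists delta, 0 < delta /\ forall a' b' c' d',
    a <= a' -> b' <= b -> c <= c' -> d' <= d ->
    a' <= x <= b' -> c' <= y <= d' -> b' - a' < delta -> d' - c' < delta ->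
    Rabs (circulation P Q a' b' c' d') <= eps * ((b' - a') + (d' - c')) ^ 2.
Proof.
intros Hx Hy He.
destruct (H x y Hx Hy) as [px [k [qy HH]]].
destruct (HH (eps / 2)) as [delta [Hd HD]]; [lra|].
exists delta; split; [exact Hd|].
intros a' b' c' d' Ha Hb Hc Hd' Hx' Hy' Hw Hh.
set (s := (b' - a') + (d' - c')).
assert (near : forall x' y', a' <= x' <= b' -> c' <= y' <= d' ->
  Rabs (P x' y' - P x y - (px * (x' - x) + k * (y' - y))) <= eps / 2 * s /\
  Rabs (Q x' y' - Q x y - (k * (x' - x) + qy * (y' - y))) <= eps / 2 * s).
  intros x' y' Hx'' Hy''.
  assert (Lx : Rabs (x' - x) <= b' - a') by (apply Rabs_le; lra).
  assert (Ly : Rabs (y' - y) <= d' - c') by (apply Rabs_le; lra).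
  destruct (HD x' y') as [D1 D2]; [lra | lra |].
  assert (eps / 2 * (Rabs (x' - x) + Rabs (y' - y)) <= eps / 2 * s).
    apply Rmult_le_compat_l; unfold s; lra.
  lra.
assert (I1 : Rabs (RInt (fun t => P t c' - P t d') a' b' - (k * (c' - d')) * (b' - a'))
    <= eps * s * (b' - a')).
  apply RInt_near_constant; [lra | apply ex_RInt_P_diff; lra |].
  intros t Ht.
  destruct (near t c') as [N1 _]; [lra | lra |].
  destruct (near t d') as [N2 _]; [lra | lra |].
  apply Rabs_le_between in N1; apply Rabs_le_between in N2; apply Rabs_le_between; lra.
assert (I2 : Rabs (RInt (fun t => Q b' t - Q a' t) c' d' - (k * (b' - a')) * (d' - c'))
    <= eps * s * (d' - c')).
  apply RInt_near_constant; [lra | apply ex_RInt_Q_diff; lra |].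
  intros t Ht.
  destruct (near b' t) as [_ N1]; [lra | lra |].
  destruct (near a' t) as [_ N2]; [lra | lra |].
  apply Rabs_le_between in N1; apply Rabs_le_between in N2; apply Rabs_le_between; lra.
unfold circulation.
apply Rabs_le_between in I1; apply Rabs_le_between in I2; apply Rabs_le_between.
replace (eps * s ^ 2) with (eps * s * (b' - a') + eps * s * (d' - c')) by (unfold s; ring).
lra.
Qed.

(** The circulation shrinks at most by 4 at each bisection, while by
    [small_circulation] it is o(4^-n) near the common point of the rectangles. *)
Lemma circulation_closed_form : circulation P Q a b c d = 0.
Proof.
destruct nested_quarters as [u [Hin Hnest]].
destruct (nested_intervals (fun n => fst (u n)) w w_pos) as [x Hx].
  intros n; split; apply (Hnest n).
destruct (nested_intervals (fun n => snd (u n)) h h_pos) as [y Hy].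
  intros n; split; apply (Hnest n).
assert (E : K 0 (a, c) = Rabs (circulation P Q a b c d)).
  unfold K, w, h; simpl. do 2 f_equal; field.
assert (Z : K 0 (a, c) <= 0).
  apply le_epsilon; intros eps Heps.
  set (s := (b - a) + (d - c)).
  assert (Hs : 0 <= s) by (unfold s; lra).
  assert (He : 0 < eps / (s ^ 2 + 1)) by (apply Rdiv_lt_0_compat; [lra|nra]).
  destruct (small_circulation x y (eps / (s ^ 2 + 1))) as [delta [Hd HD]].
  - destruct (Hin 0%nat) as [[I1 [I2 [I3 I4]]] _]; specialize (Hx 0%nat); simpl in Hx; lra.
  - destruct (Hin 0%nat) as [[I1 [I2 [I3 I4]]] _]; specialize (Hy 0%nat); simpl in Hy; lra.
  - exact He.
  - destruct (pow_lt_1_zero (1 / 2)) with (delta / (s + 1)) as [n Hn].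
      rewrite Rabs_pos_eq; lra.
      apply Rdiv_lt_0_compat; lra.
    specialize (Hn n (Nat.le_refl n)).
    rewrite Rabs_pos_eq in Hn by (apply pow_le; lra).
    assert (H2n : 0 < 2 ^ n) by (apply pow_lt; lra).
    assert (En : (1 / 2) ^ n = / 2 ^ n).
      unfold Rdiv; rewrite Rpow_mult_distr, pow1, Rmult_1_l; symmetry; now rewrite pow_inv.
    rewrite En in Hn.
    assert (Hn' : (s + 1) * / 2 ^ n < delta).
      apply Rlt_le_trans with ((s + 1) * (delta / (s + 1))).
        apply Rmult_lt_compat_l; lra.
      right; field; lra.
    assert (Hi : 0 < / 2 ^ n) by now apply Rinv_0_lt_compat.
    destruct (Hin n) as [[I1 [I2 [I3 I4]]] I5].
    specialize (Hx n); specialize (Hy n); cbv beta in Hx, Hy.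
    apply Rle_trans with (1 := I5).
    assert (B : K n (u n) <= eps / (s ^ 2 + 1) * (w n + h n) ^ 2).
      unfold K.
      replace (w n + h n) with ((fst (u n) + w n - fst (u n)) + (snd (u n) + h n - snd (u n))) by ring.
      apply HD; try lra.
      - replace (fst (u n) + w n - fst (u n)) with ((b - a) * / 2 ^ n) by (unfold w, Rdiv; ring).
        unfold s in Hn'; nra.
      - replace (snd (u n) + h n - snd (u n)) with ((d - c) * / 2 ^ n) by (unfold h, Rdiv; ring).
        unfold s in Hn'; nra.
    apply Rle_trans with (4 ^ n * (eps / (s ^ 2 + 1) * (w n + h n) ^ 2)).
      apply Rmult_le_compat_l; [apply pow_le; lra | exact B].
    replace (4 ^ n * (eps / (s ^ 2 + 1) * (w n + h n) ^ 2)) with (eps * (s ^ 2 / (s ^ 2 + 1))).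
    + assert (Hs2 := pow2_ge_0 s).
      assert (s ^ 2 / (s ^ 2 + 1) <= 1).
        apply Rmult_le_reg_r with (s ^ 2 + 1); [nra|].
        unfold Rdiv; rewrite Rmult_assoc, Rinv_l; lra.
      nra.
    + replace 4 with (2 * 2) by ring; rewrite Rpow_mult_distr.
      unfold w, h, s. field; split; [lra | nra].
rewrite E in Z.
generalize (Rabs_pos (circulation P Q a b c d)); intros Z'.
apply Rabs_eq_0; lra.
Qed.
End Goursat.

(** * Complex differentiability *)

Notation holo := (@ex_derive C_AbsRing C_NormedModule).

Lemma holo_iff (f : C -> C) (z : C) : holo f z <->
  exists l : C, forall eps, 0 < eps -> exists delta, 0 < delta /\
    forall y, Cmod (y - z) < delta ->
      Cmod (f y - f z - (y - z) * l) <= eps * Cmod (y - z).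
Proof.
split.
- intros [l [_ H]]; exists l; intros eps He.
  destruct (H z (fun P HP => HP) (mkposreal eps He)) as [delta Hd].
  exists delta; split; [apply cond_pos|].
  intros y Hy; exact (Hd y Hy).
- intros [l H]; exists l; split; [apply is_linear_scal_l|].
  intros x Hx eps.
  apply (is_filter_lim_locally_unique (V := AbsRing_NormedModule C_AbsRing)) in Hx; subst x.
  destruct (H eps (cond_pos eps)) as [delta [Hd HD]].
  exists (mkposreal delta Hd); intros y Hy; exact (HD y Hy).
Qed.

Lemma holo_const (c z : C) : holo (fun _ => c) z.
Proof. apply ex_derive_const. Qed.

Lemma holo_id (z : C) : holo (fun y => y) z.
Proof.
apply holo_iff; exists (RtoC 1); intros eps He; exists 1; split; [lra|].
intros y _; replace (y - z - (y - z) * 1)%C with (RtoC 0) by ring.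
rewrite Cmod_0; apply Rmult_le_pos; [lra | apply Cmod_ge_0].
Qed.

Lemma holo_plus (f g : C -> C) (z : C) :
  holo f z -> holo g z -> holo (fun y => (f y + g y)%C) z.
Proof. intros Hf Hg; exact (ex_derive_plus f g z Hf Hg). Qed.

(** The two structures on C as a normed space carry different, though equivalent,
    neighbourhoods; the derivative of a function only sees the norm of its values. *)
Lemma is_derive_C_AbsRing (f : C -> C) (z l : C) :
  is_derive (K := C_AbsRing) (V := C_NormedModule) f z l <->
  is_derive (K := C_AbsRing) (V := AbsRing_NormedModule C_AbsRing) f z l.
Proof.
split; intros [[L1 L2 L3] D];
  (split; [constructor; [exact L1 | exact L2 | exact L3] | exact D]).
Qed.

Lemma holo_mult (f g : C -> C) (z : C) :
  holo f z -> holo g z -> holo (fun y => (f y * g y)%C) z.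
Proof.
intros [f' Hf] [g' Hg]; eexists.
apply is_derive_C_AbsRing in Hf; apply is_derive_C_AbsRing in Hg; apply is_derive_C_AbsRing.
exact (is_derive_mult (K := C_AbsRing) f g z f' g' Hf Hg Cmult_comm).
Qed.

Lemma holo_opp (f : C -> C) (z : C) : holo f z -> holo (fun y => (- f y)%C) z.
Proof. intros Hf; exact (ex_derive_opp f z Hf). Qed.

Lemma holo_minus (f g : C -> C) (z : C) :
  holo f z -> holo g z -> holo (fun y => (f y - g y)%C) z.
Proof. intros Hf Hg; apply holo_plus; [exact Hf | now apply holo_opp]. Qed.

Lemma holo_comp (f g : C -> C) (z : C) :
  holo f (g z) -> holo g z -> holo (fun y => f (g y)) z.
Proof.
intros Hf [g' Hg]; apply is_derive_C_AbsRing in Hg.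
exact (ex_derive_comp (K := C_AbsRing) f g z Hf (ex_intro _ g' Hg)).
Qed.

Lemma holo_pow (f : C -> C) (n : nat) (z : C) : holo f z -> holo (fun y => (f y ^ n)%C) z.
Proof.
intros Hf; induction n as [|n IH]; simpl; [apply holo_const | now apply holo_mult].
Qed.

Lemma holo_ext_near (f g : C -> C) (z : C) :
  (exists delta, 0 < delta /\ forall y, Cmod (y - z) < delta -> f y = g y) ->
  holo f z -> holo g z.
Proof.
intros [delta [Hd H]]; apply ex_derive_ext_loc.
exists (mkposreal delta Hd); intros y Hy; exact (H y Hy).
Qed.

Lemma Cinv_neq_0 (z : C) : z <> 0 -> (/ z)%C <> 0.
Proof.
intros Hz E; apply C1_nz; rewrite <- (Cinv_r z Hz), E; ring.
Qed.

Lemma Cmod_pos (z : C) : z <> 0 -> 0 < Cmod z.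
Proof. apply Cmod_gt_0. Qed.

Lemma Cmod_minus_sym (x y : C) : Cmod (x - y) = Cmod (y - x).
Proof. rewrite <- Cmod_opp; f_equal; ring. Qed.

Lemma Cmod_reverse_triangle (x y : C) : Cmod x - Cmod y <= Cmod (x - y).
Proof.
assert (T := Cmod_triangle (x - y) y).
replace (x - y + y)%C with x in T by ring. lra.
Qed.

Lemma holo_inv_id (z : C) : z <> 0 -> holo Cinv z.
Proof.
intros Hz; apply holo_iff; exists (- (/ z * / z))%C.
assert (Hm := Cmod_pos z Hz).
intros eps He.
exists (Rmin (Cmod z / 2) (eps * Cmod z ^ 3 / 2)); split.
  apply Rmin_glb_lt; [lra|]; apply Rdiv_lt_0_compat; [|lra].
  apply Rmult_lt_0_compat; [exact He | now apply pow_lt].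
intros y Hy.
assert (H1 := Rlt_le_trans _ _ _ Hy (Rmin_l _ _)).
assert (H2 := Rlt_le_trans _ _ _ Hy (Rmin_r _ _)).
assert (Hy2 : Cmod z / 2 < Cmod y).
  assert (T := Cmod_reverse_triangle z y); rewrite Cmod_minus_sym in T; lra.
assert (Hy0 : y <> 0) by (apply Cmod_gt_0; lra).
replace (/ y - / z - (y - z) * - (/ z * / z))%C
   with ((y - z) * (y - z) * (/ y * (/ z * / z)))%C by (field; auto).
rewrite !Cmod_mult, !Cmod_inv by assumption.
rewrite (Rmult_comm eps), Rmult_assoc.
apply Rmult_le_compat_l; [apply Cmod_ge_0|].
apply Rle_trans with (eps * Cmod z ^ 3 / 2 * (/ (Cmod z / 2) * (/ Cmod z * / Cmod z))).
- apply Rmult_le_compat; try lra; try apply Cmod_ge_0.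
  + apply Rmult_le_pos; [|apply Rmult_le_pos]; left; apply Rinv_0_lt_compat; lra.
  + apply Rmult_le_compat_r.
      apply Rmult_le_pos; left; apply Rinv_0_lt_compat; lra.
    apply Rinv_le_contravar; lra.
- right; field; lra.
Qed.

Lemma holo_div (f g : C -> C) (z : C) :
  holo f z -> holo g z -> g z <> 0 -> holo (fun y => (f y / g y)%C) z.
Proof.
intros Hf Hg Hz; apply holo_mult; [exact Hf|].
apply (holo_comp Cinv g); [now apply holo_inv_id | exact Hg].
Qed.

Lemma holo_bounded_near (f : C -> C) (z : C) : holo f z ->
  exists l delta, 0 < delta /\ forall y, Cmod (y - z) < delta ->
    Cmod (f y - f z) <= l * Cmod (y - z).
Proof.
rewrite holo_iff; intros [l H].
destruct (H 1 Rlt_0_1) as [delta [Hd HD]].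
exists (1 + Cmod l), delta; split; [exact Hd|].
intros y Hy; specialize (HD y Hy).
replace (f y - f z)%C with ((f y - f z - (y - z) * l) + (y - z) * l)%C by ring.
apply Rle_trans with (1 := Cmod_triangle _ _); rewrite Cmod_mult.
lra.
Qed.

Lemma holo_continuous (f : C -> C) (z : C) : holo f z ->
  forall eps, 0 < eps -> exists delta, 0 < delta /\ forall y,
    Cmod (y - z) < delta -> Cmod (f y - f z) < eps.
Proof.
intros Hf eps He.
destruct (holo_bounded_near f z Hf) as [l [delta [Hd H]]].
assert (Hl : 0 < Rabs l + 1) by (generalize (Rabs_pos l); lra).
exists (Rmin delta (eps / (Rabs l + 1))); split.
  apply Rmin_glb_lt; [exact Hd | now apply Rdiv_lt_0_compat].
intros y Hy.
assert (H1 := Rlt_le_trans _ _ _ Hy (Rmin_l _ _)).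
assert (H2 := Rlt_le_trans _ _ _ Hy (Rmin_r _ _)).
apply Rle_lt_trans with (1 := H y H1).
apply Rle_lt_trans with ((Rabs l + 1) * Cmod (y - z)).
  apply Rmult_le_compat_r; [apply Cmod_ge_0 | generalize (Rle_abs l); lra].
apply Rlt_le_trans with ((Rabs l + 1) * (eps / (Rabs l + 1))).
  now apply Rmult_lt_compat_l.
right; field; lra.
Qed.

(** * The mean value inequality on circles *)

(** The complex exponential of x + i y. *)
Definition polar (x y : R) : C := (exp x * cos y, exp x * sin y).

Lemma Cmod_polar x y : Cmod (polar x y) = exp x.
Proof.
unfold Cmod, polar; simpl fst; simpl snd.
replace ((exp x * cos y) ^ 2 + (exp x * sin y) ^ 2) with (exp x ^ 2).
  apply sqrt_pow2; left; apply exp_pos.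
assert (E := sin2_cos2 y); unfold Rsqr in E.
replace ((exp x * cos y) ^ 2 + (exp x * sin y) ^ 2)
  with (exp x ^ 2 * (sin y * sin y + cos y * cos y)) by ring.
rewrite E; ring.
Qed.

Lemma polar_plus x y h k : polar (x + h) (y + k) = (polar x y * polar h k)%C.
Proof.
unfold polar, Cmult; simpl; rewrite exp_plus, cos_plus, sin_plus.
f_equal; ring.
Qed.

Lemma im_le_Cmod (c : C) : Rabs (Im c) <= Cmod c.
Proof. apply Rle_trans with (2 := Rmax_Cmod c); apply Rmax_r. Qed.

Lemma Cmod_le_sum (x y : R) : Cmod (x, y) <= Rabs x + Rabs y.
Proof.
replace (x, y) with (RtoC x + RtoC y * Ci)%C.
  apply Rle_trans with (1 := Cmod_triangle _ _).
  rewrite Cmod_mult, Cmod_Ci, !Cmod_R; lra.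
unfold Cplus, Cmult, RtoC, Ci; simpl; f_equal; ring.
Qed.

Lemma derivable_near (f : R -> R) (l : R) : derivable_pt_lim f 0 l ->
  forall eps, 0 < eps -> exists delta, 0 < delta /\ forall h, Rabs h < delta ->
    Rabs (f h - f 0 - l * h) <= eps * Rabs h.
Proof.
intros H eps He; destruct (H eps He) as [delta Hd].
exists delta; split; [apply cond_pos|]; intros h Hh.
destruct (Req_dec h 0) as [->|Hh0].
  rewrite Rabs_R0, Rmult_0_r, Rminus_diag, Rmult_0_r, Rminus_diag, Rabs_R0; lra.
specialize (Hd h Hh0 Hh); rewrite Rplus_0_l in Hd.
replace (f h - f 0 - l * h) with (((f h - f 0) / h - l) * h) by (field; auto).
rewrite Rabs_mult; apply Rmult_le_compat_r; [apply Rabs_pos | lra].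
Qed.

Lemma polar_near_0 eps : 0 < eps -> exists delta, 0 < delta /\
  forall h k, Rabs h < delta -> Rabs k < delta ->
    Cmod (polar h k - 1 - (h, k)) <= eps * (Rabs h + Rabs k).
Proof.
intros He.
(* The error terms collected at the end add up to at most 7 e |k| + e |h|. *)
set (e := Rmin 1 (eps / 7)).
assert (e0 : 0 < e) by (apply Rmin_glb_lt; lra).
assert (e1 : e <= 1) by apply Rmin_l.
assert (e7 : e <= eps / 7) by apply Rmin_r.
destruct (derivable_near exp 1) with e as [d1 [Hd1 H1]]; [|exact e0|].
  rewrite <- exp_0; apply derivable_pt_lim_exp.
destruct (derivable_near cos 0) with e as [d2 [Hd2 H2]]; [|exact e0|].
  replace 0 with (- sin 0) at 2 by (rewrite sin_0; ring); apply derivable_pt_lim_cos.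
destruct (derivable_near sin 1) with e as [d3 [Hd3 H3]]; [|exact e0|].
  rewrite <- cos_0; apply derivable_pt_lim_sin.
exists (Rmin (Rmin e d1) (Rmin d2 d3)); split.
  apply Rmin_glb_lt; apply Rmin_glb_lt; assumption.
intros h k Hh Hk.
apply Rmin_Rgt_l in Hh; destruct Hh as [Hh _]; apply Rmin_Rgt_l in Hh; destruct Hh as [Hhe Hh1].
apply Rmin_Rgt_l in Hk; destruct Hk as [Hke Hk]; apply Rmin_Rgt_l in Hk; destruct Hk as [Hk2 Hk3].
apply Rmin_Rgt_l in Hke; destruct Hke as [Hke _].
specialize (H1 h Hh1); specialize (H2 k Hk2); specialize (H3 k Hk3).
rewrite exp_0 in H1; rewrite cos_0 in H2; rewrite sin_0 in H3.
set (u := exp h - 1 - 1 * h) in *; set (v := cos k - 1 - 0 * k) in *;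
  set (w := sin k - 0 - 1 * k) in *.
replace (polar h k - 1 - (h, k))%C
  with ((u * cos k + h * v + v, (u + h) * sin k + w) : C).
2: unfold polar, Cminus, Cplus, Copp, RtoC; simpl; unfold u, v, w; f_equal; ring.
apply Rle_trans with (1 := Cmod_le_sum _ _).
assert (Ha := Rabs_pos h); assert (Hb := Rabs_pos k).
assert (C1 : Rabs (cos k) <= 1) by (apply Rabs_le, COS_bound).
assert (S1 : Rabs (sin k) <= 2 * Rabs k).
  replace (sin k) with (w + k) by (unfold w; ring).
  apply Rle_trans with (1 := Rabs_triang _ _); nra.
assert (U1 : Rabs (u * cos k) <= e * Rabs h).
  rewrite Rabs_mult; assert (X := Rabs_pos u); nra.
assert (U2 : Rabs (h * v) <= e * Rabs k).
  rewrite Rabs_mult; assert (X := Rabs_pos v); nra.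
assert (U3 : Rabs ((u + h) * sin k) <= 4 * e * Rabs k).
  rewrite Rabs_mult.
  assert (X : Rabs (u + h) <= 2 * Rabs h).
    apply Rle_trans with (1 := Rabs_triang _ _); nra.
  assert (X' := Rabs_pos (u + h)); assert (X'' := Rabs_pos (sin k)).
  apply Rle_trans with (2 * Rabs h * (2 * Rabs k)); [nra|].
  assert (Rabs h * Rabs k <= e * Rabs k) by nra. nra.
assert (T1 := Rabs_triang (u * cos k + h * v) v).
assert (T2 := Rabs_triang (u * cos k) (h * v)).
assert (T3 := Rabs_triang ((u + h) * sin k) w).
apply Rle_trans with (e * Rabs h + 7 * e * Rabs k); [lra|].
nra.
Qed.

(** With u + i v = H(exp(x + i y)), the form v dx + u dy is closed by the
    Cauchy-Riemann equations. *)
Lemma holo_polar_closed_form (H : C -> C) (x0 y0 : R) : holo H (polar x0 y0) ->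
  closed_form_at (fun x y => Im (H (polar x y))) (fun x y => Re (H (polar x y))) x0 y0.
Proof.
intros HH; apply holo_iff in HH; destruct HH as [D HD].
set (z0 := polar x0 y0) in *.
assert (Hz0 : 0 < Cmod z0) by (unfold z0; rewrite Cmod_polar; apply exp_pos).
exists (Im (D * z0)), (Re (D * z0)), (- Im (D * z0)).
intros eps He.
set (A := Cmod D * Cmod z0 + 1).
assert (HA : 1 <= A).
  unfold A; assert (X := Rmult_le_pos _ _ (Cmod_ge_0 D) (Cmod_ge_0 z0)); lra.
set (e1 := Rmin 1 (eps / (2 * A))).
assert (He1 : 0 < e1) by (apply Rmin_glb_lt; [lra | apply Rdiv_lt_0_compat; lra]).
set (e2 := eps / (4 * Cmod z0)).
assert (He2 : 0 < e2) by (apply Rdiv_lt_0_compat; lra).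
destruct (polar_near_0 e1 He1) as [d1 [Hd1 H1]].
destruct (HD e2 He2) as [d2 [Hd2 H2]].
assert (Hd3 : 0 < d2 / (4 * Cmod z0)) by (apply Rdiv_lt_0_compat; lra).
exists (Rmin d1 (d2 / (4 * Cmod z0))); split; [now apply Rmin_glb_lt|].
intros x y Hx Hy.
apply Rmin_Rgt_l in Hx; destruct Hx as [Hx1 Hx2].
apply Rmin_Rgt_l in Hy; destruct Hy as [Hy1 Hy2].
set (h := x - x0) in *; set (k := y - y0) in *.
specialize (H1 h k Hx1 Hy1).
set (E := (polar h k - 1 - (h, k))%C) in *.
set (s := Rabs h + Rabs k) in *.
assert (Hs : 0 <= s) by (unfold s; generalize (Rabs_pos h) (Rabs_pos k); lra).
assert (EE : (polar x y - z0 = z0 * ((h, k) + E))%C).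
  replace x with (x0 + h) by (unfold h; ring).
  replace y with (y0 + k) by (unfold k; ring).
  rewrite polar_plus; fold z0; unfold E; ring.
assert (Hhk : Cmod (h, k) <= s) by apply Cmod_le_sum.
assert (HE : Cmod E <= s).
  apply Rle_trans with (1 := H1); assert (e1 <= 1) by apply Rmin_l; nra.
assert (Hdist : Cmod (polar x y - z0) <= 2 * Cmod z0 * s).
  rewrite EE, Cmod_mult; assert (T := Cmod_triangle (h, k) E); nra.
assert (Hsmall : Cmod (polar x y - z0) < d2).
  apply Rle_lt_trans with (1 := Hdist).
  assert (s < 2 * (d2 / (4 * Cmod z0))) by (unfold s; lra).
  apply Rlt_le_trans with (2 * Cmod z0 * (2 * (d2 / (4 * Cmod z0)))).
    apply Rmult_lt_compat_l; lra.
  right; field; lra.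
specialize (H2 _ Hsmall).
set (Rm := (H (polar x y) - H z0 - (polar x y - z0) * D)%C) in *.
assert (main : Cmod (H (polar x y) - H z0 - D * z0 * (h, k)) <= eps * s).
  replace (H (polar x y) - H z0 - D * z0 * (h, k))%C with (D * z0 * E + Rm)%C.
  2: unfold Rm; rewrite EE; ring.
  apply Rle_trans with (1 := Cmod_triangle _ _).
  rewrite !Cmod_mult.
  assert (X1 : Cmod D * Cmod z0 * Cmod E <= eps / 2 * s).
    assert (Y : A * e1 <= eps / 2).
      apply Rle_trans with (A * (eps / (2 * A))).
        apply Rmult_le_compat_l; [lra | apply Rmin_r].
      right; field; lra.
    apply Rle_trans with (A * (e1 * s)).
      apply Rmult_le_compat; try lra; try apply Cmod_ge_0.
        apply Rmult_le_pos; apply Cmod_ge_0.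
      unfold A; lra.
    rewrite <- Rmult_assoc; now apply Rmult_le_compat_r.
  assert (X2 : Cmod Rm <= eps / 2 * s).
    apply Rle_trans with (1 := H2).
    apply Rle_trans with (e2 * (2 * Cmod z0 * s)).
      apply Rmult_le_compat_l; lra.
    right; unfold e2; field; lra.
  lra.
set (q := (H (polar x y) - H z0 - D * z0 * (h, k))%C) in *.
split; change (polar x0 y0) with z0.
- apply Rle_trans with (2 := main).
  assert (Eq : Im (H (polar x y)) - Im (H z0) - (Im (D * z0) * h + Re (D * z0) * k) = Im q)
    by (unfold q; destruct (H (polar x y)), (H z0), (D * z0)%C; simpl; ring).
  rewrite Eq.
  apply im_le_Cmod.
- apply Rle_trans with (2 := main).
  assert (Eq : Re (H (polar x y)) - Re (H z0) - (Re (D * z0) * h + - Im (D * z0) * k) = Re q)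
    by (unfold q; destruct (H (polar x y)), (H z0), (D * z0)%C; simpl; ring).
  rewrite Eq.
  apply re_le_Cmod.
Qed.

(** The form v dx + u dy attached to H(exp(x + i y)) has zero circulation along
    [ln r, ln rho] x [0, 2 PI], and the horizontal sides cancel by periodicity; so the
    integral of Re H over the circle of radius rho equals that over a small circle
    of radius r, where Re H is almost Re (H 0). *)
Lemma Re_center_le (H : C -> C) (rho M : R) :
  0 < rho -> (forall z, Cmod z <= rho -> holo H z) ->
  (forall z, Cmod z = rho -> Re (H z) <= M) -> Re (H 0) <= M.
Proof.
intros Hrho HH HM.
apply le_epsilon; intros eps He.
destruct (holo_continuous H 0 (HH _ ltac:(rewrite Cmod_0; lra)) eps He) as [d [Hd Hc]].
set (r := Rmin (d / 2) rho).
assert (Hr : 0 < r) by (apply Rmin_glb_lt; lra).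
assert (Hrr : r <= rho) by apply Rmin_r.
assert (Hrd : r < d) by (apply Rle_lt_trans with (d / 2); [apply Rmin_l | lra]).
assert (Hln : ln r <= ln rho) by (destruct Hrr as [L | ->]; [left; now apply ln_increasing | lra]).
assert (Hpi : 0 < 2 * PI) by (generalize PI_RGT_0; lra).
set (P := fun x y => Im (H (polar x y))).
set (Q := fun x y => Re (H (polar x y))).
assert (Hcf : forall x y, ln r <= x <= ln rho -> 0 <= y <= 2 * PI -> closed_form_at P Q x y).
  intros x y Hx _; apply holo_polar_closed_form, HH.
  rewrite Cmod_polar, <- (exp_ln rho Hrho).
  destruct (proj2 Hx) as [L| ->]; [left; now apply exp_increasing | lra].
assert (Z := circulation_closed_form P Q (ln r) (ln rho) 0 (2 * PI) Hln (Rlt_le _ _ Hpi) Hcf).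
unfold circulation in Z.
(* The two horizontal sides agree because exp has period 2 PI i. *)
rewrite (RInt_ext _ (fun _ => 0)) in Z.
2:{ intros x _; unfold P, polar; rewrite cos_0, sin_0, cos_2PI, sin_2PI; apply Rminus_diag. }
rewrite RInt_const in Z; unfold scal in Z; simpl in Z; unfold mult in Z; simpl in Z.
rewrite Rmult_0_r, Rplus_0_l in Z.
assert (B : RInt (fun y => Q (ln rho) y - Q (ln r) y) 0 (2 * PI)
   <= RInt (fun _ => M + eps - Re (H 0)) 0 (2 * PI)).
  apply RInt_le; [lra | | apply ex_RInt_const |].
    apply (ex_RInt_Q_diff P Q (ln r) (ln rho) 0 (2 * PI) Hcf); lra.
  intros y _; unfold Q.
  assert (L1 : Re (H (polar (ln rho) y)) <= M).
    apply HM; rewrite Cmod_polar; now apply exp_ln.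
  assert (L2 : Cmod (H (polar (ln r) y) - H 0) < eps).
    apply Hc; replace (polar (ln r) y - 0)%C with (polar (ln r) y) by ring.
    rewrite Cmod_polar, exp_ln; assumption.
  assert (L3 := re_le_Cmod (H (polar (ln r) y) - H 0)).
  apply Rabs_le_between in L3.
  replace (Re (H (polar (ln r) y) - H 0)) with (Re (H (polar (ln r) y)) - Re (H 0)) in L3
    by (destruct (H (polar (ln r) y)), (H 0); simpl; ring).
  lra.
rewrite Z, RInt_const in B; unfold scal in B; simpl in B; unfold mult in B; simpl in B.
nra.
Qed.

(** Rotate the values so that H 0 becomes a nonnegative real number. *)
Lemma Cmod_center_le (H : C -> C) (rho M : R) :
  0 < rho -> (forall z, Cmod z <= rho -> holo H z) ->
  (forall z, Cmod z = rho -> Cmod (H z) <= M) -> Cmod (H 0) <= M.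
Proof.
intros Hrho HH HM.
destruct (Req_dec (Cmod (H 0)) 0) as [E|E].
  rewrite E; apply Rle_trans with (Cmod (H (RtoC rho))); [apply Cmod_ge_0|].
  apply HM; rewrite Cmod_R; apply Rabs_pos_eq; lra.
assert (Hp : 0 < Cmod (H 0)) by (generalize (Cmod_ge_0 (H 0)); lra).
apply Rmult_le_reg_l with (Cmod (H 0)); [exact Hp|].
assert (X : Re (Cconj (H 0) * H 0) <= Cmod (H 0) * M).
  apply (Re_center_le (fun z => Cconj (H 0) * H z)%C rho); [exact Hrho | |].
    intros z Hz; apply holo_mult; [apply holo_const | now apply HH].
  intros z Hz; apply Rle_trans with (Cmod (Cconj (H 0) * H z)).
    apply Rle_trans with (2 := re_le_Cmod _); apply Rle_abs.
  rewrite Cmod_mult, Cmod_conj; apply Rmult_le_compat_l; [lra | now apply HM].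
rewrite Cmult_comm, <- Cmod2_conj in X.
replace (Re (Cmod (H 0) ^ 2)) with (Cmod (H 0) ^ 2) in X.
  simpl in X; lra.
rewrite <- RtoC_pow; reflexivity.
Qed.

Open Scope C_scope.

(** * A maximum principle that ignores finitely many points *)

Definition root_product (E : list C) (z : C) : C :=
  fold_right (fun e acc => (z - e) * acc) 1 E.

Lemma Cmod_le_1_minus (z e : C) : (Cmod z <= 1 -> Cmod (z - e) <= 1 + Cmod e)%R.
Proof.
intros Hz; assert (T := Cmod_triangle z (- e)); rewrite Cmod_opp in T.
unfold Cminus; lra.
Qed.

Lemma root_product_bounded (E : list C) :
  exists Q : R, (0 < Q)%R /\
    (forall z, (Cmod z <= 1)%R -> (Cmod (root_product E z) <= Q)%R) /\
    (forall e z, In e E -> (Cmod z <= 1)%R ->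
       (Cmod (root_product E z) <= Q * Cmod (z - e))%R).
Proof.
induction E as [|e E [Q [HQ [H1 H2]]]]; simpl.
  exists 1%R; split; [lra|]; split; [intros z _; rewrite Cmod_1; lra | intros e z []].
assert (He := Cmod_ge_0 e).
exists ((1 + Cmod e) * Q)%R; split; [|split].
- apply Rmult_lt_0_compat; lra.
- intros z Hz; rewrite Cmod_mult.
  apply Rmult_le_compat; auto using Cmod_ge_0, Cmod_le_1_minus.
- intros e' z He' Hz; rewrite Cmod_mult.
  assert (H0 := Cmod_ge_0 (z - e)).
  destruct He' as [<-|He'].
  + specialize (H1 z Hz).
    assert (X := Rmult_le_pos _ _ He (Rmult_le_pos _ _ (Rlt_le _ _ HQ) H0)).
    assert (Y := Rmult_le_compat_l _ _ _ H0 H1). lra.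
  + rewrite Rmult_assoc.
    apply Rmult_le_compat; auto using Cmod_ge_0, Cmod_le_1_minus.
Qed.

Lemma root_product_neq_0 (E : list C) (z : C) : ~ In z E -> root_product E z <> 0.
Proof.
induction E as [|e E IH]; simpl; intros H; [apply C1_nz|].
apply Cmult_neq_0; [|tauto].
intros E0; apply H; left; symmetry; now apply Ceq_minus.
Qed.

Lemma holo_root_product (E : list C) (z : C) : holo (root_product E) z.
Proof.
induction E as [|e E IH]; simpl; [apply holo_const|].
apply holo_mult; [|exact IH]; apply holo_minus; [apply holo_id | apply holo_const].
Qed.

Lemma finite_complement_open (E : list C) (z : C) : ~ In z E ->
  exists delta : R, (0 < delta)%R /\ forall y, (Cmod (y - z) < delta)%R -> ~ In y E.
Proof.
induction E as [|e E IH]; simpl; intros H.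
  exists 1%R; split; [lra | tauto].
destruct IH as [d [Hd HD]]; [tauto|].
assert (He : (0 < Cmod (e - z))%R).
  apply Cmod_pos; intros E0; apply H; left; now apply Ceq_minus.
exists (Rmin d (Cmod (e - z))); split; [now apply Rmin_glb_lt|].
intros y Hy [->|HyE].
  apply (Rlt_irrefl (Cmod (y - z))), (Rlt_le_trans _ _ _ Hy), Rmin_r.
now apply (HD y); [apply (Rlt_le_trans _ _ _ Hy), Rmin_l|].
Qed.

Lemma unit_disc_open (z : C) : unit_disc z ->
  exists delta : R, (0 < delta)%R /\ forall y, (Cmod (y - z) < delta)%R -> unit_disc y.
Proof.
unfold unit_disc; intros Hz; exists (1 - Cmod z)%R; split; [lra|].
intros y Hy; assert (T := Cmod_reverse_triangle y z); lra.
Qed.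

Lemma pow_bounded_le_1 (x K : R) : (forall n, x ^ n <= K)%R -> (x <= 1)%R.
Proof.
intros H; destruct (Rle_or_lt x 1) as [L|L]; [exact L|].
destruct (Pow_x_infinity x) with (b := (Rabs K + 1)%R) as [n Hn].
  rewrite Rabs_pos_eq; lra.
specialize (Hn n (Nat.le_refl n)); specialize (H n).
rewrite Rabs_pos_eq in Hn by (apply pow_le; lra).
generalize (Rle_abs K); lra.
Qed.

Section RemovableMaximum.
Variables (G : C -> C) (E : list C) (B : R).
Hypothesis holo_G : forall z, unit_disc z -> ~ In z E -> holo G z.
Hypothesis bound_G : forall z, unit_disc z -> ~ In z E -> (Cmod (G z) <= B)%R.

Let H (n : nat) (z : C) : C :=
  if in_dec Ceq_dec z E then RtoC 0 else G z ^ n * root_product E z ^ 2.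

(** At a point e of E the function is O(|z - e|^2), so its derivative there is 0. *)
Lemma holo_filled (n : nat) (z : C) : unit_disc z -> holo (H n) z.
Proof.
intros Hz; destruct (in_dec Ceq_dec z E) as [HE|HE].
- destruct (root_product_bounded E) as [Q [HQ [_ H2]]].
  destruct (unit_disc_open z Hz) as [d [Hd HD]].
  set (L := (Rabs B ^ n * (Q * Q) + 1)%R).
  assert (HB : (0 <= Rabs B ^ n)%R) by (apply pow_le, Rabs_pos).
  assert (HQ2 : (0 < Q * Q)%R) by now apply Rmult_lt_0_compat.
  assert (HL : (0 < L)%R) by (unfold L; nra).
  apply holo_iff; exists (RtoC 0); intros eps He.
  exists (Rmin d (eps / L)); split.
    apply Rmin_glb_lt; [exact Hd | now apply Rdiv_lt_0_compat].
  intros y Hy.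
  assert (Hy1 := HD y (Rlt_le_trans _ _ _ Hy (Rmin_l _ _))).
  assert (Hy2 := Rlt_le_trans _ _ _ Hy (Rmin_r _ _)).
  assert (Hyz := Cmod_ge_0 (y - z)).
  unfold H at 2; destruct (in_dec Ceq_dec z E) as [_|N]; [|contradiction].
  replace (H n y - 0 - (y - z) * 0) with (H n y) by ring.
  unfold H; destruct (in_dec Ceq_dec y E) as [Hin|Hout].
    rewrite Cmod_0; apply Rmult_le_pos; lra.
  rewrite Cmod_mult, !Cmod_pow.
  apply Rle_trans with (L * Cmod (y - z) * Cmod (y - z))%R.
  + apply Rle_trans with (Rabs B ^ n * (Q * Cmod (y - z)) ^ 2)%R.
      apply Rmult_le_compat; try apply pow_le; try apply Cmod_ge_0.
        apply pow_incr; split; [apply Cmod_ge_0|].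
        apply Rle_trans with (1 := bound_G y Hy1 Hout), Rle_abs.
      apply pow_incr; split; [apply Cmod_ge_0|].
      apply H2; [exact HE | left; exact Hy1].
    assert (X := Rmult_le_pos _ _ Hyz Hyz). unfold L; nra.
  + apply Rmult_le_compat_r; [exact Hyz|].
    apply Rle_trans with (L * (eps / L))%R.
      apply Rmult_le_compat_l; lra.
    right; field; lra.
- destruct (finite_complement_open E z HE) as [d [Hd HD]].
  apply holo_ext_near with (fun y => G y ^ n * root_product E y ^ 2).
    exists d; split; [exact Hd|]; intros y Hy; unfold H.
    destruct (in_dec Ceq_dec y E) as [Hin|_]; [now destruct (HD y Hy) | reflexivity].
  apply holo_mult; apply holo_pow; [now apply holo_G | apply holo_root_product].
Qed.

(** The function G^n times the square of the product of the z - e extends by 0 to a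
    function differentiable on the whole disc, because G is bounded.  The mean value
    inequality bounds |G 0|^n by C (1 + eps)^n with C independent of n; take n-th
    roots. *)
Lemma removable_maximum_at_0 :
  ~ In (RtoC 0) E ->
  (forall eps : R, (0 < eps)%R -> exists rho0 : R, (rho0 < 1)%R /\
     forall z, (rho0 < Cmod z < 1)%R -> ~ In z E -> (Cmod (G z) <= 1 + eps)%R) ->
  (Cmod (G 0) <= 1)%R.
Proof.
intros H0 Hlim; apply le_epsilon; intros eps He.
destruct (Hlim eps He) as [rho0 [Hrho0 Hrho]].
set (rho := ((Rmax rho0 0 + 1) / 2)%R).
assert (M1 := Rmax_l rho0 0); assert (M2 := Rmax_r rho0 0).
assert (M3 : (Rmax rho0 0 < 1)%R) by (apply Rmax_lub_lt; lra).
assert (Hr : (0 < rho < 1 /\ rho0 < rho)%R) by (unfold rho; lra).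
destruct (root_product_bounded E) as [Q [HQ [H1 _]]].
set (q0 := Cmod (root_product E 0)).
assert (Hq0 : (0 < q0)%R) by now apply Cmod_pos, root_product_neq_0.
assert (K : (Cmod (G 0) / (1 + eps) <= 1)%R).
2:{ replace (Cmod (G 0)) with (Cmod (G 0) / (1 + eps) * (1 + eps))%R by (field; lra).
    nra. }
apply pow_bounded_le_1 with (Q ^ 2 / q0 ^ 2)%R; intros n.
assert (X : (Cmod (H n 0) <= (1 + eps) ^ n * Q ^ 2)%R).
  apply Cmod_center_le with rho; [lra | |].
    intros z Hz; apply holo_filled; unfold unit_disc; lra.
  intros z Hz; unfold H; destruct (in_dec Ceq_dec z E) as [_|HE].
    rewrite Cmod_0; apply Rmult_le_pos; apply pow_le; lra.
  rewrite Cmod_mult, !Cmod_pow.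
  apply Rmult_le_compat; try apply pow_le; try apply Cmod_ge_0;
    apply pow_incr; (split; [apply Cmod_ge_0|]).
    apply Hrho; [lra | exact HE].
  apply H1; lra.
unfold H in X; destruct (in_dec Ceq_dec 0 E) as [?|_]; [contradiction|].
rewrite Cmod_mult, !Cmod_pow in X; fold q0 in X.
assert (P1 : (0 < (1 + eps) ^ n)%R) by (apply pow_lt; lra).
assert (P2 : (0 < q0 ^ 2)%R) by (apply pow_lt; lra).
unfold Rdiv; rewrite Rpow_mult_distr, pow_inv.
apply Rmult_le_reg_r with (((1 + eps) ^ n) * q0 ^ 2)%R; [nra|].
replace (Cmod (G 0) ^ n * / (1 + eps) ^ n * ((1 + eps) ^ n * q0 ^ 2))%R
  with (Cmod (G 0) ^ n * q0 ^ 2)%R by (field; lra).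
replace (Q ^ 2 * / q0 ^ 2 * ((1 + eps) ^ n * q0 ^ 2))%R
  with ((1 + eps) ^ n * Q ^ 2)%R by (field; lra).
exact X.
Qed.
End RemovableMaximum.

(** * Disc automorphisms and the Schwarz-Pick lemma *)

Definition mobius (p z : C) : C := (z - p) / (1 - Cconj p * z).

Lemma mobius_denominator_Cmod (p z : C) :
  (1 - Cmod p * Cmod z <= Cmod (1 - Cconj p * z))%R.
Proof.
assert (T := Cmod_reverse_triangle 1 (Cconj p * z)).
rewrite Cmod_mult, Cmod_conj, Cmod_1 in T; exact T.
Qed.

Lemma Cmod_mult_lt_1 (p z : C) : unit_disc p -> unit_disc z -> (Cmod p * Cmod z < 1)%R.
Proof.
unfold unit_disc; intros Hp Hz.
generalize (Cmod_ge_0 p) (Cmod_ge_0 z); nra.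
Qed.

Lemma mobius_denominator_pos (p z : C) : unit_disc p -> unit_disc z ->
  (0 < Cmod (1 - Cconj p * z))%R.
Proof.
intros Hp Hz; generalize (Cmod_mult_lt_1 p z Hp Hz) (mobius_denominator_Cmod p z); lra.
Qed.

Lemma mobius_denominator_neq_0 (p z : C) : unit_disc p -> unit_disc z ->
  1 - Cconj p * z <> 0.
Proof. intros Hp Hz; now apply Cmod_gt_0, mobius_denominator_pos. Qed.

Lemma mobius_identity (p z : C) :
  (Cmod (1 - Cconj p * z) ^ 2 - Cmod (z - p) ^ 2 = (1 - Cmod p ^ 2) * (1 - Cmod z ^ 2))%R.
Proof.
rewrite !Cmod2_alt; destruct p as [a b], z as [x y]; simpl; ring.
Qed.

Lemma mobius_numerator_lt (p z : C) : unit_disc p -> unit_disc z ->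
  (Cmod (z - p) < Cmod (1 - Cconj p * z))%R.
Proof.
unfold unit_disc; intros Hp Hz; apply Rsqr_incrst_0; try apply Cmod_ge_0.
assert (I := mobius_identity p z); unfold Rsqr.
generalize (Cmod_ge_0 p) (Cmod_ge_0 z); intros P Z.
assert (0 < (1 - Cmod p ^ 2) * (1 - Cmod z ^ 2))%R by (apply Rmult_lt_0_compat; nra).
nra.
Qed.

Lemma Cmod_mobius (p z : C) : unit_disc p -> unit_disc z ->
  Cmod (mobius p z) = (Cmod (z - p) / Cmod (1 - Cconj p * z))%R.
Proof. intros Hp Hz; apply Cmod_div; now apply mobius_denominator_neq_0. Qed.

Lemma mobius_disc (p z : C) : unit_disc p -> unit_disc z -> unit_disc (mobius p z).
Proof.
intros Hp Hz; unfold unit_disc; rewrite Cmod_mobius by assumption.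
assert (D := mobius_denominator_pos p z Hp Hz).
apply Rmult_lt_reg_r with (1 := D); unfold Rdiv; rewrite Rmult_assoc, Rinv_l by lra.
generalize (mobius_numerator_lt p z Hp Hz); lra.
Qed.

Lemma holo_mobius (p z : C) : unit_disc p -> unit_disc z -> holo (mobius p) z.
Proof.
intros Hp Hz; apply holo_div.
- apply holo_minus; [apply holo_id | apply holo_const].
- apply holo_minus; [apply holo_const|]; apply holo_mult; [apply holo_const | apply holo_id].
- now apply mobius_denominator_neq_0.
Qed.

Lemma unit_disc_opp (z : C) : unit_disc z -> unit_disc (- z).
Proof. unfold unit_disc; now rewrite Cmod_opp. Qed.

Lemma mobius_0 (p : C) : mobius p 0 = - p.
Proof. unfold mobius; field. Qed.

Lemma mobius_self (p : C) : mobius p p = 0.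
Proof. unfold mobius, Cdiv, Cminus; rewrite Cplus_opp_r; apply Cmult_0_l. Qed.

Lemma mobius_eq_0 (p z : C) : unit_disc p -> unit_disc z -> mobius p z = 0 -> z = p.
Proof.
intros Hp Hz E; apply Ceq_minus.
assert (D := mobius_denominator_neq_0 p z Hp Hz).
replace (z - p) with (mobius p z * (1 - Cconj p * z)) by (unfold mobius; field; exact D).
rewrite E; ring.
Qed.

Lemma mobius_cancel (p z : C) : unit_disc p -> unit_disc z ->
  mobius p (mobius (- p) z) = z.
Proof.
intros Hp Hz.
assert (D1 := mobius_denominator_neq_0 (- p) z (unit_disc_opp p Hp) Hz).
assert (D2 := mobius_denominator_neq_0 p p Hp Hp).
unfold mobius; rewrite Copp_conj in *; field; split.
- replace (1 - - Cconj p * z) with (1 + Cconj p * z) in D1 by ring.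
  intros E; apply D1; rewrite <- E; ring.
- intros E; apply D2; rewrite <- E; ring.
Qed.

Lemma one_minus_mobius_le (p z : C) : unit_disc p -> unit_disc z ->
  (1 - Cmod (mobius p z) ^ 2 <= (1 - Cmod z ^ 2) / (1 - Cmod p) ^ 2)%R.
Proof.
intros Hp Hz; rewrite Cmod_mobius by assumption.
assert (D := mobius_denominator_pos p z Hp Hz).
assert (I := mobius_identity p z).
assert (L : (1 - Cmod p <= Cmod (1 - Cconj p * z))%R).
  generalize (mobius_denominator_Cmod p z) (Cmod_ge_0 p) (Cmod_ge_0 z).
  unfold unit_disc in Hz; nra.
unfold unit_disc in *; set (d := Cmod (1 - Cconj p * z)) in *.
replace (1 - (Cmod (z - p) / d) ^ 2)%R with ((1 - Cmod p ^ 2) * (1 - Cmod z ^ 2) / d ^ 2)%R.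
2: rewrite <- I; field; lra.
assert (P := Cmod_ge_0 p); assert (Z := Cmod_ge_0 z).
assert (Z2 : (0 <= 1 - Cmod z ^ 2)%R) by nra.
unfold Rdiv; apply Rmult_le_compat.
- apply Rmult_le_pos; nra.
- left; apply Rinv_0_lt_compat; apply pow_lt; lra.
- assert (0 <= Cmod p ^ 2)%R by (apply pow_le; lra). nra.
- apply Rinv_le_contravar; [apply pow_lt; lra|].
  apply pow_incr; lra.
Qed.

(** The values on E are arbitrary: a quotient by a Blaschke factor is left undefined
    at the zero of that factor. *)
Definition schur_off (E : list C) (f : C -> C) : Prop :=
  forall z, unit_disc z -> ~ In z E -> holo f z /\ (Cmod (f z) <= 1)%R.

Section StrictSchwarzPick.
Variables (E : list C) (f : C -> C) (c : R) (p z : C).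
Hypothesis HE : forall e, In e E -> unit_disc e.
Hypothesis (Hc : (0 <= c < 1)%R).
Hypothesis Hf : forall z, unit_disc z -> ~ In z E -> holo f z /\ (Cmod (f z) <= c)%R.
Hypotheses (Hp : unit_disc p) (Hz : unit_disc z) (HpE : ~ In p E) (HzE : ~ In z E).
Hypothesis Hpz : z <> p.

Let quotient (y : C) : C := mobius (f p) (f y) / mobius p y.

Let value_disc (y : C) : unit_disc y -> ~ In y E -> unit_disc (f y).
Proof.
intros Hy HyE; destruct (Hf y Hy HyE) as [_ L]; unfold unit_disc; lra.
Qed.

Lemma holo_quotient (y : C) : unit_disc y -> ~ In y (p :: E) -> holo quotient y.
Proof.
simpl; intros Hy HyE; apply holo_div.
- apply (holo_comp (mobius (f p)) f); [|apply Hf; tauto].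
  apply holo_mobius; apply value_disc; tauto.
- now apply holo_mobius.
- intros E0; apply HyE; left; symmetry; now apply mobius_eq_0.
Qed.

Lemma Cmod_quotient_far (y : C) : unit_disc y -> ~ In y (p :: E) ->
  (Cmod (quotient y) <= / Cmod (mobius p y))%R.
Proof.
simpl; intros Hy HyE.
assert (N : mobius p y <> 0) by (intros E0; apply HyE; left; symmetry; now apply mobius_eq_0).
unfold quotient; rewrite Cmod_div by exact N.
rewrite <- (Rmult_1_l (/ _)); apply Rmult_le_compat_r.
  left; now apply Rinv_0_lt_compat, Cmod_pos.
left; apply mobius_disc; apply value_disc; tauto.
Qed.

Lemma Cmod_mobius_ge (y : C) : unit_disc y -> (Cmod (y - p) / 2 <= Cmod (mobius p y))%R.
Proof.
intros Hy; rewrite Cmod_mobius by assumption.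
assert (D := mobius_denominator_pos p y Hp Hy).
apply Rmult_le_compat_l; [apply Cmod_ge_0|].
apply Rinv_le_contravar; [exact D|].
apply Rle_trans with (1 := Cmod_triangle _ _).
rewrite Cmod_opp, Cmod_mult, Cmod_conj, Cmod_1.
generalize (Cmod_mult_lt_1 p y Hp Hy); lra.
Qed.

(** Away from p the denominator is bounded below; near p both terms are
    O(|y - p|), and the numerator is controlled because |f| <= c < 1. *)
Lemma quotient_bounded : exists B : R, forall y, unit_disc y -> ~ In y (p :: E) ->
  (Cmod (quotient y) <= B)%R.
Proof.
destruct (holo_bounded_near f p (proj1 (Hf p Hp HpE))) as [l [d [Hd HD]]].
exists (Rmax (l / (1 - c) * 2) (2 / d)); intros y Hy HyE.
assert (Hyp : (0 < Cmod (y - p))%R).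
  apply Cmod_pos; intros E0; apply HyE; left; symmetry; now apply Ceq_minus.
assert (M := Cmod_mobius_ge y Hy).
destruct (Rlt_or_le (Cmod (y - p)) d) as [L|L].
- apply Rle_trans with (2 := Rmax_l _ _).
  simpl in HyE.
  assert (Dp := value_disc p Hp HpE).
  assert (Dy : unit_disc (f y)) by (apply value_disc; tauto).
  unfold quotient; rewrite Cmod_div by (apply Cmod_gt_0; lra).
  rewrite (Cmod_mobius (f p)) by assumption.
  assert (L1 : (1 - c <= Cmod (1 - Cconj (f p) * f y))%R).
    generalize (mobius_denominator_Cmod (f p) (f y)).
    destruct (Hf p Hp HpE) as [_ F1].
    unfold unit_disc in Dy.
    generalize (Cmod_ge_0 (f p)) (Cmod_ge_0 (f y)); nra.
  specialize (HD y L).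
  apply Rle_trans with (l * Cmod (y - p) / (1 - c) / (Cmod (y - p) / 2))%R.
    unfold Rdiv at 1 3; apply Rmult_le_compat.
    + apply Rmult_le_pos; [apply Cmod_ge_0|]; left; apply Rinv_0_lt_compat; lra.
    + left; apply Rinv_0_lt_compat; lra.
    + unfold Rdiv; apply Rmult_le_compat; [apply Cmod_ge_0 | | exact HD |].
        left; apply Rinv_0_lt_compat; lra.
      apply Rinv_le_contravar; lra.
    + apply Rinv_le_contravar; lra.
  right; field; lra.
- apply Rle_trans with (2 := Rmax_r _ _).
  apply Rle_trans with (1 := Cmod_quotient_far y Hy HyE).
  apply Rle_trans with (/ (d / 2))%R; [apply Rinv_le_contravar; lra|].
  right; field; lra.
Qed.

(** The automorphism mobius (- z) carries 0 to z, and near the circle the modulus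
    of mobius p tends to 1, so the maximum principle at 0 applies to the composite. *)
Lemma Cmod_quotient_le_1 : (Cmod (quotient z) <= 1)%R.
Proof.
assert (Hz' := unit_disc_opp z Hz).
assert (Hpull : forall w, unit_disc w -> ~ In w (map (mobius z) (p :: E)) ->
  unit_disc (mobius (- z) w) /\ ~ In (mobius (- z) w) (p :: E)).
  intros w Hw HwE; split; [now apply mobius_disc|].
  intros I; apply HwE; rewrite <- (mobius_cancel z w Hz Hw).
  now apply in_map.
destruct quotient_bounded as [B HB].
replace z with (mobius (- z) 0) by (rewrite mobius_0; ring).
apply (removable_maximum_at_0 (fun w => quotient (mobius (- z) w))
  (map (mobius z) (p :: E)) B).
- intros w Hw HwE; destruct (Hpull w Hw HwE) as [H1 H2].
  apply (holo_comp quotient); [now apply holo_quotient | now apply holo_mobius].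
- intros w Hw HwE; destruct (Hpull w Hw HwE) as [H1 H2]; now apply HB.
- rewrite in_map_iff; intros [e [He1 He2]].
  assert (De : unit_disc e) by (destruct He2 as [<-|He2]; [exact Hp | now apply HE]).
  apply mobius_eq_0 in He1; [|exact Hz | exact De]; subst e.
  destruct He2 as [->|He2]; [now apply Hpz | contradiction].
- intros eps He.
  set (K := (/ (1 - Cmod p) ^ 2 * / (1 - Cmod z) ^ 2)%R).
  unfold unit_disc in Hp, Hz.
  assert (HK : (0 < K)%R).
    apply Rmult_lt_0_compat; apply Rinv_0_lt_compat, pow_lt; lra.
  set (eta := (1 - / (1 + eps))%R).
  assert (Heta : (0 < eta < 1)%R).
    assert (/ (1 + eps) < 1)%R by (rewrite <- Rinv_1 at 2; apply Rinv_lt_contravar; lra).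
    assert (0 < / (1 + eps))%R by (apply Rinv_0_lt_compat; lra).
    unfold eta; lra.
  exists (1 - eta / (2 * K))%R; split.
    assert (0 < eta / (2 * K))%R by (apply Rdiv_lt_0_compat; lra). lra.
  intros w [Hw1 Hw2] HwE.
  destruct (Hpull w Hw2 HwE) as [H1 H2].
  apply Rle_trans with (1 := Cmod_quotient_far _ H1 H2).
  set (m := Cmod (mobius p (mobius (- z) w))).
  assert (Hm1 : (m < 1)%R) by (apply mobius_disc; assumption).
  assert (Hm0 : (0 <= m)%R) by apply Cmod_ge_0.
  assert (A1 := one_minus_mobius_le p _ Hp H1); fold m in A1.
  assert (A2 := one_minus_mobius_le (- z) w Hz' Hw2); rewrite Cmod_opp in A2.
  assert (A3 : (1 - m ^ 2 <= eta)%R).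
    apply Rle_trans with (1 := A1).
    apply Rle_trans with (K * (1 - Cmod w ^ 2))%R.
      unfold Rdiv in *; rewrite Rmult_comm; unfold K; rewrite Rmult_assoc.
      apply Rmult_le_compat_l; [left; apply Rinv_0_lt_compat, pow_lt; lra | lra].
    apply Rle_trans with (K * (2 * (eta / (2 * K))))%R.
      apply Rmult_le_compat_l; [lra|].
      assert (W := Cmod_ge_0 w); nra.
    right; field; lra.
  assert (A4 : (/ (1 + eps) <= m)%R) by (unfold eta in A3; nra).
  rewrite <- (Rinv_inv (1 + eps)).
  apply Rinv_le_contravar; [apply Rinv_0_lt_compat; lra | exact A4].
Qed.
End StrictSchwarzPick.

(** Apply the strict version to c f with c < 1 and let c tend to 1.  Written without
    division, the inequality is meaningful when |f p| = 1 and then says that f is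
    constant. *)
Lemma schwarz_pick (E : list C) (f : C -> C) (p z : C) :
  (forall e, In e E -> unit_disc e) -> schur_off E f ->
  unit_disc p -> unit_disc z -> ~ In p E -> ~ In z E ->
  (Cmod (f z - f p) * Cmod (1 - Cconj p * z) <= Cmod (z - p) * Cmod (1 - Cconj (f p) * f z))%R.
Proof.
intros HE Hf Hp Hz HpE HzE.
destruct (Ceq_dec z p) as [->|Hpz].
  unfold Cminus at 1; rewrite Cplus_opp_r, Cmod_0, Rmult_0_l.
  apply Rmult_le_pos; apply Cmod_ge_0.
destruct (Hf p Hp HpE) as [_ Bp]; destruct (Hf z Hz HzE) as [_ Bz].
apply le_epsilon; intros eps He.
set (A := Cmod (f z - f p)); set (D := Cmod (1 - Cconj p * z)); set (N := Cmod (z - p)).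
assert (HN : (0 <= N)%R) by apply Cmod_ge_0.
assert (HA : (0 <= A)%R) by apply Cmod_ge_0.
assert (HD : (0 < D)%R) by now apply mobius_denominator_pos.
(* Replacing f by (1 - eta) f changes the two sides by at most T * eta. *)
set (T := (A * D + 2 * N + 1)%R).
assert (HT : (1 <= T)%R) by (unfold T; assert (X := Rmult_le_pos _ _ HA (Rlt_le _ _ HD)); lra).
set (eta := Rmin (/ 2) (eps / T)).
assert (Heta : (0 < eta)%R) by (apply Rmin_glb_lt; [lra | apply Rdiv_lt_0_compat; lra]).
assert (Heta2 : (eta <= / 2)%R) by apply Rmin_l.
assert (Heta3 : (T * eta <= eps)%R).
  apply Rle_trans with (T * (eps / T))%R; [|right; field; lra].
  apply Rmult_le_compat_l; [lra | apply Rmin_r].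
set (c := (1 - eta)%R).
assert (Hc : (0 <= c < 1)%R) by (unfold c; lra).
assert (Hcf : forall y, unit_disc y -> ~ In y E ->
  holo (fun y => c * f y) y /\ (Cmod (c * f y) <= c)%R).
  intros y Hy HyE; destruct (Hf y Hy HyE) as [H1 H2]; split.
    apply holo_mult; [apply holo_const | exact H1].
  rewrite Cmod_mult, Cmod_R, Rabs_pos_eq by lra; nra.
assert (Q := Cmod_quotient_le_1 E (fun y => c * f y) c p z HE Hc Hcf Hp Hz HpE HzE Hpz).
cbv beta in Q.
destruct (Hcf p Hp HpE) as [_ Cp]; destruct (Hcf z Hz HzE) as [_ Cz].
assert (Up : unit_disc (c * f p)) by (unfold unit_disc; lra).
assert (Uz : unit_disc (c * f z)) by (unfold unit_disc; lra).
rewrite Cmod_div in Q.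
2: intros E0; apply Hpz; now apply mobius_eq_0.
rewrite !Cmod_mobius in Q by assumption; fold D N in Q.
set (D' := Cmod (1 - Cconj (c * f p) * (c * f z))) in Q.
assert (HD' : (0 < D')%R) by now apply mobius_denominator_pos.
replace (c * f z - c * f p) with (c * (f z - f p)) in Q by ring.
rewrite Cmod_mult, Cmod_R, Rabs_pos_eq in Q by lra; fold A in Q.
assert (HN' : (0 < N)%R).
  apply Cmod_pos; intros E0; apply Hpz; now apply Ceq_minus.
assert (Q' : (c * A * D <= N * D')%R).
  apply Rmult_le_compat_r with (r := (N * D')%R) in Q; [|apply Rmult_le_pos; lra].
  replace (c * A / D' / (N / D) * (N * D'))%R with (c * A * D)%R in Q by (field; lra).
  lra.
assert (HX : (D' <= Cmod (1 - Cconj (f p) * f z) + 2 * eta)%R).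
  unfold D'; rewrite Cmult_conj.
  replace (1 - Cconj c * Cconj (f p) * (c * f z))
    with ((1 - Cconj (f p) * f z) + RtoC (1 - c * c) * (Cconj (f p) * f z)).
  2:{ replace (Cconj c) with (RtoC c) by (unfold Cconj, RtoC; simpl; f_equal; ring).
      rewrite RtoC_minus, RtoC_mult; ring. }
  apply Rle_trans with (1 := Cmod_triangle _ _).
  rewrite !Cmod_mult, Cmod_conj, Cmod_R.
  apply Rplus_le_compat_l.
  rewrite Rabs_pos_eq by nra.
  assert (Cmod (f p) * Cmod (f z) <= 1)%R.
    generalize (Cmod_ge_0 (f p)) (Cmod_ge_0 (f z)); nra.
  assert (0 <= Cmod (f p) * Cmod (f z))%R by (apply Rmult_le_pos; apply Cmod_ge_0).
  assert (1 - c * c <= 2 * eta)%R by (unfold c; nra).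
  assert (0 <= 1 - c * c)%R by nra.
  nra.
assert (N * D' <= N * (Cmod (1 - Cconj (f p) * f z) + 2 * eta))%R
  by (apply Rmult_le_compat_l; lra).
unfold T in Heta3; unfold c in Q'.
assert (0 <= eta)%R by lra. lra.
Qed.

(** * Inequalities between the nodes of a disc and its values *)

Definition self_map (f : C -> C) : Prop :=
  forall z, unit_disc z -> holo f z /\ unit_disc (f z).

Lemma self_map_schur (f : C -> C) : self_map f -> schur_off nil f.
Proof. intros Hf z Hz _; destruct (Hf z Hz) as [H1 H2]; split; [exact H1 | left; exact H2]. Qed.

Lemma unit_disc_0 : unit_disc 0.
Proof. unfold unit_disc; rewrite Cmod_0; lra. Qed.

(** This is Schwarz-Pick between the zero q and z. *)
Lemma schur_divide (E : list C) (g : C -> C) (q : C) :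
  (forall e, In e E -> unit_disc e) -> schur_off E g ->
  unit_disc q -> ~ In q E -> g q = 0 ->
  schur_off (q :: E) (fun z => g z / mobius q z).
Proof.
intros HE Hg Hq HqE Hgq z Hz HzE; simpl in HzE.
assert (N : mobius q z <> 0).
  intros E0; apply HzE; left; symmetry; now apply mobius_eq_0.
destruct (Hg z Hz ltac:(tauto)) as [H1 H2]; split.
  apply holo_div; [exact H1 | now apply holo_mobius | exact N].
assert (S := schwarz_pick E g q z HE Hg Hq Hz HqE ltac:(tauto)).
rewrite Hgq in S.
replace (g z - 0) with (g z) in S by ring.
replace (1 - Cconj 0 * g z) with (RtoC 1) in S.
2: unfold Cconj, RtoC, Cminus, Copp, Cmult, Cplus; simpl; f_equal; ring.
rewrite Cmod_1, Rmult_1_r in S.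
rewrite Cmod_div by exact N; rewrite Cmod_mobius by assumption.
assert (D := mobius_denominator_pos q z Hq Hz).
assert (P : (0 < Cmod (z - q))%R).
  apply Cmod_pos; intros E0; apply HzE; left; symmetry; now apply Ceq_minus.
apply Rmult_le_reg_r with (Cmod (z - q)); [exact P|].
replace (Cmod (g z) / (Cmod (z - q) / Cmod (1 - Cconj q * z)) * Cmod (z - q))%R
  with (Cmod (g z) * Cmod (1 - Cconj q * z))%R by (field; lra).
lra.
Qed.

(** Schwarz-Pick for a self-map f of the disc with f p = a and f s = b.
    When a and b differ, it keeps p and s apart in the limit. *)
Definition separated (a b p s : C) : Prop :=
  (Cmod ((b - a) * (1 - Cconj p * s)) <= Cmod ((s - p) * (1 - Cconj a * b)))%R.

(** Schwarz-Pick between p and s for f(z) / z, where f p = a and f s = b,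
    multiplied by |p s|. *)
Definition quotient_pick (a b p s : C) : Prop :=
  (Cmod ((b * p - a * s) * (1 - Cconj p * s)) <=
   Cmod ((s - p) * (Cconj p * s - Cconj a * b)))%R.

(** Schwarz-Pick between 0 and r for mobius a (f z) / (mobius p z * mobius q z), where
    f p = f q = a and f r = b, cleared of the denominators that involve p, q and r.
    Both sides are then continuous in the nodes on the closed disc. *)
Definition fibre_pick (a b p q r : C) : Prop :=
  (Cmod (mobius a b * (p * q) * ((1 - Cconj p * r) * (1 - Cconj q * r))
         + a * ((r - p) * (r - q))) <=
   Cmod (r * (Cconj (p * q) * ((r - p) * (r - q))
         + Cconj a * mobius a b * ((1 - Cconj p * r) * (1 - Cconj q * r)))))%R.

Section Discs.
Variable f : C -> C.
Hypothesis Hf : self_map f.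

Lemma self_map_separated (p s : C) : unit_disc p -> unit_disc s ->
  separated (f p) (f s) p s.
Proof.
intros Hp Hs; unfold separated; rewrite !Cmod_mult.
apply (schwarz_pick nil); auto using self_map_schur.
simpl; tauto.
Qed.

Lemma schwarz_quotient_schur : f 0 = 0 -> schur_off (RtoC 0 :: nil) (fun z => f z / z).
Proof.
intros H0 z Hz HzE.
assert (N : z <> 0) by (intros ->; apply HzE; now left).
assert (S := schur_divide nil f 0 ltac:(simpl; tauto) (self_map_schur f Hf)
  unit_disc_0 ltac:(simpl; tauto) H0 z Hz HzE).
destruct S as [_ S2]; split.
  apply holo_div; [now apply Hf | apply holo_id | exact N].
replace (mobius 0 z) with z in S2; [exact S2|].
unfold mobius; replace (1 - Cconj 0 * z) with (RtoC 1); [field|].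
unfold Cconj, RtoC, Cminus, Copp, Cmult, Cplus; simpl; f_equal; ring.
Qed.

Lemma schwarz (z : C) : f 0 = 0 -> unit_disc z -> (Cmod (f z) <= Cmod z)%R.
Proof.
intros H0 Hz; destruct (Ceq_dec z 0) as [->|N].
  rewrite H0; lra.
destruct (schwarz_quotient_schur H0 z Hz) as [_ S].
  intros [E|[]]; now apply N.
rewrite Cmod_div in S by exact N.
assert (P := Cmod_pos z N).
apply Rmult_le_compat_r with (r := Cmod z) in S; [|lra].
replace (Cmod (f z) / Cmod z * Cmod z)%R with (Cmod (f z)) in S by (field; lra).
lra.
Qed.

Lemma self_map_quotient_pick (p s : C) : f 0 = 0 -> unit_disc p -> unit_disc s ->
  p <> 0 -> s <> 0 -> quotient_pick (f p) (f s) p s.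
Proof.
intros H0 Hp Hs Np Ns.
assert (S := schwarz_pick (RtoC 0 :: nil) (fun z => f z / z) p s).
cbv beta in S.
assert (S' := S ltac:(intros e [<-|[]]; apply unit_disc_0) (schwarz_quotient_schur H0) Hp Hs
  ltac:(intros [E|[]]; now apply Np) ltac:(intros [E|[]]; now apply Ns)); clear S.
assert (Npc : Cconj p <> 0).
  intros E; apply Np; rewrite <- (Cconj_conj p), E; unfold Cconj, RtoC; simpl; f_equal; ring.
rewrite Cdiv_conj in S' by exact Np.
unfold quotient_pick; rewrite !Cmod_mult.
replace (f s * p - f p * s) with ((f s / s - f p / p) * (p * s)) by (field; auto).
replace (Cconj p * s - Cconj (f p) * f s)
  with ((1 - Cconj (f p) / Cconj p * (f s / s)) * (Cconj p * s)) by (field; auto).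
rewrite !(Cmod_mult _ (_ * s)), !(Cmod_mult _ s), Cmod_conj.
assert (X := Rmult_le_pos _ _ (Cmod_ge_0 p) (Cmod_ge_0 s)).
nra.
Qed.

Section Fibre.
Variables p q : C.
Hypotheses (Hp : unit_disc p) (Hq : unit_disc q) (Hpq : p <> q) (Hfpq : f p = f q).

Lemma fibre_quotient_schur :
  schur_off (q :: p :: nil) (fun z => mobius (f p) (f z) / mobius p z / mobius q z).
Proof.
apply (schur_divide (p :: nil) (fun z => mobius (f p) (f z) / mobius p z)).
- now intros e [<-|[]].
- apply (schur_divide nil (fun z => mobius (f p) (f z))); auto using mobius_self.
    simpl; tauto.
  intros z Hz _; split.
    apply (holo_comp (mobius (f p)) f); [apply holo_mobius|]; now apply Hf.
  left; apply mobius_disc; now apply Hf.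
- exact Hq.
- simpl; intros [E|[]]; now apply Hpq.
- rewrite Hfpq, mobius_self; unfold Cdiv; apply Cmult_0_l.
Qed.

Hypotheses (H0 : f 0 = 0) (Hp0 : p <> 0) (Hq0 : q <> 0).

Lemma fibre_quotient_at_0 :
  mobius (f p) (f 0) / mobius p 0 / mobius q 0 = - (f p / (p * q)).
Proof. rewrite H0, !mobius_0; field; auto. Qed.

Lemma fibre_product : (Cmod (f p) <= Cmod (p * q))%R.
Proof.
destruct (fibre_quotient_schur 0 unit_disc_0) as [_ S].
  intros [E|[E|[]]]; auto.
rewrite fibre_quotient_at_0, Cmod_opp, Cmod_div in S by now apply Cmult_neq_0.
assert (P := Cmod_pos _ (Cmult_neq_0 _ _ Hp0 Hq0)).
apply Rmult_le_compat_r with (r := Cmod (p * q)) in S; [|lra].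
replace (Cmod (f p) / Cmod (p * q) * Cmod (p * q))%R with (Cmod (f p)) in S by (field; lra).
lra.
Qed.

Lemma self_map_fibre_pick (r : C) : unit_disc r -> r <> p -> r <> q ->
  fibre_pick (f p) (f r) p q r.
Proof.
intros Hr Nrp Nrq.
assert (S := schwarz_pick (q :: p :: nil) _ 0 r
  ltac:(now intros e [<-|[<-|[]]]) fibre_quotient_schur unit_disc_0 Hr
  ltac:(intros [E|[E|[]]]; auto) ltac:(intros [E|[E|[]]]; auto)).
cbv beta in S; rewrite fibre_quotient_at_0 in S.
replace (1 - Cconj 0 * r) with (RtoC 1) in S.
2: unfold Cconj, RtoC, Cminus, Copp, Cmult, Cplus; simpl; f_equal; ring.
rewrite Cmod_1, Rmult_1_r in S.
replace (r - 0) with r in S by ring.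
assert (D1 := mobius_denominator_neq_0 p r Hp Hr).
assert (D2 := mobius_denominator_neq_0 q r Hq Hr).
assert (N1 : r - p <> 0) by now intros E; apply Nrp, Ceq_minus.
assert (N2 : r - q <> 0) by now intros E; apply Nrq, Ceq_minus.
assert (Npq : p * q <> 0) by now apply Cmult_neq_0.
assert (Npqc : Cconj (p * q) <> 0).
  intros E; apply Npq; rewrite <- (Cconj_conj (p * q)), E.
  unfold Cconj, RtoC; simpl; f_equal; ring.
rewrite Copp_conj, Cdiv_conj in S by exact Npq.
unfold fibre_pick.
set (mu := mobius (f p) (f r)) in *.
set (M := (1 - Cconj p * r) * (1 - Cconj q * r)).
set (N := (r - p) * (r - q)).
assert (HN : N <> 0) by now apply Cmult_neq_0.
assert (Ek : mu / mobius p r / mobius q r = mu * M / N).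
  unfold mobius, M, N; field; auto.
rewrite Ek in S.
replace (mu * (p * q) * M + f p * N)
  with ((mu * M / N - - (f p / (p * q))) * ((p * q) * N)) by (field; auto).
replace (r * (Cconj (p * q) * N + Cconj (f p) * mu * M))
  with (r * (1 - - (Cconj (f p) / Cconj (p * q)) * (mu * M / N)) * (Cconj (p * q) * N))
  by (field; auto).
rewrite !(Cmod_mult _ (_ * N)), !(Cmod_mult _ N), Cmod_conj, (Cmod_mult r).
apply Rmult_le_compat_r; [apply Rmult_le_pos; apply Cmod_ge_0 | exact S].
Qed.
End Fibre.
End Discs.

(** What is retained of a self-map that fixes 0 and takes the value a at p, q and the
    value b at r, s.  Every clause is a non-strict inequality between moduli of
    polynomials in the nodes and their conjugates, so it passes to limits. *)
Definition fibre_constraints (a b p q r s : C) : Prop :=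
  (Cmod a <= Cmod (p * q))%R /\ (Cmod b <= Cmod (r * s))%R /\
  quotient_pick a b p s /\ quotient_pick a b q r /\
  fibre_pick a b p q r /\ fibre_pick a b p q s /\
  separated a b p s /\ separated a b q s.

Lemma self_map_fibre_constraints (f : C -> C) (a b p q r s : C) :
  self_map f -> f 0 = 0 -> a <> 0 -> b <> 0 -> a <> b ->
  unit_disc p -> unit_disc q -> unit_disc r -> unit_disc s ->
  f p = a -> f q = a -> f r = b -> f s = b -> p <> q -> r <> s ->
  fibre_constraints a b p q r s.
Proof.
intros Hf H0 Na Nb Nab Hp Hq Hr Hs Ep Eq Er Es Npq Nrs.
assert (Np : p <> 0) by (intros ->; congruence).
assert (Nq : q <> 0) by (intros ->; congruence).
assert (Nr : r <> 0) by (intros ->; congruence).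
assert (Ns : s <> 0) by (intros ->; congruence).
assert (Epq : f p = f q) by congruence.
assert (Ers : f r = f s) by congruence.
repeat split.
- rewrite <- Ep; now apply fibre_product.
- rewrite <- Er; now apply fibre_product.
- rewrite <- Ep, <- Es; now apply self_map_quotient_pick.
- rewrite <- Eq, <- Er; now apply self_map_quotient_pick.
- rewrite <- Ep, <- Er; apply self_map_fibre_pick; auto; congruence.
- rewrite <- Ep, <- Es; apply self_map_fibre_pick; auto; congruence.
- rewrite <- Ep, <- Es; now apply self_map_separated.
- rewrite <- Eq, <- Es; now apply self_map_separated.
Qed.

(** * The equality case with all nodes inside the disc *)

Lemma Cconj_mult_Cmod_eq (x y : C) : Cmod x = Cmod y -> Cconj x * x = Cconj y * y.
Proof.
intros E; rewrite !(Cmult_comm (Cconj _)), <- !Cmod2_conj, E; reflexivity.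
Qed.

(** When |a| = |p q|, the left side of [fibre_pick] has the modulus of the factor of r on
    the right, and |r| < 1 forces both to vanish: the quotient is constant. *)
Lemma fibre_pick_equality (a b p q r : C) : a <> 0 -> unit_disc r ->
  Cmod a = Cmod (p * q) -> fibre_pick a b p q r ->
  mobius a b * (p * q) * ((1 - Cconj p * r) * (1 - Cconj q * r))
    = - (a * ((r - p) * (r - q))).
Proof.
intros Na Hr HX H; unfold fibre_pick in H.
set (M := (1 - Cconj p * r) * (1 - Cconj q * r)) in *.
set (N := (r - p) * (r - q)) in *; set (mu := mobius a b) in *; set (X := p * q) in *.
set (U := mu * X * M + a * N) in *.
set (W := Cconj X * N + Cconj a * mu * M) in *.
(* Multiply out, using conj a * a = conj X * X. *)
assert (E : Cconj a * U = X * W).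
  unfold U, W.
  replace (Cconj a * (mu * X * M + a * N))
    with (Cconj a * mu * X * M + (Cconj a * a) * N) by ring.
  rewrite (Cconj_mult_Cmod_eq a X HX); ring.
apply (f_equal Cmod) in E; rewrite !Cmod_mult, Cmod_conj, <- HX in E.
assert (Pa := Cmod_pos a Na).
apply Rmult_eq_reg_l in E; [|lra].
rewrite Cmod_mult, <- E in H; unfold unit_disc in Hr.
assert (U0 : U = 0) by (apply Cmod_eq_0; generalize (Cmod_ge_0 U); nra).
replace (mu * X * M) with (U - a * N) by (unfold U; ring).
rewrite U0; ring.
Qed.

Lemma Cmult_cancel_l (a x y : C) : a <> 0 -> a * x = a * y -> x = y.
Proof.
intros Na E; replace x with (/ a * (a * x)) by (field; exact Na).
rewrite E; field; exact Na.
Qed.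

(** The finite Blaschke product mobius p * mobius q takes the same value at r and s,
    written without division. *)
Lemma fibre_points_equation (a b p q r s : C) : a <> 0 ->
  unit_disc r -> unit_disc s -> Cmod a = Cmod (p * q) ->
  fibre_pick a b p q r -> fibre_pick a b p q s ->
  (r - p) * (r - q) * ((1 - Cconj p * s) * (1 - Cconj q * s))
   = (s - p) * (s - q) * ((1 - Cconj p * r) * (1 - Cconj q * r)).
Proof.
intros Na Hr Hs HX Fr Fs.
apply fibre_pick_equality in Fr; auto; apply fibre_pick_equality in Fs; auto.
set (Mr := (1 - Cconj p * r) * (1 - Cconj q * r)) in *.
set (Nr := (r - p) * (r - q)) in *.
set (Ms := (1 - Cconj p * s) * (1 - Cconj q * s)) in *.
set (Ns := (s - p) * (s - q)) in *.
set (k := mobius a b * (p * q)) in *.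
apply (Cmult_cancel_l a); [exact Na|].
replace (a * (Nr * Ms)) with (- (- (a * Nr)) * Ms) by ring.
replace (a * (Ns * Mr)) with (- (- (a * Ns)) * Mr) by ring.
rewrite <- Fr, <- Fs; ring.
Qed.

(** After the automorphism mobius p, which moves p to 0, the equation has the factor
    mobius p r - mobius p s; this is the cofactor. *)
Lemma equation_normalised (p q r s : C) :
  unit_disc p -> unit_disc q -> unit_disc r -> unit_disc s -> r <> s ->
  (r - p) * (r - q) * ((1 - Cconj p * s) * (1 - Cconj q * s))
   = (s - p) * (s - q) * ((1 - Cconj p * r) * (1 - Cconj q * r)) ->
  mobius p r + mobius p s
    = mobius p q + Cconj (mobius p q) * (mobius p r * mobius p s).
Proof.
intros Hp Hq Hr Hs Nrs E.
assert (Dq := mobius_denominator_neq_0 p q Hp Hq).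
assert (Dr := mobius_denominator_neq_0 p r Hp Hr).
assert (Ds := mobius_denominator_neq_0 p s Hp Hs).
assert (Dp := mobius_denominator_neq_0 p p Hp Hp).
assert (Dq' := mobius_denominator_neq_0 q p Hq Hp).
assert (EQ : Cconj (mobius p q) = (Cconj q - Cconj p) / (1 - Cconj q * p)).
  unfold mobius; rewrite Cdiv_conj by exact Dq.
  rewrite !Cminus_conj, Cmult_conj, Cconj_conj.
  replace (Cconj 1) with (RtoC 1) by (unfold Cconj, RtoC; simpl; f_equal; ring).
  now rewrite (Cmult_comm p).
set (R := mobius p r); set (S := mobius p s); set (Q := mobius p q) in *.
set (Q' := Cconj Q) in *.
assert (cross : R * (R - Q) * (1 - Q' * S) = S * (S - Q) * (1 - Q' * R)).
  set (c := (1 - Cconj p * p) * (1 - Cconj p * p) /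
     ((1 - Cconj p * r) * (1 - Cconj p * r) * ((1 - Cconj p * s) * (1 - Cconj p * s)) *
      ((1 - Cconj p * q) * (1 - Cconj q * p)))).
  replace (R * (R - Q) * (1 - Q' * S)) with
    (c * ((r - p) * (r - q) * ((1 - Cconj p * s) * (1 - Cconj q * s)))).
  2: rewrite EQ; unfold c, R, S, Q, mobius; field; auto.
  rewrite E; rewrite EQ; unfold c, R, S, Q, mobius; field; auto.
assert (NRS : R - S <> 0).
  intros E0; apply Nrs, Ceq_minus.
  replace (r - s) with ((R - S) * ((1 - Cconj p * r) * (1 - Cconj p * s)) / (1 - Cconj p * p)).
    rewrite E0; field; exact Dp.
  unfold R, S, mobius; field; auto.
apply (Cmult_cancel_l (R - S)); [exact NRS|].
apply Ceq_minus.
replace ((R - S) * (R + S) - (R - S) * (Q + Q' * (R * S)))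
  with (R * (R - Q) * (1 - Q' * S) - S * (S - Q) * (1 - Q' * R)) by ring.
rewrite cross; ring.
Qed.

(** Write Q, R, S for the images of q, r, s under mobius p.  The normalised equations
    are R + S = Q + conj Q R S and Q + S = R + conj R Q S; their sum is
    2 S = S (conj Q R + conj R Q), so S = 0 or 2 <= 2 |Q| |R| < 2. *)
Lemma fibre_equations_incompatible (p q r s : C) :
  unit_disc p -> unit_disc q -> unit_disc r -> unit_disc s ->
  p <> s -> q <> s -> r <> s ->
  (r - p) * (r - q) * ((1 - Cconj p * s) * (1 - Cconj q * s))
   = (s - p) * (s - q) * ((1 - Cconj p * r) * (1 - Cconj q * r)) ->
  (q - p) * (q - r) * ((1 - Cconj p * s) * (1 - Cconj r * s))
   = (s - p) * (s - r) * ((1 - Cconj p * q) * (1 - Cconj r * q)) -> False.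
Proof.
intros Hp Hq Hr Hs Nps Nqs Nrs E1 E2.
apply equation_normalised in E1; auto; apply equation_normalised in E2; auto.
assert (DQ := mobius_disc p q Hp Hq); assert (DR := mobius_disc p r Hp Hr).
assert (NS : mobius p s <> 0).
  intros E0; apply Nps; symmetry; now apply mobius_eq_0.
set (R := mobius p r) in *; set (S := mobius p s) in *; set (Q := mobius p q) in *.
assert (E : Cconj Q * R + Cconj R * Q = 2).
  apply (Cmult_cancel_l S); [exact NS|].
  replace (S * (Cconj Q * R + Cconj R * Q))
    with ((Q + Cconj Q * (R * S)) + (R + Cconj R * (Q * S)) - Q - R) by ring.
  rewrite <- E1, <- E2; ring.
assert (T := Cmod_triangle (Cconj Q * R) (Cconj R * Q)).
rewrite E, !Cmod_mult, !Cmod_conj, Cmod_R, Rabs_pos_eq in T by lra.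
generalize (Cmod_mult_lt_1 Q R DQ DR); lra.
Qed.

Lemma separated_neq (a b p s : C) : unit_disc a -> unit_disc b -> a <> b ->
  unit_disc p -> unit_disc s -> separated a b p s -> p <> s.
Proof.
intros Ha Hb Nab Hp Hs H ->; unfold separated in H.
rewrite !Cmod_mult in H.
replace (s - s) with (RtoC 0) in H by ring.
rewrite Cmod_0, Rmult_0_l in H.
assert (P1 := mobius_denominator_pos s s Hs Hs).
assert (P2 : (0 < Cmod (b - a))%R).
  apply Cmod_pos; intros E; apply Nab; symmetry; now apply Ceq_minus.
assert (X := Rmult_lt_0_compat _ _ P2 P1); lra.
Qed.

Lemma interior_impossible (a1 a2 b1 b2 p q r s : C) :
  a1 <> 0 -> b1 <> 0 -> a1 <> a2 -> b1 <> b2 ->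
  unit_disc a1 -> unit_disc a2 -> unit_disc b1 -> unit_disc b2 ->
  fibre_constraints a1 a2 p q r s -> fibre_constraints b1 b2 p r q s ->
  Cmod a1 = Cmod (p * q) -> Cmod b1 = Cmod (p * r) ->
  unit_disc p -> unit_disc q -> unit_disc r -> unit_disc s -> False.
Proof.
intros Na Nb Naa Nbb Ha1 Ha2 Hb1 Hb2
  (_ & _ & _ & _ & Fr & Fs & Sps & Sqs) (_ & _ & _ & _ & Gq & Gs & _ & Srs) EA EB Hp Hq Hr Hs.
apply (fibre_equations_incompatible p q r s); auto.
- now apply (separated_neq a1 a2).
- now apply (separated_neq a1 a2).
- now apply (separated_neq b1 b2).
- now apply (fibre_points_equation a1 a2).
- now apply (fibre_points_equation b1 b2).
Qed.

(** * The equality case with a node on the circle *)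

(** If f(z) / z has modulus 1 at p or at s, it takes the same value at both. *)
Lemma quotient_pick_equality (a b p s : C) :
  unit_disc p -> unit_disc s -> p <> 0 -> s <> 0 ->
  quotient_pick a b p s -> Cmod a = Cmod p \/ Cmod b = Cmod s ->
  b * p = a * s.
Proof.
intros Hp Hs Np Ns H HE; unfold quotient_pick in H.
rewrite !Cmod_mult in H.
assert (E : Cmod (Cconj p * s - Cconj a * b) = Cmod (b * p - a * s)).
  destruct HE as [HE|HE].
  - apply Rmult_eq_reg_l with (Cmod p); [|generalize (Cmod_pos p Np); lra].
    rewrite <- HE at 2; rewrite <- (Cmod_conj a), <- !Cmod_mult.
    rewrite <- (Cmod_opp (_ * (_ - a * s))); f_equal.
    assert (X := Cconj_mult_Cmod_eq a p HE).
    replace (p * (Cconj p * s - Cconj a * b))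
      with ((Cconj p * p) * s - Cconj a * b * p) by ring.
    rewrite <- X; ring.
  - apply Rmult_eq_reg_l with (Cmod s); [|generalize (Cmod_pos s Ns); lra].
    rewrite <- HE at 2; rewrite <- (Cmod_conj s), <- (Cmod_conj b), <- !Cmod_mult.
    rewrite <- (Cmod_conj (Cconj s * _)).
    f_equal.
    assert (X := Cconj_mult_Cmod_eq b s HE).
    rewrite Cmult_conj, Cminus_conj, !Cmult_conj, !Cconj_conj.
    replace (Cconj b * (b * p - a * s)) with (Cconj b * b * p - Cconj b * a * s) by ring.
    rewrite X; ring.
apply Ceq_minus, Cmod_eq_0.
rewrite E in H.
assert (L := mobius_numerator_lt p s Hp Hs).
generalize (Cmod_ge_0 (b * p - a * s)); nra.
Qed.

Lemma common_rotation (a b a' b' p s : C) :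
  unit_disc p -> unit_disc s -> p <> 0 -> s <> 0 -> a <> 0 -> 
  quotient_pick a b p s -> (Cmod a = Cmod p \/ Cmod b = Cmod s) ->
  quotient_pick a' b' p s -> (Cmod a' = Cmod p \/ Cmod b' = Cmod s) ->
  Cmod (a * b) = Cmod (a' * b') ->
  exists u, Cmod u = 1%R /\ a' = u * a /\ b' = u * b.
Proof.
intros Hp Hs Np Ns Na H HE H' HE' Hprod.
assert (E := quotient_pick_equality a b p s Hp Hs Np Ns H HE).
assert (E' := quotient_pick_equality a' b' p s Hp Hs Np Ns H' HE').
assert (Eb : b = a * s / p) by (rewrite <- E; field; exact Np).
assert (Eb' : b' = a' * s / p) by (rewrite <- E'; field; exact Np).
exists (a' / a); split; [|split].
- rewrite Cmod_div by exact Na.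
  rewrite Eb, Eb' in Hprod.
  replace (a * (a * s / p)) with (a * a * (s / p)) in Hprod by (field; exact Np).
  replace (a' * (a' * s / p)) with (a' * a' * (s / p)) in Hprod by (field; exact Np).
  rewrite !(Cmod_mult _ (s / p)) in Hprod.
  assert (Nsp : s / p <> 0) by (apply Cmult_neq_0; [exact Ns | now apply Cinv_neq_0]).
  apply Rmult_eq_reg_r in Hprod; [|generalize (Cmod_pos _ Nsp); lra].
  rewrite !Cmod_mult in Hprod.
  assert (X : Cmod a' = Cmod a).
    apply Rsqr_inj; try apply Cmod_ge_0; unfold Rsqr; lra.
  rewrite X; field; generalize (Cmod_pos a Na); lra.
- field; exact Na.
- rewrite Eb, Eb'; field; auto.
Qed.

Lemma quotient_pick_sym (a b p s : C) : quotient_pick a b p s -> quotient_pick b a s p.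
Proof.
unfold quotient_pick; intros H; rewrite !Cmod_mult in *.
rewrite (Cmod_minus_sym (a * s)), (Cmod_minus_sym p).
replace (Cmod (1 - Cconj s * p)) with (Cmod (1 - Cconj p * s)).
  replace (Cmod (Cconj s * p - Cconj b * a)) with (Cmod (Cconj p * s - Cconj a * b)).
    exact H.
  rewrite <- Cmod_conj, Cminus_conj, !Cmult_conj, !Cconj_conj.
  f_equal; ring.
rewrite <- Cmod_conj, Cminus_conj, Cmult_conj, Cconj_conj.
replace (Cconj 1) with (RtoC 1) by (unfold Cconj, RtoC; simpl; f_equal; ring).
f_equal; ring.
Qed.

Section Limits.
Context {T : Type}.

(** * Limits of nodes along a filter base *)

(** A filter base indexed by tolerances; passing to a finer base replaces the
    extraction of subsequences. *)
Definition filter_base (S : R -> T -> Prop) : Prop :=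
  (forall d e t, (d <= e)%R -> S d t -> S e t) /\
  (forall e, (0 < e)%R -> exists t, S e t).

Definition limit_along (S : R -> T -> Prop) (u : T -> C) (l : C) : Prop :=
  forall e, (0 < e)%R -> exists d, (0 < d)%R /\ forall t, S d t -> (Cmod (u t - l) < e)%R.

(** The limit is the upper limit of x along the base: the supremum of the numbers
    that x reaches somewhere on every member. *)
Lemma cluster_real (S : R -> T -> Prop) (x : T -> R) : filter_base S ->
  (forall e t, S e t -> Rabs (x t) <= 1)%R ->
  exists l, filter_base (fun e t => S e t /\ (Rabs (x t - l) < e)%R).
Proof.
intros [Hmono Hne] Hb.
set (Z := fun y => forall e, (0 < e)%R -> exists t, S e t /\ (y <= x t)%R).
destruct (completeness Z) as [l [Hl1 Hl2]].
- exists 1%R; intros y Hy; destruct (Hy 1%R Rlt_0_1) as [t [Ht1 Ht2]].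
  specialize (Hb _ _ Ht1); apply Rabs_le_between in Hb; lra.
- exists (- 1)%R; intros e He; destruct (Hne e He) as [t Ht]; exists t; split; [exact Ht|].
  specialize (Hb _ _ Ht); apply Rabs_le_between in Hb; lra.
- exists l; split.
    intros d e t Hde [H1 H2]; split; [now apply (Hmono d) | lra].
  intros e He.
  assert (H1 : exists z, Z z /\ (l - e < z)%R).
    apply NNPP; intros N; specialize (Hl2 (l - e)%R).
    assert (l <= l - e)%R; [|lra].
    apply Hl2; intros z Hz; destruct (Rle_or_lt z (l - e)) as [L|L]; [exact L|].
    now destruct N; exists z.
  destruct H1 as [z [Hz Hlz]].
  assert (H2 : exists e0, (0 < e0)%R /\ forall t, S e0 t -> (x t < l + e)%R).
    apply NNPP; intros N.
    assert (l + e <= l)%R; [|lra].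
    apply Hl1; intros e0 He0; apply NNPP; intros N'; apply N.
    exists e0; split; [exact He0|]; intros t Ht.
    apply Rnot_le_lt; intros L; apply N'; now exists t.
  destruct H2 as [e0 [He0 H2]].
  destruct (Hz (Rmin e e0) (Rmin_glb_lt _ _ _ He He0)) as [t [Ht1 Ht2]].
  exists t; split; [apply (Hmono (Rmin e e0)); [apply Rmin_l | exact Ht1]|].
  assert (x t < l + e)%R by (apply H2, (Hmono (Rmin e e0)); [apply Rmin_r | exact Ht1]).
  apply Rabs_lt_between; lra.
Qed.

Lemma cluster (S : R -> T -> Prop) (u : T -> C) : filter_base S ->
  (forall e t, S e t -> unit_disc (u t)) ->
  exists (S' : R -> T -> Prop) (l : C), filter_base S' /\
    (forall e t, S' e t -> S e t) /\ limit_along S' u l.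
Proof.
intros HS Hb.
destruct (cluster_real S (fun t => Re (u t)) HS) as [l1 H1].
  intros e t Ht; apply Rle_trans with (1 := re_le_Cmod _); left; exact (Hb _ _ Ht).
destruct (cluster_real _ (fun t => Im (u t)) H1) as [l2 H2].
  intros e t [Ht _]; apply Rle_trans with (1 := im_le_Cmod _); left; exact (Hb _ _ Ht).
eexists; exists (l1, l2); split; [exact H2|]; split; [tauto|].
intros e He; exists (e / 2)%R; split; [lra|]; intros t [[_ Ht1] Ht2].
apply Rle_lt_trans with (Rabs (Re (u t) - l1) + Rabs (Im (u t) - l2))%R; [|lra].
destruct (u t) as [x y]; apply (Cmod_le_sum (x - l1) (y - l2)).
Qed.

Lemma limit_along_sub (S S' : R -> T -> Prop) (u : T -> C) (l : C) :
  (forall e t, S' e t -> S e t) -> limit_along S u l -> limit_along S' u l.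
Proof.
intros H L e He; destruct (L e He) as [d [Hd HD]]; exists d; split; auto.
Qed.

Section Base.
Variable S : R -> T -> Prop.
Hypothesis HS : filter_base S.

Lemma limit_along_const (c : C) : limit_along S (fun _ => c) c.
Proof.
intros e He; exists 1%R; split; [lra|]; intros t _.
now unfold Cminus; rewrite Cplus_opp_r, Cmod_0.
Qed.

Lemma limit_along_conj (u : T -> C) (l : C) :
  limit_along S u l -> limit_along S (fun t => Cconj (u t)) (Cconj l).
Proof.
intros L e He; destruct (L e He) as [d [Hd HD]]; exists d; split; [exact Hd|].
intros t Ht; rewrite <- Cminus_conj, Cmod_conj; auto.
Qed.

Lemma limit_along_plus (u v : T -> C) (l m : C) :
  limit_along S u l -> limit_along S v m -> limit_along S (fun t => u t + v t) (l + m).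
Proof.
intros L M e He.
destruct (L (e / 2)%R) as [d1 [Hd1 H1]]; [lra|].
destruct (M (e / 2)%R) as [d2 [Hd2 H2]]; [lra|].
exists (Rmin d1 d2); split; [now apply Rmin_glb_lt|]; intros t Ht.
specialize (H1 t (proj1 HS _ _ _ (Rmin_l _ _) Ht)).
specialize (H2 t (proj1 HS _ _ _ (Rmin_r _ _) Ht)).
replace (u t + v t - (l + m)) with ((u t - l) + (v t - m)) by ring.
apply Rle_lt_trans with (1 := Cmod_triangle _ _); lra.
Qed.

Lemma limit_along_mult (u v : T -> C) (l m : C) :
  limit_along S u l -> limit_along S v m -> limit_along S (fun t => u t * v t) (l * m).
Proof.
intros L M e He.
set (A := (Cmod l + Cmod m + 1)%R).
assert (HA : (1 <= A)%R) by (unfold A; generalize (Cmod_ge_0 l) (Cmod_ge_0 m); lra).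
set (k := Rmin 1 (e / (2 * A))).
assert (Hk : (0 < k)%R) by (apply Rmin_glb_lt; [lra | apply Rdiv_lt_0_compat; lra]).
assert (Hk1 : (k <= 1)%R) by apply Rmin_l.
assert (Hk2 : (2 * A * k <= e)%R).
  apply Rle_trans with (2 * A * (e / (2 * A)))%R; [|right; field; lra].
  apply Rmult_le_compat_l; [lra | apply Rmin_r].
destruct (L k Hk) as [d1 [Hd1 H1]].
destruct (M k Hk) as [d2 [Hd2 H2]].
exists (Rmin d1 d2); split; [now apply Rmin_glb_lt|]; intros t Ht.
specialize (H1 t (proj1 HS _ _ _ (Rmin_l _ _) Ht)).
specialize (H2 t (proj1 HS _ _ _ (Rmin_r _ _) Ht)).
replace (u t * v t - l * m)
  with ((u t - l) * (v t - m) + ((u t - l) * m + l * (v t - m))) by ring.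
apply Rle_lt_trans with (1 := Cmod_triangle _ _).
assert (X := Cmod_triangle ((u t - l) * m) (l * (v t - m))).
rewrite !Cmod_mult in *.
generalize (Cmod_ge_0 (u t - l)) (Cmod_ge_0 (v t - m)) (Cmod_ge_0 l) (Cmod_ge_0 m).
unfold A in Hk2; intros; nra.
Qed.

Lemma limit_along_minus (u v : T -> C) (l m : C) :
  limit_along S u l -> limit_along S v m -> limit_along S (fun t => u t - v t) (l - m).
Proof.
intros L M; unfold Cminus; apply limit_along_plus; [exact L|].
intros e He; destruct (M e He) as [d [Hd HD]]; exists d; split; [exact Hd|].
intros t Ht; replace (- v t - - m) with (- (v t - m)) by ring.
rewrite Cmod_opp; auto.
Qed.

Lemma limit_along_Cmod_le (u v : T -> C) (l m : C) (K : R) :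
  limit_along S u l -> limit_along S v m ->
  (forall e t, S e t -> (Cmod (u t) <= Cmod (v t) + K * e)%R) -> (Cmod l <= Cmod m)%R.
Proof.
intros L M H; apply le_epsilon; intros e He.
set (A := (Rabs K + 1)%R).
assert (HA : (1 <= A)%R) by (unfold A; generalize (Rabs_pos K); lra).
destruct (L (e / 4)%R) as [d1 [Hd1 H1]]; [lra|].
destruct (M (e / 4)%R) as [d2 [Hd2 H2]]; [lra|].
assert (Hd3 : (0 < e / (4 * A))%R) by (apply Rdiv_lt_0_compat; lra).
set (d := Rmin (Rmin d1 d2) (e / (4 * A))).
assert (Hd : (0 < d)%R) by (apply Rmin_glb_lt; [now apply Rmin_glb_lt | exact Hd3]).
destruct (proj2 HS d Hd) as [t Ht].
assert (D1 : (d <= d1)%R) by (apply Rle_trans with (1 := Rmin_l _ _); apply Rmin_l).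
assert (D2 : (d <= d2)%R) by (apply Rle_trans with (1 := Rmin_l _ _); apply Rmin_r).
specialize (H1 t (proj1 HS _ _ _ D1 Ht)); specialize (H2 t (proj1 HS _ _ _ D2 Ht)).
specialize (H d t Ht).
assert (D3 : (K * d <= e / 4)%R).
  apply Rle_trans with (A * (e / (4 * A)))%R; [|right; field; lra].
  apply Rle_trans with (A * d)%R.
    apply Rmult_le_compat_r; [lra|]; unfold A; generalize (Rle_abs K); lra.
  apply Rmult_le_compat_l; [lra | apply Rmin_r].
assert (T1 := Cmod_reverse_triangle l (u t)); rewrite Cmod_minus_sym in T1.
assert (T2 := Cmod_reverse_triangle (v t) m).
lra.
Qed.

Lemma limit_along_closed (u v : T -> C) (l m : C) :
  limit_along S u l -> limit_along S v m ->
  (forall e t, S e t -> (Cmod (u t) <= Cmod (v t))%R) -> (Cmod l <= Cmod m)%R.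
Proof.
intros L M H; apply (limit_along_Cmod_le u v l m 0); auto.
intros e t Ht; specialize (H e t Ht); lra.
Qed.
End Base.
End Limits.

Ltac limit_along_polynomial := repeat first
  [ assumption | apply limit_along_const
  | apply limit_along_minus | apply limit_along_plus | apply limit_along_mult
  | apply limit_along_conj ].

Lemma fibre_constraints_closed {T : Type} (S : R -> T -> Prop) (a b : C)
  (u v w x : T -> C) (p q r s : C) : filter_base S ->
  limit_along S u p -> limit_along S v q -> limit_along S w r -> limit_along S x s ->
  (forall e t, S e t -> fibre_constraints a b (u t) (v t) (w t) (x t)) ->
  fibre_constraints a b p q r s.
Proof.
intros HS Hp Hq Hr Hs H.
assert (close : forall (y z : T -> C) (l m : C), limit_along S y l -> limit_along S z m ->
    (forall t, fibre_constraints a b (u t) (v t) (w t) (x t) ->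
       (Cmod (y t) <= Cmod (z t))%R) -> (Cmod l <= Cmod m)%R).
  intros y z l m Hy Hz HC; apply (limit_along_closed S HS y z); auto.
  intros e t Ht; apply HC, (H e t Ht).
unfold fibre_constraints in close; repeat split; unfold quotient_pick, fibre_pick, separated.
- eapply close; [ | | intros t HC; exact (proj1 HC)]; limit_along_polynomial.
- eapply close; [ | | intros t (_ & HC & _); exact HC]; limit_along_polynomial.
- eapply close; [ | | intros t (_ & _ & HC & _); exact HC]; limit_along_polynomial.
- eapply close; [ | | intros t (_ & _ & _ & HC & _); exact HC]; limit_along_polynomial.
- eapply close; [ | | intros t (_ & _ & _ & _ & HC & _); exact HC]; limit_along_polynomial.
- eapply close; [ | | intros t (_ & _ & _ & _ & _ & HC & _); exact HC]; limit_along_polynomial.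
- eapply close; [ | | intros t (_ & _ & _ & _ & _ & _ & HC & _); exact HC];
    limit_along_polynomial.
- eapply close; [ | | intros t (_ & _ & _ & _ & _ & _ & _ & HC); exact HC];
    limit_along_polynomial.
Qed.

(** The product bound turns all four fibre inequalities into equalities.  A node on
    the circle then fixes the moduli of its two neighbours; for instance |q| = 1 gives
    |p| = |a1| and |s| = |b2|. *)
Lemma rotation_of_boundary_limit (a1 a2 b1 b2 p q r s : C) :
  a1 <> 0 -> a2 <> 0 -> b1 <> 0 -> b2 <> 0 -> a1 <> a2 -> b1 <> b2 ->
  unit_disc a1 -> unit_disc a2 -> unit_disc b1 -> unit_disc b2 ->
  Cmod (a1 * a2) = Cmod (b1 * b2) ->
  fibre_constraints a1 a2 p q r s -> fibre_constraints b1 b2 p r q s ->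
  (Cmod p <= 1)%R -> (Cmod q <= 1)%R -> (Cmod r <= 1)%R -> (Cmod s <= 1)%R ->
  (Cmod (p * q * (r * s)) <= Cmod (a1 * a2))%R ->
  exists u, Cmod u = 1%R /\ ((b1 = u * a1 /\ b2 = u * a2) \/ (b2 = u * a1 /\ b1 = u * a2)).
Proof.
intros Na1 Na2 Nb1 Nb2 Naa Nbb Ha1 Ha2 Hb1 Hb2 Hab CA CB Hp Hq Hr Hs Hprod.
assert (CA' := CA); assert (CB' := CB).
destruct CA' as (A1 & A2 & A3 & A4 & _); destruct CB' as (B1 & B2 & B3 & B4 & _).
assert (Pa1 := Cmod_pos _ Na1); assert (Pa2 := Cmod_pos _ Na2).
assert (Pb1 := Cmod_pos _ Nb1); assert (Pb2 := Cmod_pos _ Nb2).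
rewrite !Cmod_mult in *.
assert (Pp := Cmod_ge_0 p); assert (Pq := Cmod_ge_0 q).
assert (Pr := Cmod_ge_0 r); assert (Ps := Cmod_ge_0 s).
assert (EA1 : Cmod a1 = (Cmod p * Cmod q)%R) by nra.
assert (EA2 : Cmod a2 = (Cmod r * Cmod s)%R) by nra.
assert (EB1 : Cmod b1 = (Cmod p * Cmod r)%R) by nra.
assert (EB2 : Cmod b2 = (Cmod q * Cmod s)%R) by nra.
unfold unit_disc in *.
assert (Np : p <> 0) by (intros ->; rewrite Cmod_0 in *; lra).
assert (Nq : q <> 0) by (intros ->; rewrite Cmod_0 in *; lra).
assert (Nr : r <> 0) by (intros ->; rewrite Cmod_0 in *; lra).
assert (Ns : s <> 0) by (intros ->; rewrite Cmod_0 in *; lra).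
assert (outer : (unit_disc p /\ unit_disc s /\
     (Cmod a1 = Cmod p \/ Cmod a2 = Cmod s) /\ (Cmod b1 = Cmod p \/ Cmod b2 = Cmod s)) \/
   (unit_disc q /\ unit_disc r /\
     (Cmod a1 = Cmod q \/ Cmod a2 = Cmod r) /\ (Cmod b2 = Cmod q \/ Cmod b1 = Cmod r))).
  unfold unit_disc.
  destruct (Rle_lt_or_eq_dec _ _ Hq) as [Lq|Eq].
  2:{ left; rewrite Eq in *; lra. }
  destruct (Rle_lt_or_eq_dec _ _ Hr) as [Lr|Er].
  2:{ left; rewrite Er in *; lra. }
  destruct (Rle_lt_or_eq_dec _ _ Hp) as [Lp|Ep].
  2:{ right; rewrite Ep in *; lra. }
  destruct (Rle_lt_or_eq_dec _ _ Hs) as [Ls|Es].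
  2:{ right; rewrite Es in *; lra. }
  destruct (interior_impossible a1 a2 b1 b2 p q r s); try assumption.
  - now rewrite Cmod_mult.
  - now rewrite Cmod_mult.
destruct outer as [(Dp & Ds & EA & EB)|(Dq & Dr & EA & EB)].
- destruct (common_rotation a1 a2 b1 b2 p s) as (u & Hu & U1 & U2); auto.
    now rewrite !Cmod_mult.
  exists u; auto.
- destruct (common_rotation a1 a2 b2 b1 q r) as (u & Hu & U1 & U2); auto.
    now apply quotient_pick_sym.
    rewrite !Cmod_mult; lra.
  exists u; auto.
Qed.

Lemma rotation_of_small_products (a1 a2 b1 b2 : C) :
  a1 <> 0 -> a2 <> 0 -> b1 <> 0 -> b2 <> 0 -> a1 <> a2 -> b1 <> b2 ->
  unit_disc a1 -> unit_disc a2 -> unit_disc b1 -> unit_disc b2 ->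
  Cmod (a1 * a2) = Cmod (b1 * b2) ->
  (forall e, (0 < e)%R -> exists p q r s,
     unit_disc p /\ unit_disc q /\ unit_disc r /\ unit_disc s /\
     fibre_constraints a1 a2 p q r s /\ fibre_constraints b1 b2 p r q s /\
     (Cmod (p * q * (r * s)) <= Cmod (a1 * a2) + e)%R) ->
  exists u, Cmod u = 1%R /\ ((b1 = u * a1 /\ b2 = u * a2) \/ (b2 = u * a1 /\ b1 = u * a2)).
Proof.
intros Na1 Na2 Nb1 Nb2 Naa Nbb Ha1 Ha2 Hb1 Hb2 Hab H.
set (pp := fun t : C * C * (C * C) => fst (fst t)).
set (qq := fun t : C * C * (C * C) => snd (fst t)).
set (rr := fun t : C * C * (C * C) => fst (snd t)).
set (ss := fun t : C * C * (C * C) => snd (snd t)).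
set (S0 := fun e t => unit_disc (pp t) /\ unit_disc (qq t) /\ unit_disc (rr t) /\
  unit_disc (ss t) /\
  fibre_constraints a1 a2 (pp t) (qq t) (rr t) (ss t) /\
  fibre_constraints b1 b2 (pp t) (rr t) (qq t) (ss t) /\
  (Cmod (pp t * qq t * (rr t * ss t)) <= Cmod (a1 * a2) + 1 * e)%R).
assert (B0 : filter_base S0).
  split.
    intros d e t Hde (H1 & H2 & H3 & H4 & H5 & H6 & H7); repeat split; try apply H5; try apply H6;
      auto; lra.
  intros e He; destruct (H e He) as (p & q & r & s & HH).
  exists ((p, q), (r, s)); unfold S0; rewrite Rmult_1_l; exact HH.
destruct (cluster S0 pp B0 ltac:(now intros e t HH; apply HH)) as (S1 & p & B1 & I1 & L1).
destruct (cluster S1 qq B1 ltac:(now intros e t HH; apply I1 in HH; apply HH))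
  as (S2 & q & B2 & I2 & L2).
destruct (cluster S2 rr B2 ltac:(now intros e t HH; apply I2, I1 in HH; apply HH))
  as (S3 & r & B3 & I3 & L3).
destruct (cluster S3 ss B3 ltac:(now intros e t HH; apply I3, I2, I1 in HH; apply HH))
  as (S4 & s & B4 & I4 & L4).
apply (limit_along_sub S3 S4) in L3; [|exact I4].
apply (limit_along_sub S2 S4) in L2; [|auto].
apply (limit_along_sub S1 S4) in L1; [|auto].
assert (I : forall e t, S4 e t -> S0 e t) by auto.
assert (le_1 : forall u l, limit_along S4 u l -> (forall e t, S4 e t -> unit_disc (u t)) ->
   (Cmod l <= 1)%R).
  intros u l L Hu; rewrite <- Cmod_1.
  apply (limit_along_closed S4 B4 u (fun _ => RtoC 1)); [exact L | apply limit_along_const |].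
  intros e t Ht; rewrite Cmod_1; left; now apply (Hu e).
apply (rotation_of_boundary_limit a1 a2 b1 b2 p q r s); auto.
- now apply (fibre_constraints_closed S4 a1 a2 pp qq rr ss); auto; intros e t Ht; apply (I e t).
- now apply (fibre_constraints_closed S4 b1 b2 pp rr qq ss); auto; intros e t Ht; apply (I e t).
- now apply (le_1 pp); auto; intros e t Ht; apply (I e t).
- now apply (le_1 qq); auto; intros e t Ht; apply (I e t).
- now apply (le_1 rr); auto; intros e t Ht; apply (I e t).
- now apply (le_1 ss); auto; intros e t Ht; apply (I e t).
- apply (limit_along_Cmod_le S4 B4 (fun t => pp t * qq t * (rr t * ss t)) (fun _ => a1 * a2)
    _ _ 1); limit_along_polynomial.
  intros e t Ht; apply (I e t Ht).
Qed.

(** * Discs through four points near a rotation *)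

Lemma continuous_Cmod_affine (x y : C) (t0 : R) :
  continuous (fun t : R => Cmod (x + t * y)) t0.
Proof.
apply continuity_pt_filterlim; intros eps He.
assert (Hy := Cmod_ge_0 y).
exists (eps / (Cmod y + 1))%R; split; [apply Rdiv_lt_0_compat; lra|].
intros t [_ Ht]; simpl in *; unfold R_dist in *.
assert (E : x + t * y - (x + t0 * y) = RtoC (t - t0) * y) by (rewrite RtoC_minus; ring).
assert (T1 := Cmod_reverse_triangle (x + t * y) (x + t0 * y)).
assert (T2 := Cmod_reverse_triangle (x + t0 * y) (x + t * y)).
rewrite Cmod_minus_sym, E, Cmod_mult, Cmod_R in T2; rewrite E, Cmod_mult, Cmod_R in T1.
apply Rle_lt_trans with (Rabs (t - t0) * Cmod y)%R; [apply Rabs_le; lra|].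
assert (H0 := Rabs_pos (t - t0)).
apply Rle_lt_trans with (Rabs (t - t0) * (Cmod y + 1))%R; [nra|].
apply Rlt_le_trans with (eps / (Cmod y + 1) * (Cmod y + 1))%R.
  apply Rmult_lt_compat_r; lra.
right; field; lra.
Qed.

Lemma positive_left_of_1 (F : R -> R) : continuous F 1 -> (0 < F 1)%R ->
  exists t0, (t0 < 1)%R /\ forall t, (t0 < t < 1)%R -> (0 < F t)%R.
Proof.
intros HF H1.
destruct (HF (fun y => (0 < y)%R) (open_gt 0 _ H1)) as [d Hd].
exists (1 - d)%R; split; [generalize (cond_pos d); lra|].
intros t Ht; apply Hd; change (Rabs (t - 1) < d)%R; apply Rabs_lt_between; lra.
Qed.

(** This compares |mobius rho (x / t)| (1 + t^2) / (2 t^2) with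
    |mobius l1 t * mobius l2 t|, cleared of denominators.  At t = 1 the second number
    is 1 and the first is |mobius rho x| < 1, so the strict inequality persists for t
    close to 1. *)
Lemma boundary_room (rho : R) (x l1 l2 : C) : (0 <= rho < 1)%R ->
  unit_disc x -> unit_disc l1 -> unit_disc l2 ->
  exists t0, (t0 < 1)%R /\ forall t, (t0 < t < 1)%R ->
   (Cmod (x - rho * t) * (Cmod (1 - Cconj l1 * t) * Cmod (1 - Cconj l2 * t)) * (1 + t * t)
    < 2 * (t * t) * (Cmod (t - rho * x) * (Cmod (t - l1) * Cmod (t - l2))))%R.
Proof.
intros Hrho Hx H1 H2.
set (F := fun t : R =>
  (2 * (t * t) * (Cmod (- rho * x + t * 1) * (Cmod (- l1 + t * 1) * Cmod (- l2 + t * 1)))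
   - Cmod (x + t * - rho) * (Cmod (1 + t * - Cconj l1) * Cmod (1 + t * - Cconj l2))
     * (1 + t * t))%R).
destruct (positive_left_of_1 F) as [t0 [Ht0 HF]].
- assert (I : continuous (fun t : R => t) 1) by apply continuous_id.
  assert (K : forall c : R, continuous (fun _ : R => c) 1) by (intros; apply continuous_const).
  assert (Mu : forall f g : R -> R, continuous f 1 -> continuous g 1 ->
    continuous (fun t => f t * g t)%R 1) by (intros f g; apply (continuous_mult f g)).
  assert (Pl : forall f g : R -> R, continuous f 1 -> continuous g 1 ->
    continuous (fun t => f t + g t)%R 1) by (intros f g; apply (continuous_plus f g)).
  assert (Mi : forall f g : R -> R, continuous f 1 -> continuous g 1 ->
    continuous (fun t => f t - g t)%R 1) by (intros f g; apply (continuous_minus f g)).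
  unfold F; repeat lazymatch goal with
    | |- continuous (fun t => Cmod _) _ => apply continuous_Cmod_affine
    | |- continuous (fun t => @?f t - @?g t)%R _ => apply (Mi f g)
    | |- continuous (fun t => @?f t + @?g t)%R _ => apply (Pl f g)
    | |- continuous (fun t => @?f t * @?g t)%R _ => apply (Mu f g)
    | |- continuous (fun t => t) _ => exact I
    | |- continuous (fun _ => ?c) _ => exact (K c)
    end.
- unfold F.
  assert (S1 : forall l, Cmod (- l + 1 * 1) = Cmod (1 + 1 * - Cconj l)).
    intros l; rewrite <- Cmod_conj, Cplus_conj, Copp_conj.
    f_equal; unfold Cconj, RtoC, Cplus, Cmult, Copp; simpl; f_equal; ring.
  rewrite (S1 l1), (S1 l2).
  assert (N : forall l, unit_disc l -> (0 < Cmod (1 + 1 * - Cconj l))%R).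
    intros l Hl; replace (1 + 1 * - Cconj l) with (1 - Cconj l * 1) by ring.
    generalize (mobius_denominator_Cmod l 1); rewrite Cmod_1; unfold unit_disc in Hl; lra.
  set (A := Cmod (1 + 1 * - Cconj l1)); set (B := Cmod (1 + 1 * - Cconj l2)).
  assert (HA : (0 < A)%R) by now apply N.
  assert (HB : (0 < B)%R) by now apply N.
  assert (Drho : unit_disc rho) by (unfold unit_disc; rewrite Cmod_R, Rabs_pos_eq; lra).
  assert (L := mobius_numerator_lt rho x Drho Hx).
  replace (Cconj rho) with (RtoC rho) in L by (unfold Cconj, RtoC; simpl; f_equal; ring).
  replace (x + 1 * - rho) with (x - rho) by ring.
  replace (- rho * x + 1 * 1) with (1 - rho * x) by ring.
  assert (X := Rmult_lt_0_compat _ _ HA HB).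
  assert (Y : (0 < (Cmod (1 - rho * x) - Cmod (x - rho)) * (A * B))%R)
    by (apply Rmult_lt_0_compat; lra).
  lra.
- exists t0; split; [exact Ht0|]; intros t Ht; specialize (HF t Ht); unfold F in HF.
  replace (x - rho * t) with (x + t * - rho) by ring.
  replace (1 - Cconj l1 * t) with (1 + t * - Cconj l1) by ring.
  replace (1 - Cconj l2 * t) with (1 + t * - Cconj l2) by ring.
  replace (t - rho * x) with (- rho * x + t * 1) by ring.
  replace (t - l1) with (- l1 + t * 1) by ring.
  replace (t - l2) with (- l2 + t * 1) by ring.
  lra.
Qed.

Lemma mobius_opp_cancel (p z : C) : unit_disc p -> unit_disc z ->
  mobius (- p) (mobius p z) = z.
Proof.
intros Hp Hz; replace p with (- - p) at 2 by ring.
apply mobius_cancel; [now apply unit_disc_opp | exact Hz].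
Qed.

Lemma parallelogram (z w : C) :
  (Cmod (z + w) ^ 2 + Cmod (z - w) ^ 2 = 2 * Cmod z ^ 2 + 2 * Cmod w ^ 2)%R.
Proof. rewrite !Cmod2_alt; destruct z, w; simpl; ring. Qed.

Section ExtraPoints.
Variables (rho t : R) (l1 l2 : C).
Hypotheses (Hrho : (0 <= rho < 1)%R) (Ht : (0 < t < 1)%R).
Hypotheses (H1 : unit_disc l1) (H2 : unit_disc l2).

Let q (z : C) : C := mobius l1 z * mobius l2 z.

(** The map h is sought as mobius (- rho) of mobius l1 * mobius l2 * v, which takes
    the value rho at l1 and l2; this is the value that v must take at s in order that
    s * h s = x. *)
Definition residual_value (s x : C) : C := mobius rho (x / s) / q s.

Lemma residual_value_small (s x : C) : Cmod s = t -> (Cmod x < t)%R ->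
  (Cmod (x - rho * s) * (Cmod (1 - Cconj l1 * s) * Cmod (1 - Cconj l2 * s)) * (1 + t * t)
    < 2 * (t * t) * (Cmod (s - rho * x) * (Cmod (s - l1) * Cmod (s - l2))))%R ->
  q s <> 0 /\ (Cmod (residual_value s x) * (1 + t * t) <= 2 * (t * t))%R.
Proof.
intros Hs Hx H.
assert (Ds : unit_disc s) by (unfold unit_disc; lra).
assert (Drho : unit_disc rho) by (unfold unit_disc; rewrite Cmod_R, Rabs_pos_eq; lra).
assert (Ns : s <> 0) by (intros E; rewrite E, Cmod_0 in Hs; lra).
assert (P1 := mobius_denominator_pos l1 s H1 Ds).
assert (P2 := mobius_denominator_pos l2 s H2 Ds).
assert (Dxs : unit_disc (x / s)).
  unfold unit_disc; rewrite Cmod_div, Hs by exact Ns.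
  apply Rmult_lt_reg_r with t; [lra|]; unfold Rdiv; rewrite Rmult_assoc, Rinv_l; lra.
assert (T0 : (0 < t * t)%R) by nra.
assert (P3 : (0 < Cmod (s - rho * x) * (Cmod (s - l1) * Cmod (s - l2)))%R).
  assert (0 <= Cmod (x - rho * s) * (Cmod (1 - Cconj l1 * s) * Cmod (1 - Cconj l2 * s)) * (1 + t * t))%R.
    repeat apply Rmult_le_pos; try apply Cmod_ge_0; lra.
  nra.
assert (G0 := Cmod_ge_0 (s - rho * x)); assert (G1 := Cmod_ge_0 (s - l1)).
assert (G2 := Cmod_ge_0 (s - l2)).
assert (Q0 : (0 < Cmod (s - rho * x))%R) by (destruct G0 as [?|E]; [lra | rewrite <- E in P3; lra]).
assert (Q1 : (0 < Cmod (s - l1))%R) by (destruct G1 as [?|E]; [lra | rewrite <- E in P3; lra]).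
assert (Q2 : (0 < Cmod (s - l2))%R) by (destruct G2 as [?|E]; [lra | rewrite <- E in P3; lra]).
assert (Nq : q s <> 0).
  apply Cmult_neq_0.
    intros E; apply mobius_eq_0 in E; auto; rewrite E in Q1.
    unfold Cminus in Q1; rewrite Cplus_opp_r, Cmod_0 in Q1; lra.
  intros E; apply mobius_eq_0 in E; auto; rewrite E in Q2.
  unfold Cminus in Q2; rewrite Cplus_opp_r, Cmod_0 in Q2; lra.
split; [exact Nq|].
unfold residual_value; rewrite Cmod_div by exact Nq.
unfold q; rewrite Cmod_mult, !Cmod_mobius by assumption.
replace (Cconj rho) with (RtoC rho) by (unfold Cconj, RtoC; simpl; f_equal; ring).
replace (x / s - rho) with ((x - rho * s) / s) by (field; exact Ns).
replace (1 - rho * (x / s)) with ((s - rho * x) / s) by (field; exact Ns).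
rewrite !Cmod_div, Hs by exact Ns.
left.
apply Rmult_lt_reg_r with (Cmod (s - rho * x) * (Cmod (s - l1) * Cmod (s - l2)))%R; [exact P3|].
match goal with |- (?L < _)%R => replace L with
 (Cmod (x - rho * s) * (Cmod (1 - Cconj l1 * s) * Cmod (1 - Cconj l2 * s)) * (1 + t * t))%R end.
  exact H.
field; repeat split; lra.
Qed.

Let v (v1 v2 z : C) : C := (v1 * (z + t) ^ 2 + v2 * (z - t) ^ 2) / RtoC (4 * (t * t)).

(** The numerator is bounded by max(|v1|, |v2|) (|z + t|^2 + |z - t|^2), and the
    parallelogram identity bounds the sum of squares by 2 + 2 t^2. *)
Lemma two_point_factor_disc (v1 v2 z : C) :
  (Cmod v1 * (1 + t * t) <= 2 * (t * t))%R -> (Cmod v2 * (1 + t * t) <= 2 * (t * t))%R ->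
  unit_disc z -> unit_disc (v v1 v2 z).
Proof.
intros V1 V2 Hz; unfold unit_disc in *; unfold v.
assert (T0 : (0 < t * t)%R) by nra.
rewrite Cmod_div by (intros E; apply RtoC_inj in E; lra).
rewrite Cmod_R, Rabs_pos_eq by lra.
apply Rmult_lt_reg_r with (4 * (t * t))%R; [lra|].
unfold Rdiv; rewrite Rmult_assoc, Rinv_l, Rmult_1_r, Rmult_1_l by lra.
apply Rle_lt_trans with (1 := Cmod_triangle _ _); rewrite !Cmod_mult, !Cmod_pow.
assert (P := parallelogram z t).
rewrite (Cmod_R t), Rabs_pos_eq in P by lra.
assert (A1 := pow2_ge_0 (Cmod (z + t))); assert (A2 := pow2_ge_0 (Cmod (z - t))).
assert (Z := Cmod_ge_0 z).
assert (Z2 : (Cmod z ^ 2 < 1)%R) by nra.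
apply Rmult_lt_reg_r with (1 + t * t)%R; [lra|].
apply Rle_lt_trans with (2 * (t * t) * (Cmod (z + t) ^ 2 + Cmod (z - t) ^ 2))%R.
  apply Rmult_le_compat_r with (r := (Cmod (z + t) ^ 2)%R) in V1; [|exact A1].
  apply Rmult_le_compat_r with (r := (Cmod (z - t) ^ 2)%R) in V2; [|exact A2].
  lra.
rewrite P; nra.
Qed.

Lemma extra_points_map (x y : C) :
  (Cmod x < t)%R -> (Cmod y < t)%R -> q t <> 0 -> q (- t) <> 0 ->
  (Cmod (residual_value t x) * (1 + t * t) <= 2 * (t * t))%R ->
  (Cmod (residual_value (- t) y) * (1 + t * t) <= 2 * (t * t))%R ->
  exists h, self_map h /\ h l1 = rho /\ h l2 = rho /\ t * h t = x /\ - t * h (- t) = y.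
Proof.
intros Hx Hy Nt Nt' V1 V2.
assert (Drho : unit_disc rho) by (unfold unit_disc; rewrite Cmod_R, Rabs_pos_eq; lra).
assert (NT : RtoC t <> 0) by (intros E; apply RtoC_inj in E; lra).
assert (Ct : Cmod t = t) by (rewrite Cmod_R, Rabs_pos_eq; lra).
set (v1 := residual_value t x) in *; set (v2 := residual_value (- t) y) in *.
set (w := fun z => q z * v v1 v2 z).
assert (Hw : self_map w).
  intros z Hz; split.
  - apply holo_mult; [now apply holo_mult; apply holo_mobius|].
    apply holo_mult; [|apply holo_const].
    apply (holo_plus (fun z => v1 * (z + t) ^ 2) (fun z => v2 * (z - t) ^ 2)).
    + apply (holo_mult (fun _ => v1) (fun z => (z + t) ^ 2)); [apply holo_const|].
      apply (holo_pow (fun z => z + t)), holo_plus; [apply holo_id | apply holo_const].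
    + apply (holo_mult (fun _ => v2) (fun z => (z - t) ^ 2)); [apply holo_const|].
      apply (holo_pow (fun z => z - t)), holo_minus; [apply holo_id | apply holo_const].
  - assert (B1 := two_point_factor_disc v1 v2 z V1 V2 Hz).
    assert (B2 := mobius_disc l1 z H1 Hz); assert (B3 := mobius_disc l2 z H2 Hz).
    unfold unit_disc in *; unfold w, q; rewrite !Cmod_mult.
    generalize (Cmod_ge_0 (mobius l1 z)) (Cmod_ge_0 (mobius l2 z)) (Cmod_ge_0 (v v1 v2 z)).
    intros; assert (Cmod (mobius l1 z) * Cmod (mobius l2 z) <= 1)%R by nra. nra.
assert (Dopp := unit_disc_opp rho Drho).
exists (fun z => mobius (- rho) (w z)); split; [|split; [|split; [|split]]].
- intros z Hz; destruct (Hw z Hz) as [W1 W2]; split; [|now apply mobius_disc].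
  apply (holo_comp (mobius (- rho)) w); [now apply holo_mobius | exact W1].
- unfold w, q; rewrite mobius_self, !Cmult_0_l, mobius_0; ring.
- unfold w, q; rewrite mobius_self, Cmult_0_r, Cmult_0_l, mobius_0; ring.
- assert (Ew : w t = mobius rho (x / t)).
    unfold w, v, v1, residual_value; rewrite RtoC_mult, RtoC_mult.
    field; auto.
  rewrite Ew, mobius_opp_cancel; [field; exact NT | exact Drho |].
  unfold unit_disc; rewrite Cmod_div, Ct by exact NT.
  apply Rmult_lt_reg_r with t; [lra|]; unfold Rdiv; rewrite Rmult_assoc, Rinv_l; lra.
- assert (NT' : - RtoC t <> 0) by (intros E; apply NT; replace (RtoC t) with (- - t) by ring; rewrite E; ring).
  assert (Ew : w (- t) = mobius rho (y / - t)).
    unfold w, v, v2; set (v2' := residual_value (- t) y).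
    replace (mobius rho (y / - t)) with (q (- t) * v2') by (unfold v2', residual_value; field; auto).
    rewrite RtoC_mult, RtoC_mult; field; exact NT.
  rewrite Ew, mobius_opp_cancel; [field; exact NT | exact Drho |].
  unfold unit_disc; rewrite Cmod_div, Cmod_opp, Ct by exact NT'.
  apply Rmult_lt_reg_r with t; [lra|]; unfold Rdiv; rewrite Rmult_assoc, Rinv_l; lra.
Qed.
End ExtraPoints.

Lemma extra_points_near_boundary (rho : R) (l1 l2 x y : C) : (0 <= rho < 1)%R ->
  unit_disc l1 -> unit_disc l2 -> unit_disc x -> unit_disc y ->
  exists t0, (t0 < 1)%R /\ forall t : R, (t0 < t < 1)%R ->
    exists h, self_map h /\ h l1 = rho /\ h l2 = rho /\ t * h t = x /\ - t * h (- t) = y.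
Proof.
intros Hrho H1 H2 Hx Hy.
destruct (boundary_room rho x l1 l2) as [s1 [S1 R1]]; auto.
destruct (boundary_room rho (- y) (- l1) (- l2)) as [s2 [S2 R2]]; auto using unit_disc_opp.
unfold unit_disc in Hx, Hy.
exists (Rmax (Rmax s1 s2) (Rmax (Rmax (Cmod x) (Cmod y)) 0)); split.
  repeat apply Rmax_lub_lt; lra.
intros t [Ht Ht1].
assert (M1 := Rmax_l (Rmax s1 s2) (Rmax (Rmax (Cmod x) (Cmod y)) 0)).
assert (M2 := Rmax_r (Rmax s1 s2) (Rmax (Rmax (Cmod x) (Cmod y)) 0)).
assert (M3 := Rmax_l s1 s2); assert (M4 := Rmax_r s1 s2).
assert (M5 := Rmax_l (Rmax (Cmod x) (Cmod y)) 0); assert (M6 := Rmax_r (Rmax (Cmod x) (Cmod y)) 0).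
assert (M7 := Rmax_l (Cmod x) (Cmod y)); assert (M8 := Rmax_r (Cmod x) (Cmod y)).
specialize (R1 t); specialize (R2 t).
assert (Ct : Cmod t = t) by (rewrite Cmod_R, Rabs_pos_eq; lra).
destruct (residual_value_small rho t l1 l2 Hrho ltac:(lra) H1 H2 t x Ct ltac:(lra)) as [N1 V1].
  apply R1; lra.
destruct (residual_value_small rho t l1 l2 Hrho ltac:(lra) H1 H2 (- t) y) as [N2 V2].
- rewrite Cmod_opp; exact Ct.
- lra.
- replace (y - rho * - t) with (- (- y - rho * t)) by ring.
  replace (1 - Cconj l1 * - t) with (1 - Cconj (- l1) * t) by (rewrite Copp_conj; ring).
  replace (1 - Cconj l2 * - t) with (1 - Cconj (- l2) * t) by (rewrite Copp_conj; ring).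
  replace (- t - rho * y) with (- (t - rho * - y)) by ring.
  replace (- t - l1) with (- (t - - l1)) by ring.
  replace (- t - l2) with (- (t - - l2)) by ring.
  rewrite !Cmod_opp; apply R2; lra.
- apply (extra_points_map rho t l1 l2); auto; lra.
Qed.

(** Take p = a1 / rho and s = a2 / rho, where h and k are equal to rho, and place the
    two other nodes at t and -t, whose moduli are at most 1.  The product of the
    moduli is at most |a1 a2| / rho^2. *)
Lemma almost_rotation_through_four_points (a1 a2 : C) (e : R) :
  a1 <> 0 -> a2 <> 0 -> unit_disc a1 -> unit_disc a2 -> (0 < e)%R ->
  exists (f g : C -> C) (p q r s : C),
    self_map f /\ self_map g /\ f 0 = 0 /\ g 0 = 0 /\
    unit_disc p /\ unit_disc q /\ unit_disc r /\ unit_disc s /\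
    f p = a1 /\ f q = a1 /\ f r = a2 /\ f s = a2 /\
    g p = a1 /\ g q = a2 /\ g r = a1 /\ g s = a2 /\
    (Cmod (p * q * (r * s)) <= Cmod (a1 * a2) + e)%R.
Proof.
intros N1 N2 H1 H2 He; unfold unit_disc in H1, H2.
(* With rho between m and 1, the points a1 / rho and a2 / rho lie in the disc, and the
   bounds 1/2 and 1 - e/8 give |a1 a2| / rho^2 <= |a1 a2| + e. *)
set (m := Rmax (Rmax (Cmod a1) (Cmod a2)) (Rmax (/ 2) (1 - e / 8))).
assert (Hm : (m < 1)%R) by (repeat apply Rmax_lub_lt; lra).
assert (M1 := Rmax_l (Rmax (Cmod a1) (Cmod a2)) (Rmax (/ 2) (1 - e / 8))).
assert (M2 := Rmax_r (Rmax (Cmod a1) (Cmod a2)) (Rmax (/ 2) (1 - e / 8))).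
fold m in M1, M2.
assert (M3 := Rmax_l (Cmod a1) (Cmod a2)); assert (M4 := Rmax_r (Cmod a1) (Cmod a2)).
assert (M5 := Rmax_l (/ 2) (1 - e / 8)); assert (M6 := Rmax_r (/ 2) (1 - e / 8)).
set (rho := ((m + 1) / 2)%R).
assert (Hrho : (0 <= rho < 1)%R) by (unfold rho; lra).
assert (Hrm : (m < rho)%R) by (unfold rho; lra).
assert (Nrho : RtoC rho <> 0) by (intros E; apply RtoC_inj in E; lra).
assert (Crho : Cmod rho = rho) by (rewrite Cmod_R, Rabs_pos_eq; lra).
assert (small : forall a, (Cmod a <= m)%R -> unit_disc (a / rho)).
  intros a Ha; unfold unit_disc; rewrite Cmod_div, Crho by exact Nrho.
  apply Rmult_lt_reg_r with rho; [lra|]; unfold Rdiv; rewrite Rmult_assoc, Rinv_l; lra.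
assert (D1 : unit_disc (a1 / rho)) by (apply small; lra).
assert (D2 : unit_disc (a2 / rho)) by (apply small; lra).
destruct (extra_points_near_boundary rho (a1 / rho) (a2 / rho) a1 a2) as [s1 [S1 T1]]; auto.
destruct (extra_points_near_boundary rho (a1 / rho) (a2 / rho) a2 a1) as [s2 [S2 T2]]; auto.
set (t := ((Rmax (Rmax s1 s2) 0 + 1) / 2)%R).
assert (Ht : (Rmax (Rmax s1 s2) 0 < t < 1)%R).
  assert (Rmax (Rmax s1 s2) 0 < 1)%R by (repeat apply Rmax_lub_lt; lra).
  unfold t; lra.
assert (K1 := Rmax_l (Rmax s1 s2) 0); assert (K2 := Rmax_r (Rmax s1 s2) 0).
assert (K3 := Rmax_l s1 s2); assert (K4 := Rmax_r s1 s2).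
destruct (T1 t ltac:(lra)) as (h & Hh & h1 & h2 & h3 & h4).
destruct (T2 t ltac:(lra)) as (k & Hk & k1 & k2 & k3 & k4).
assert (mult_self : forall h, self_map h -> self_map (fun z => z * h z)).
  intros h' Hh' z Hz; destruct (Hh' z Hz) as [A B]; split.
    apply holo_mult; [apply holo_id | exact A].
  unfold unit_disc in *; rewrite Cmod_mult.
  generalize (Cmod_ge_0 z) (Cmod_ge_0 (h' z)); nra.
assert (Ct : Cmod t = t) by (rewrite Cmod_R, Rabs_pos_eq; lra).
exists (fun z => z * h z), (fun z => z * k z), (a1 / rho), (RtoC t), (- RtoC t), (a2 / rho).
refine (conj (mult_self h Hh) (conj (mult_self k Hk) _)).
repeat split; auto; try ring.
- unfold unit_disc; lra.
- unfold unit_disc; rewrite Cmod_opp; lra.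
- rewrite h1; field; exact Nrho.
- rewrite h2; field; exact Nrho.
- rewrite k1; field; exact Nrho.
- rewrite k2; field; exact Nrho.
- rewrite !Cmod_mult, !Cmod_div, Cmod_opp, Crho, Ct by exact Nrho.
  assert (P1 := Cmod_ge_0 a1); assert (P2 := Cmod_ge_0 a2).
  set (A := (Cmod a1 * Cmod a2)%R).
  assert (HA : (0 <= A <= 1)%R) by (unfold A; nra).
  replace (Cmod a1 / rho * t * (t * (Cmod a2 / rho)))%R with (A * (t * t) / (rho * rho))%R
    by (unfold A; field; lra).
  apply Rmult_le_reg_r with (rho * rho)%R; [nra|].
  unfold Rdiv; rewrite Rmult_assoc, Rinv_l, Rmult_1_r by nra.
  assert (t * t <= 1)%R by nra.
  assert (A * (t * t) <= A)%R by nra.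
  assert (1 - rho * rho <= e / 4)%R by (unfold rho; nra).
  assert (rho * rho >= / 4)%R by nra.
  nra.
Qed.

Open Scope R_scope.

(** * The Lempert functions of the disc and of the bidisc *)

Notation bidisc_space := (prod_NormedModule C_AbsRing C_NormedModule C_NormedModule).

Definition product_of {V : Type} (f : V -> R) (l : list V) : R := fold_right Rmult 1 (map f l).

Lemma product_of_bounds {V : Type} (f : V -> R) (l : list V) :
  (forall s, In s l -> 0 <= f s <= 1) -> 0 <= product_of f l <= 1.
Proof.
induction l as [|x l IH]; unfold product_of; simpl; intros H; [lra|].
assert (H1 := H x (or_introl eq_refl)).
assert (H2 := IH (fun s Hs => H s (or_intror Hs))); unfold product_of in H2; nra.
Qed.

Lemma product_of_app {V : Type} (f : V -> R) (l l' : list V) :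
  product_of f (l ++ l') = product_of f l * product_of f l'.
Proof.
induction l as [|x l IH]; unfold product_of in *; simpl; [ring | rewrite IH; ring].
Qed.

(** The factors lie in [0, 1], so leaving some of them out increases the product. *)
Lemma product_of_incl {V : Type} (f : V -> R) (l L : list V) :
  NoDup l -> incl l L -> (forall s, In s L -> 0 <= f s <= 1) ->
  product_of f L <= product_of f l.
Proof.
revert L; induction l as [|x l IH]; intros L Hl Hincl Hf.
  now apply product_of_bounds.
destruct (in_split x L) as [L1 [L2 ->]]; [apply Hincl; now left|].
inversion Hl as [|? ? Hx Hl']; subst.
assert (H : product_of f (L1 ++ L2) <= product_of f l).
  apply IH; [exact Hl' | |].
    intros s Hs; assert (Hs' := Hincl s (or_intror Hs)).
    rewrite in_app_iff in *; simpl in Hs'.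
    destruct Hs' as [?|[->|?]]; [now left | contradiction | now right].
  intros s Hs; apply Hf; rewrite in_app_iff in *; simpl; tauto.
assert (Hx1 : 0 <= f x <= 1) by (apply Hf; rewrite in_app_iff; simpl; tauto).
rewrite product_of_app in *.
unfold product_of in *; simpl; nra.
Qed.

Lemma prod_over_list {V : NormedModule C_AbsRing} (S : V -> Prop) (L : list V) (f : V -> R) :
  NoDup L -> (forall s, S s <-> In s L) -> (forall s, S s -> 0 <= f s <= 1) ->
  prod_over S f = Finite (product_of f L).
Proof.
intros HL HS Hf; apply is_glb_Rbar_unique; split.
- intros p [l [Hl [Hin ->]]]; simpl.
  apply product_of_incl; [exact Hl | |].
    intros s Hs; now apply HS, Hin.
  intros s Hs; now apply Hf, HS.
- intros b Hb; apply Hb; exists L; split; [exact HL|]; split; [apply HS | reflexivity].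
Qed.

Lemma prod_over_sublist {V : NormedModule C_AbsRing} (T : V -> Prop) (L : list V)
  (d : V -> bool) (f : V -> R) :
  NoDup L -> (forall s, T s -> In s L) -> (forall s, d s = true <-> T s) ->
  (forall s, T s -> 0 <= f s <= 1) ->
  prod_over T f = Finite (product_of (fun s => if d s then f s else 1) L).
Proof.
intros HL HT Hd Hf.
rewrite (prod_over_list T (filter d L) f).
- f_equal; clear; induction L as [|x L IH]; [reflexivity|]; simpl.
  unfold product_of in *; simpl; destruct (d x); simpl; rewrite IH; [reflexivity | ring].
- now apply NoDup_filter.
- intros s; rewrite filter_In, Hd; split; [auto | tauto].
- exact Hf.
Qed.

Lemma hol_bidisc_components (phi : C -> C * C) :
  hol_disc (V := bidisc_space) bidisc phi ->
  self_map (fun z => fst (phi z)) /\ self_map (fun z => snd (phi z)).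
Proof.
intros H; split; intros z Hz; destruct (H z Hz) as [[l Hl] [H1 H2]]; split; auto.
- exists (fst l).
  apply (filterdiff_comp (U := AbsRing_NormedModule C_AbsRing) (V := bidisc_space)
    (W := C_NormedModule) phi fst (fun y => scal y l) fst Hl).
  apply filterdiff_linear, is_linear_fst.
- exists (snd l).
  apply (filterdiff_comp (U := AbsRing_NormedModule C_AbsRing) (V := bidisc_space)
    (W := C_NormedModule) phi snd (fun y => scal y l) snd Hl).
  apply filterdiff_linear, is_linear_snd.
Qed.

Lemma hol_bidisc_pair (f g : C -> C) : self_map f -> self_map g ->
  hol_disc (V := bidisc_space) bidisc (fun z => (f z, g z)).
Proof.
intros Hf Hg z Hz; destruct (Hf z Hz) as [[l Hl] H1]; destruct (Hg z Hz) as [[m Hm] H2].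
split; [|split; assumption].
exists (l, m).
apply (filterdiff_comp'_2 (T := AbsRing_NormedModule C_AbsRing) (U := C_NormedModule)
  (V := C_NormedModule) (W := bidisc_space) f g (fun u v => (u, v)) z _ _ (fun u v => (u, v)) Hl Hm).
apply (filterdiff_ext_lin _ (fun t => t)); [|intros [u v]; reflexivity].
apply (filterdiff_ext (fun t => t)); [intros [u v]; reflexivity|].
apply filterdiff_id.
Qed.

(** The nodes p, q, r, s are those of (a1,b1), (a1,b2), (a2,b1), (a2,b2). *)
Definition four_point_product (a1 a2 b1 b2 : C) (x : R) : Prop :=
  exists (f g : C -> C) (p q r s : C),
    self_map f /\ self_map g /\ f 0 = 0 /\ g 0 = 0 /\
    unit_disc p /\ unit_disc q /\ unit_disc r /\ unit_disc s /\
    f p = a1 /\ f q = a1 /\ f r = a2 /\ f s = a2 /\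
    g p = b1 /\ g q = b2 /\ g r = b1 /\ g s = b2 /\
    x = Cmod (p * q * (r * s)).

Lemma Cmod_unit_bounds (z : C) : unit_disc z -> 0 <= Cmod z <= 1.
Proof. unfold unit_disc; intros; generalize (Cmod_ge_0 z); lra. Qed.

Definition grid (a1 a2 b1 b2 : C) : list (C * C) :=
  (a1, b1) :: (a1, b2) :: (a2, b1) :: (a2, b2) :: nil.

Lemma NoDup_grid (a1 a2 b1 b2 : C) : a1 <> a2 -> b1 <> b2 -> NoDup (grid a1 a2 b1 b2).
Proof.
intros Na Nb; unfold grid; repeat constructor; simpl; intros H;
  repeat destruct H as [H|H]; try (injection H); congruence || tauto.
Qed.

Lemma in_grid (A B : C -> Prop) (a1 a2 b1 b2 : C) :
  (forall z, A z <-> z = a1 \/ z = a2) -> (forall z, B z <-> z = b1 \/ z = b2) ->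
  forall s, cartesian A B s <-> In s (grid a1 a2 b1 b2).
Proof.
intros HA HB [z w]; unfold cartesian, grid; simpl; rewrite HA, HB; split.
- intros [[->| ->] [->| ->]]; tauto.
- intros [H|[H|[H|[H|[]]]]]; injection H; intros <- <-; tauto.
Qed.

Lemma lempert_bidisc_four_points (A B : C -> Prop) (a1 a2 b1 b2 : C) :
  a1 <> a2 -> b1 <> b2 ->
  (forall z, A z <-> z = a1 \/ z = a2) -> (forall z, B z <-> z = b1 \/ z = b2) ->
  lempert_bidisc (cartesian A B) (RtoC 0, RtoC 0)
    = Glb_Rbar (four_point_product a1 a2 b1 b2).
Proof.
intros Na Nb HA HB; apply Glb_Rbar_eqset; intros x.
assert (HS := in_grid A B a1 a2 b1 b2 HA HB).
assert (HL := NoDup_grid a1 a2 b1 b2 Na Nb).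
split.
- intros (phi & lam & Hphi & H0 & Hlam & Hx).
  rewrite (prod_over_list (V := bidisc_space) _ (grid a1 a2 b1 b2)) in Hx; auto.
  2: intros s Hs; now apply Cmod_unit_bounds, Hlam.
  injection Hx as ->; unfold grid, product_of; simpl.
  destruct (hol_bidisc_components phi Hphi) as [Hf Hg].
  assert (V : forall s, In s (grid a1 a2 b1 b2) -> unit_disc (lam s) /\ phi (lam s) = s).
    intros s Hs; now apply Hlam, HS.
  unfold grid in V; simpl in V.
  destruct (V (a1, b1)) as [U1 V1]; [tauto|]; destruct (V (a1, b2)) as [U2 V2]; [tauto|].
  destruct (V (a2, b1)) as [U3 V3]; [tauto|]; destruct (V (a2, b2)) as [U4 V4]; [tauto|].
  exists (fun z => fst (phi z)), (fun z => snd (phi z)),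
    (lam (a1, b1)), (lam (a1, b2)), (lam (a2, b1)), (lam (a2, b2)).
  rewrite H0, V1, V2, V3, V4; refine (conj Hf (conj Hg _)); repeat split; auto.
  rewrite !Cmod_mult; ring.
- intros (f & g & p & q & r & s & Hf & Hg & f0 & g0 & Hp & Hq & Hr & Hs
    & fp & fq & fr & fs & gp & gq & gr & gs & ->).
  set (lam := fun y : C * C =>
    if Ceq_dec (fst y) a1 then if Ceq_dec (snd y) b1 then p else q
    else if Ceq_dec (snd y) b1 then r else s).
  assert (L : lam (a1, b1) = p /\ lam (a1, b2) = q /\ lam (a2, b1) = r /\ lam (a2, b2) = s).
    unfold lam; simpl; repeat split; repeat destruct Ceq_dec; congruence.
  destruct L as (L1 & L2 & L3 & L4).
  assert (P : passes_through (V := bidisc_space) (fun z => (f z, g z)) (cartesian A B) lam).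
    intros y Hy; apply HS in Hy; unfold grid in Hy; simpl in Hy.
    destruct Hy as [<-|[<-|[<-|[<-|[]]]]]; [rewrite L1 | rewrite L2 | rewrite L3 | rewrite L4];
      split; congruence.
  exists (fun z => (f z, g z)), lam; split; [now apply hol_bidisc_pair|].
  split; [now rewrite f0, g0|]; split; [exact P|].
  rewrite (prod_over_list (V := bidisc_space) _ (grid a1 a2 b1 b2)); auto.
  2: intros y Hy; now apply Cmod_unit_bounds, P.
  unfold grid, product_of; simpl; rewrite L1, L2, L3, L4, !Cmod_mult; f_equal; ring.
Qed.

Lemma four_point_constraints (a1 a2 b1 b2 : C) (f g : C -> C) (p q r s : C) :
  a1 <> 0 -> a2 <> 0 -> b1 <> 0 -> b2 <> 0 -> a1 <> a2 -> b1 <> b2 ->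
  self_map f -> self_map g -> f 0 = 0 -> g 0 = 0 ->
  unit_disc p -> unit_disc q -> unit_disc r -> unit_disc s ->
  f p = a1 -> f q = a1 -> f r = a2 -> f s = a2 ->
  g p = b1 -> g q = b2 -> g r = b1 -> g s = b2 ->
  fibre_constraints a1 a2 p q r s /\ fibre_constraints b1 b2 p r q s.
Proof.
intros; split.
- apply (self_map_fibre_constraints f); auto; congruence.
- apply (self_map_fibre_constraints g); auto; congruence.
Qed.

Lemma four_point_product_ge (a1 a2 b1 b2 : C) (x : R) :
  a1 <> 0 -> a2 <> 0 -> b1 <> 0 -> b2 <> 0 -> a1 <> a2 -> b1 <> b2 ->
  four_point_product a1 a2 b1 b2 x -> Cmod (a1 * a2) <= x.
Proof.
intros Na1 Na2 Nb1 Nb2 Naa Nbb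
  (f & g & p & q & r & s & Hf & Hg & f0 & g0 & Hp & Hq & Hr & Hs
    & fp & fq & fr & fs & gp & gq & gr & gs & ->).
destruct (four_point_constraints a1 a2 b1 b2 f g p q r s) as [(C1 & C2 & _) _]; auto.
rewrite (Cmod_mult a1), (Cmod_mult (p * q)).
apply Rmult_le_compat; auto using Cmod_ge_0.
Qed.

Lemma self_map_scale (u : C) (f : C -> C) : Cmod u = 1 -> self_map f ->
  self_map (fun z => u * f z)%C.
Proof.
intros Hu Hf z Hz; destruct (Hf z Hz) as [H1 H2]; split.
  apply holo_mult; [apply holo_const | exact H1].
unfold unit_disc in *; rewrite Cmod_mult, Hu; lra.
Qed.

Lemma self_map_id : self_map (fun z => z).
Proof. intros z Hz; split; [apply holo_id | exact Hz]. Qed.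

(** The lower bound is the inequality |a1| |a2| <= |p q| |r s|; it is approached by the
    discs (f, u g) with (f, g) close to the diagonal. *)
Lemma Glb_four_point_rotated (a1 a2 u : C) :
  a1 <> 0 -> a2 <> 0 -> a1 <> a2 -> unit_disc a1 -> unit_disc a2 -> Cmod u = 1 ->
  Glb_Rbar (four_point_product a1 a2 (u * a1) (u * a2)) = Finite (Cmod (a1 * a2)).
Proof.
intros Na1 Na2 Naa H1 H2 Hu.
assert (Nu : u <> 0) by (intros ->; rewrite Cmod_0 in Hu; lra).
apply is_glb_Rbar_unique; split.
- intros x Hx; simpl; apply (four_point_product_ge a1 a2 (u * a1) (u * a2)); auto using Cmult_neq_0.
  intros E; apply Naa; now apply (Cmult_cancel_l u).
- intros b Hb.
  assert (K : forall e, 0 < e -> Rbar_le b (Cmod (a1 * a2) + e)).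
    intros e He.
    destruct (almost_rotation_through_four_points a1 a2 e)
      as (f & g & p & q & r & s & Hf & Hg & f0 & g0 & Hp & Hq & Hr & Hs
        & fp & fq & fr & fs & gp & gq & gr & gs & L); auto.
    apply Rbar_le_trans with (Cmod (p * q * (r * s))); [|exact L].
    apply Hb; exists f, (fun z => u * g z)%C, p, q, r, s.
    refine (conj Hf (conj (self_map_scale u g Hu Hg) _)).
    rewrite g0, gp, gq, gr, gs, Cmult_0_r; repeat split; auto.
  destruct b as [b| |].
  + simpl in *; now apply le_epsilon.
  + exact (K 1 Rlt_0_1).
  + exact I.
Qed.

Lemma lempert_disc_pair (A : C -> Prop) (a1 a2 : C) : a1 <> a2 ->
  (forall z, A z <-> z = a1 \/ z = a2) -> unit_disc a1 -> unit_disc a2 ->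
  lempert_disc A 0 = Finite (Cmod (a1 * a2)).
Proof.
intros Na HA H1 H2.
assert (HL : NoDup (a1 :: a2 :: nil)) by (repeat constructor; simpl; intuition).
assert (HS : forall z, A z <-> In z (a1 :: a2 :: nil)).
  intros z; rewrite HA; simpl; intuition.
apply is_glb_Rbar_unique; split.
- intros x (f & lam & Hf & f0 & Hlam & Hx).
  rewrite (prod_over_list (V := C_NormedModule) _ (a1 :: a2 :: nil)) in Hx; auto.
  2: intros s Hs; now apply Cmod_unit_bounds, Hlam.
  injection Hx as ->; unfold product_of; simpl.
  destruct (Hlam a1) as [U1 V1]; [apply HA; tauto|].
  destruct (Hlam a2) as [U2 V2]; [apply HA; tauto|].
  rewrite Rmult_1_r, Cmod_mult; apply Rmult_le_compat; try apply Cmod_ge_0.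
  + rewrite <- V1 at 1; now apply schwarz.
  + rewrite <- V2 at 1; now apply schwarz.
- intros b Hb; apply Hb; exists (fun z => z), (fun z => z).
  split; [exact self_map_id|]; split; [reflexivity|].
  assert (P : passes_through (V := C_NormedModule) (fun z => z) A (fun z => z)).
    intros s Hs; split; [|reflexivity]; apply HA in Hs; destruct Hs as [->| ->]; assumption.
  split; [exact P|].
  rewrite (prod_over_list (V := C_NormedModule) _ (a1 :: a2 :: nil)); auto.
    unfold product_of; simpl; rewrite Rmult_1_r, Cmod_mult; reflexivity.
  intros s Hs; now apply Cmod_unit_bounds, P.
Qed.

Lemma Cmod_cis (t : R) : Cmod (cis t) = 1.
Proof.
unfold Cmod, cis; simpl fst; simpl snd.
assert (E := sin2_cos2 t); unfold Rsqr in E.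
replace (cos t ^ 2 + sin t ^ 2) with 1 by (rewrite <- E; ring).
apply sqrt_1.
Qed.

Lemma exists_cis (u : C) : Cmod u = 1 -> exists t, u = cis t.
Proof.
destruct u as [x y]; unfold Cmod, cis; simpl fst; simpl snd; intros H.
assert (E : x ^ 2 + y ^ 2 = 1).
  rewrite <- (sqrt_sqrt (x ^ 2 + y ^ 2)) by nra. rewrite H; ring.
assert (Hx : -1 <= x <= 1) by nra.
destruct (Rle_or_lt 0 y) as [Hy|Hy].
- exists (acos x); rewrite cos_acos, sin_acos by lra; f_equal.
  replace (1 - Rsqr x) with (y ^ 2) by (unfold Rsqr; lra).
  symmetry; now apply sqrt_pow2.
- exists (- acos x); rewrite cos_neg, sin_neg, cos_acos, sin_acos by lra; f_equal.
  replace (1 - Rsqr x) with ((- y) ^ 2) by (unfold Rsqr; lra).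
  rewrite sqrt_pow2; lra.
Qed.

(** The quotient f(z) / z has modulus 1 at p, hence is constant. *)
Lemma schwarz_equality (f : C -> C) (p : C) : self_map f -> f 0 = 0 ->
  unit_disc p -> p <> 0 -> Cmod (f p) = Cmod p ->
  exists alpha, Cmod alpha = 1 /\ forall z, unit_disc z -> f z = (alpha * z)%C.
Proof.
intros Hf f0 Hp Np E; exists (f p / p)%C; split.
  rewrite Cmod_div, E by exact Np; field; generalize (Cmod_pos p Np); lra.
intros z Hz; destruct (Ceq_dec z 0) as [->|Nz].
  rewrite f0; ring.
assert (Q := quotient_pick_equality (f p) (f z) p z Hp Hz Np Nz
  (self_map_quotient_pick f Hf p z f0 Hp Hz Np Nz) (or_introl E)).
replace (f p / p * z)%C with (f p * z / p)%C by (field; exact Np).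
rewrite <- Q; field; exact Np.
Qed.

(** * Extremal discs and rotations *)

Lemma rotation_fibre_injective (f : C -> C) (alpha : C) (r s : C) : Cmod alpha = 1 ->
  (forall z, unit_disc z -> f z = (alpha * z)%C) -> unit_disc r -> unit_disc s ->
  f r = f s -> r = s.
Proof.
intros Ha Hf Hr Hs E; rewrite !Hf in E by assumption.
apply (Cmult_cancel_l alpha); [|exact E].
intros ->; rewrite Cmod_0 in Ha; lra.
Qed.

(** The three inequalities |c| <= 1, |c| <= |x| and |c| <= |x y| in one form; the
    booleans say which of the two points are met. *)
Lemma fibre_weight_ge (h : C -> C) (c x y : C) (t t' : bool) :
  self_map h -> h 0 = 0 -> c <> 0 -> unit_disc c ->
  (t = true -> unit_disc x /\ h x = c) -> (t' = true -> unit_disc y /\ h y = c) ->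
  (t = true -> t' = true -> x <> y) ->
  Cmod c <= (if t then Cmod x else 1) * (if t' then Cmod y else 1).
Proof.
intros Hh h0 Nc Dc Hx Hy Hxy.
assert (N : forall z, h z = c -> z <> 0) by (intros z Ez ->; congruence).
unfold unit_disc in Dc.
destruct t, t'; rewrite ?Rmult_1_l, ?Rmult_1_r; try lra.
- destruct (Hx eq_refl) as [Dx Ex]; destruct (Hy eq_refl) as [Dy Ey].
  rewrite <- Cmod_mult, <- Ex; apply fibre_product; auto; congruence.
- destruct (Hx eq_refl) as [Dx Ex]; rewrite <- Ex; now apply schwarz.
- destruct (Hy eq_refl) as [Dy Ey]; rewrite <- Ey; now apply schwarz.
Qed.

Lemma schwarz_equality_injective (f : C -> C) (p r s : C) : self_map f -> f 0 = 0 ->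
  unit_disc p -> f p <> 0 -> Cmod (f p) = Cmod p -> unit_disc r -> unit_disc s ->
  f r = f s -> r = s.
Proof.
intros Hf f0 Hp Np E Hr Hs Ers.
destruct (schwarz_equality f p) as (alpha & Ha & Hal); auto.
  intros ->; now apply Np.
now apply (rotation_fibre_injective f alpha).
Qed.

Lemma diagonal_rotations (f g : C -> C) (p s : C) : self_map f -> self_map g ->
  f 0 = 0 -> g 0 = 0 -> unit_disc p -> unit_disc s -> f p <> 0 ->
  Cmod (f p) = Cmod p -> Cmod (g p) = Cmod p ->
  exists alpha beta : C, Cmod alpha = 1 /\ Cmod beta = 1 /\
    (forall z, unit_disc z -> f z = (alpha * z)%C /\ g z = (beta * z)%C) /\
    (g p = beta / alpha * f p /\ g s = beta / alpha * f s)%C.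
Proof.
intros Hf Hg f0 g0 Hp Hs Nfp Ef Eg.
assert (Np : p <> 0) by (intros ->; now apply Nfp).
destruct (schwarz_equality f p) as (alpha & Ha & Hal); auto.
destruct (schwarz_equality g p) as (beta & Hb & Hbe); auto.
assert (Na : alpha <> 0) by (intros ->; rewrite Cmod_0 in Ha; lra).
exists alpha, beta; repeat split; auto.
- rewrite Hal, Hbe by exact Hp; field; exact Na.
- rewrite Hal, Hbe by exact Hs; field; exact Na.
Qed.

(** The products over the two rows are at least |a1| and |a2|, those over the two
    columns at least |b1| and |b2|, and they multiply to |a1 a2| = |b1 b2|; so all four
    are equalities.  An empty row or column would give one of the four
    points modulus 1.  With three points, one
    row is a single point and makes f a rotation, while the other row contradicts its
    injectivity.  Only the two diagonals remain. *)
Lemma extremal_components (f g : C -> C) (a1 a2 b1 b2 p q r s : C)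
  (t11 t12 t21 t22 : bool) :
  a1 <> 0 -> a2 <> 0 -> b1 <> 0 -> b2 <> 0 -> a1 <> a2 -> b1 <> b2 ->
  unit_disc a1 -> unit_disc a2 -> unit_disc b1 -> unit_disc b2 ->
  self_map f -> self_map g -> f 0 = 0 -> g 0 = 0 ->
  (t11 = true -> unit_disc p /\ f p = a1 /\ g p = b1) ->
  (t12 = true -> unit_disc q /\ f q = a1 /\ g q = b2) ->
  (t21 = true -> unit_disc r /\ f r = a2 /\ g r = b1) ->
  (t22 = true -> unit_disc s /\ f s = a2 /\ g s = b2) ->
  Cmod (a1 * a2) = Cmod (b1 * b2) ->
  (if t11 then Cmod p else 1) * (if t12 then Cmod q else 1)
    * ((if t21 then Cmod r else 1) * (if t22 then Cmod s else 1)) = Cmod (a1 * a2) ->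
  exists alpha beta : C, Cmod alpha = 1 /\ Cmod beta = 1 /\
    (forall z, unit_disc z -> f z = (alpha * z)%C /\ g z = (beta * z)%C) /\
    ((b1 = beta / alpha * a1 /\ b2 = beta / alpha * a2)%C \/
     (b2 = beta / alpha * a1 /\ b1 = beta / alpha * a2)%C).
Proof.
intros Na1 Na2 Nb1 Nb2 Naa Nbb Da1 Da2 Db1 Db2 Hf Hg f0 g0 H11 H12 H21 H22 Hab Hprod.
rewrite !Cmod_mult in Hab; rewrite !Cmod_mult in Hprod.
assert (R1 : Cmod a1 <= (if t11 then Cmod p else 1) * (if t12 then Cmod q else 1)).
  apply (fibre_weight_ge f); auto; try tauto; intros ? ? ->; intuition congruence.
assert (R2 : Cmod a2 <= (if t21 then Cmod r else 1) * (if t22 then Cmod s else 1)).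
  apply (fibre_weight_ge f); auto; try tauto; intros ? ? ->; intuition congruence.
assert (K1 : Cmod b1 <= (if t11 then Cmod p else 1) * (if t21 then Cmod r else 1)).
  apply (fibre_weight_ge g); auto; try tauto; intros ? ? ->; intuition congruence.
assert (K2 : Cmod b2 <= (if t12 then Cmod q else 1) * (if t22 then Cmod s else 1)).
  apply (fibre_weight_ge g); auto; try tauto; intros ? ? ->; intuition congruence.
assert (Pos : forall (t : bool) z, 0 <= if t then Cmod z else 1).
  intros [] z; [apply Cmod_ge_0 | lra].
assert (Pos11 := Pos t11 p); assert (Pos12 := Pos t12 q).
assert (Pos21 := Pos t21 r); assert (Pos22 := Pos t22 s).
assert (Pa1 := Cmod_pos _ Na1); assert (Pa2 := Cmod_pos _ Na2).
assert (Pb1 := Cmod_pos _ Nb1); assert (Pb2 := Cmod_pos _ Nb2).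
assert (equalities : forall x y z w, 0 <= x -> 0 <= y -> 0 <= z -> 0 <= w ->
   x * y * (z * w) = Cmod a1 * Cmod a2 ->
   Cmod a1 <= x * y -> Cmod a2 <= z * w -> Cmod b1 <= x * z -> Cmod b2 <= y * w ->
   Cmod a1 = x * y /\ Cmod a2 = z * w /\ Cmod b1 = x * z /\ Cmod b2 = y * w).
  intros x y z w Hx Hy Hz Hw Hxyzw L1 L2 L3 L4.
  assert (tight : forall u v U V, 0 < u -> 0 < v -> u <= U -> v <= V -> U * V = u * v ->
     u = U /\ v = V).
    intros u v U V Hu Hv LU LV E.
    assert (X : 0 <= U * (V - v)) by (apply Rmult_le_pos; lra).
    assert (Y : 0 <= (U - u) * v) by (apply Rmult_le_pos; lra).
    assert (Z : (U - u) * v = 0) by lra.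
    assert (W : U * (V - v) = 0) by lra.
    apply Rmult_integral in Z; apply Rmult_integral in W.
    lra.
  destruct (tight _ _ _ _ Pa1 Pa2 L1 L2 Hxyzw) as [E1 E2].
  destruct (tight _ _ _ _ Pb1 Pb2 L3 L4) as [E3 E4]; [|auto].
  rewrite <- Hab, <- Hxyzw; ring.
destruct (equalities _ _ _ _ Pos11 Pos12 Pos21 Pos22 Hprod R1 R2 K1 K2)
  as (EA1 & EA2 & EB1 & EB2).
clear R1 R2 K1 K2 Pos Pos11 Pos12 Pos21 Pos22 equalities Hprod.
unfold unit_disc in Da1, Da2, Db1, Db2.
destruct t11, t12, t21, t22; rewrite ?Rmult_1_l, ?Rmult_1_r in *; try (exfalso; lra);
  try (destruct (H11 eq_refl) as (Dp & fp & gp)); try (destruct (H12 eq_refl) as (Dq & fq & gq));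
  try (destruct (H21 eq_refl) as (Dr & fr & gr)); try (destruct (H22 eq_refl) as (Ds & fs & gs));
  clear H11 H12 H21 H22.
- exfalso.
  destruct (four_point_constraints a1 a2 b1 b2 f g p q r s) as [CA CB]; auto.
  apply (interior_impossible a1 a2 b1 b2 p q r s); auto; now rewrite Cmod_mult.
- exfalso; assert (p = q); [|congruence].
  apply (schwarz_equality_injective f r); auto; congruence.
- exfalso; assert (p = q); [|congruence].
  apply (schwarz_equality_injective f s); auto; congruence.
- exfalso; assert (r = s); [|congruence].
  apply (schwarz_equality_injective f p); auto; congruence.
- destruct (diagonal_rotations f g p s) as (alpha & beta & Ha & Hb & H & E); auto; try congruence.
  exists alpha, beta; rewrite gp, fp, gs, fs in E; auto.
- exfalso; assert (r = s); [|congruence].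
  apply (schwarz_equality_injective f q); auto; congruence.
- destruct (diagonal_rotations f g q r) as (alpha & beta & Ha & Hb & H & E); auto; try congruence.
  exists alpha, beta; rewrite gq, fq, gr, fr in E; auto.
Qed.

Lemma extremal_bidisc_rotations (A B : C -> Prop) (a1 a2 b1 b2 : C) (phi : C -> C * C) :
  a1 <> 0 -> a2 <> 0 -> b1 <> 0 -> b2 <> 0 -> a1 <> a2 -> b1 <> b2 ->
  unit_disc a1 -> unit_disc a2 -> unit_disc b1 -> unit_disc b2 ->
  (forall z, A z <-> z = a1 \/ z = a2) -> (forall z, B z <-> z = b1 \/ z = b2) ->
  Cmod (a1 * a2) = Cmod (b1 * b2) ->
  lempert_bidisc (cartesian A B) (RtoC 0, RtoC 0) = Finite (Cmod (a1 * a2)) ->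
  extremal_bidisc (cartesian A B) (RtoC 0, RtoC 0) phi ->
  exists theta, maps_onto (Cmult (cis theta)) A B /\ rotation_pair theta phi.
Proof.
intros Na1 Na2 Nb1 Nb2 Naa Nbb Da1 Da2 Db1 Db2 HA HB Hab Hl
  (Hphi & phi0 & T & lam & _ & HTS & Hlam & HT).
unfold lempert_bidisc in Hl; rewrite Hl in HT.
set (d := fun s => if excluded_middle_informative (T s) then true else false).
assert (Hd : forall s, d s = true <-> T s).
  intros s; unfold d; destruct excluded_middle_informative; split; congruence || tauto.
rewrite (prod_over_sublist (V := bidisc_space) T (grid a1 a2 b1 b2) d) in HT; auto.
2: now apply NoDup_grid.
2: intros s Hs; now apply (in_grid A B), HTS.
2: intros s Hs; now apply Cmod_unit_bounds, Hlam.
injection HT as HT; unfold grid, product_of in HT; simpl in HT.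
destruct (hol_bidisc_components phi Hphi) as [Hf Hg].
assert (V : forall x y, d (x, y) = true ->
   unit_disc (lam (x, y)) /\ fst (phi (lam (x, y))) = x /\ snd (phi (lam (x, y))) = y).
  intros x y Hxy; apply Hd in Hxy; destruct (Hlam _ Hxy) as [V1 V2].
  rewrite V2; auto.
destruct (extremal_components (fun z => fst (phi z)) (fun z => snd (phi z)) a1 a2 b1 b2
  (lam (a1, b1)) (lam (a1, b2)) (lam (a2, b1)) (lam (a2, b2))
  (d (a1, b1)) (d (a1, b2)) (d (a2, b1)) (d (a2, b2)))
  as (alpha & beta & Ha & Hb & Hrot & E); auto.
- now rewrite phi0.
- now rewrite phi0.
- rewrite HT; ring.
- assert (Nal : alpha <> 0) by (intros ->; rewrite Cmod_0 in Ha; lra).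
  destruct (exists_cis alpha Ha) as [t Ht].
  destruct (exists_cis (beta / alpha)%C) as [theta Htheta].
    rewrite Cmod_div, Ha, Hb by exact Nal; field.
  exists theta; split.
  + intros w; rewrite HB; rewrite Htheta in E; split.
    * destruct E as [[-> ->]|[-> ->]]; intros [->| ->];
        [exists a1 | exists a2 | exists a2 | exists a1]; rewrite HA; auto.
    * intros (z & Hz & ->); apply HA in Hz.
      destruct E as [[-> ->]|[-> ->]]; destruct Hz as [->| ->]; auto.
  + exists (fun z => alpha * z)%C; split; [exists t; now rewrite Ht|].
    intros z Hz; destruct (Hrot z Hz) as [E1 E2].
    rewrite (surjective_pairing (phi z)), E1, E2, <- Htheta.
    f_equal; field; exact Nal.
Qed.

Lemma rotation_pair_extremal (A B : C -> Prop) (a1 a2 : C) (theta : R) (phi : C -> C * C) :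
  a1 <> a2 -> unit_disc a1 -> unit_disc a2 ->
  (forall z, A z <-> z = a1 \/ z = a2) ->
  maps_onto (Cmult (cis theta)) A B ->
  lempert_bidisc (cartesian A B) (RtoC 0, RtoC 0) = Finite (Cmod (a1 * a2)) ->
  rotation_pair theta phi ->
  extremal_bidisc (cartesian A B) (RtoC 0, RtoC 0) phi.
Proof.
intros Naa Da1 Da2 HA HAB Hl (r & (t & Hr) & Hphi).
assert (Ht := Cmod_cis t); assert (Hth := Cmod_cis theta).
assert (Nt : cis t <> 0) by (intros E; rewrite E, Cmod_0 in Ht; lra).
assert (Hphi' : forall z, unit_disc z -> phi z = (cis t * z, cis theta * (cis t * z))%C).
  intros z Hz; rewrite Hphi, Hr by exact Hz; reflexivity.
set (T := fun s : C * C => A (fst s) /\ snd s = (cis theta * fst s)%C).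
set (lam := fun s : C * C => (fst s / cis t)%C).
set (L := (a1, cis theta * a1)%C :: (a2, cis theta * a2)%C :: nil).
assert (HT : forall s, T s <-> In s L).
  intros [z w]; unfold T, L; simpl; rewrite HA; split.
    intros [[->| ->] ->]; auto.
  intros [E|[E|[]]]; injection E; intros <- <-; auto.
assert (Clam : forall s, Cmod (lam s) = Cmod (fst s)).
  intros s; unfold lam; rewrite Cmod_div, Ht by exact Nt; field.
assert (P : passes_through (V := bidisc_space) phi T lam).
  intros s Hs; assert (U : unit_disc (lam s)).
    unfold unit_disc; rewrite Clam.
    destruct Hs as [Hs _]; apply HA in Hs; destruct Hs as [->| ->]; assumption.
  split; [exact U|]; destruct Hs as [_ Hs].
  rewrite Hphi' by exact U; unfold lam.
  destruct s as [x y]; simpl in *; rewrite Hs; f_equal; field; exact Nt.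
split; [|split].
- intros z Hz.
  assert (H : hol_disc (V := bidisc_space) bidisc
    (fun z => (cis t * z, cis theta * (cis t * z)))%C).
    apply hol_bidisc_pair; [apply (self_map_scale (cis t) (fun z => z)) |
      apply (self_map_scale (cis theta) (fun z => cis t * z)%C)]; auto using self_map_id.
    apply (self_map_scale (cis t) (fun z => z)); auto using self_map_id.
  destruct (H z Hz) as [D1 D2]; rewrite <- (Hphi' z Hz) in D2; split; [|exact D2].
  refine (ex_derive_ext_loc _ _ z _ D1).
  destruct (unit_disc_open z Hz) as [e [He HE]].
  exists (mkposreal e He); intros y Hy; symmetry; apply Hphi', HE, Hy.
- rewrite Hphi' by exact unit_disc_0; now rewrite !Cmult_0_r.
- exists T, lam; split; [|split; [|split; [exact P|]]].
  + exists (a1, cis theta * a1)%C; apply HT; now left.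
  + intros s [Hs1 Hs2]; split; [exact Hs1|]; apply HAB; now exists (fst s).
  + unfold lempert_bidisc in Hl; rewrite Hl.
    rewrite (prod_over_list (V := bidisc_space) T L).
    * unfold L, product_of; simpl; rewrite !Clam, Cmod_mult; simpl; f_equal; ring.
    * unfold L; repeat constructor; simpl; intros H; repeat destruct H as [H|H]; auto.
      injection H; auto.
    * exact HT.
    * intros s Hs; now apply Cmod_unit_bounds, P.
Qed.

(** Two different rotations with the same image of A differ by one that exchanges the
    two points of A, that is, by -1. *)
Lemma maps_onto_cis_unique (A B : C -> Prop) (a1 a2 : C) (theta theta' : R) :
  a1 <> 0 -> a2 <> 0 -> a1 <> a2 -> (forall z, A z <-> z = a1 \/ z = a2) ->
  maps_onto (Cmult (cis theta)) A B -> maps_onto (Cmult (cis theta')) A B ->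
  ~ maps_onto Copp A A -> cis theta' = cis theta.
Proof.
intros Na1 Na2 Naa HA H H' Hopp.
assert (Ht := Cmod_cis theta).
assert (Nt : cis theta <> 0) by (intros E; rewrite E, Cmod_0 in Ht; lra).
set (u := cis theta) in *; set (v := cis theta') in *.
assert (image : forall z, A z -> (v * z = u * a1 \/ v * z = u * a2)%C).
  intros z Hz; assert (Bz : B (v * z)%C) by (apply H'; now exists z).
  apply H in Bz; destruct Bz as (y & Hy & ->); apply HA in Hy.
  destruct Hy as [->| ->]; auto.
destruct (image a1) as [E1|E1]; [apply HA; now left | |].
  apply (Cmult_cancel_l a1); [exact Na1|]; rewrite !(Cmult_comm a1); exact E1.
destruct (image a2) as [E2|E2]; [apply HA; now right | |].
2: apply (Cmult_cancel_l a2); [exact Na2|]; rewrite !(Cmult_comm a2); exact E2.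
exfalso; apply Hopp.
(* v / u exchanges the two points, so its square is 1 *)
assert (S : ((v - u) * (v + u) = 0)%C).
  apply (Cmult_cancel_l a1); [exact Na1|].
  replace (a1 * ((v - u) * (v + u)))%C with (v * (v * a1) - u * (u * a1))%C by ring.
  rewrite E1, <- E2; ring.
assert (Np : (v - u <> 0)%C).
  intros E; apply Ceq_minus in E; rewrite E in E1; apply Naa; now apply (Cmult_cancel_l u).
assert (E : (v + u = 0)%C).
  apply (Cmult_cancel_l (v - u)%C); [exact Np | rewrite S; ring].
assert (Ev : v = (- u)%C) by (replace v with (v + u - u)%C by ring; rewrite E; ring).
assert (E12 : a2 = (- a1)%C).
  apply (Cmult_cancel_l u); [exact Nt|]; rewrite <- E1, Ev; ring.
intros w; rewrite HA; split.
- intros [->| ->]; [exists a2 | exists a1]; rewrite HA, E12; split; auto; ring.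
- intros (z & Hz & ->); apply HA in Hz; rewrite E12 in Hz |- *.
  destruct Hz as [->| ->]; [right | left]; ring.
Qed.

Theorem theorem7 (A B : C -> Prop)
  (hA2 : two_points A) (hB2 : two_points B)
  (hA : forall z : C, A z -> unit_disc z) (hB : forall z : C, B z -> unit_disc z)
  (hA0 : ~ A (RtoC 0)) (hB0 : ~ B (RtoC 0))
  (hAB : lempert_disc A (RtoC 0) = lempert_disc B (RtoC 0)) :
  (lempert_disc A (RtoC 0) = lempert_bidisc (cartesian A B) (RtoC 0, RtoC 0) <->
   exists r : C -> C, rotation r /\ maps_onto r A B) /\
  (forall theta : R, maps_onto (Cmult (cis theta)) A B ->
   (forall phi : C -> C * C,
      extremal_bidisc (cartesian A B) (RtoC 0, RtoC 0) phi <->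
      exists theta' : R,
        maps_onto (Cmult (cis theta')) A B /\ rotation_pair theta' phi) /\
   (~ maps_onto Copp A A ->
    forall phi : C -> C * C,
      extremal_bidisc (cartesian A B) (RtoC 0, RtoC 0) phi <->
      rotation_pair theta phi)).
Proof.
destruct hA2 as (a1 & a2 & Naa & HA); destruct hB2 as (b1 & b2 & Nbb & HB).
assert (A1 : A a1) by (apply HA; auto); assert (A2 : A a2) by (apply HA; auto).
assert (B1 : B b1) by (apply HB; auto); assert (B2 : B b2) by (apply HB; auto).
assert (Da1 := hA a1 A1); assert (Da2 := hA a2 A2).
assert (Db1 := hB b1 B1); assert (Db2 := hB b2 B2).
assert (Na1 : a1 <> 0) by (intros E; apply hA0; now rewrite <- E).
assert (Na2 : a2 <> 0) by (intros E; apply hA0; now rewrite <- E).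
assert (Nb1 : b1 <> 0) by (intros E; apply hB0; now rewrite <- E).
assert (Nb2 : b2 <> 0) by (intros E; apply hB0; now rewrite <- E).
assert (LA := lempert_disc_pair A a1 a2 Naa HA Da1 Da2).
assert (LB := lempert_disc_pair B b1 b2 Nbb HB Db1 Db2).
rewrite LA, LB in hAB; injection hAB as Hab; rewrite LA; clear LA LB.
assert (rotated : forall theta, maps_onto (Cmult (cis theta)) A B ->
  lempert_bidisc (cartesian A B) (RtoC 0, RtoC 0) = Finite (Cmod (a1 * a2))).
  intros theta Htheta; assert (Ht := Cmod_cis theta).
  rewrite (lempert_bidisc_four_points A B a1 a2 (cis theta * a1) (cis theta * a2)); auto.
  - now apply Glb_four_point_rotated.
  - intros E; apply Naa, (Cmult_cancel_l (cis theta)); [|exact E].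
    intros E0; rewrite E0, Cmod_0 in Ht; lra.
  - intros z; rewrite (Htheta z); split.
      intros (y & Hy & ->); apply HA in Hy; destruct Hy as [->| ->]; auto.
    intros [->| ->]; [exists a1 | exists a2]; auto.
split; [split|].
- intros Hl; symmetry in Hl.
  rewrite (lempert_bidisc_four_points A B a1 a2 b1 b2) in Hl; auto.
  destruct (rotation_of_small_products a1 a2 b1 b2) as (u & Hu & E); auto.
    intros e He.
    assert (X : exists x, four_point_product a1 a2 b1 b2 x /\ x < Cmod (a1 * a2) + e).
      apply NNPP; intros N.
      assert (G := Glb_Rbar_correct (four_point_product a1 a2 b1 b2)); rewrite Hl in G.
      assert (Y : Rbar_le (Cmod (a1 * a2) + e) (Cmod (a1 * a2))).
        apply (proj2 G); intros x Hx; simpl; apply Rnot_lt_le; intros L; apply N; now exists x.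
      simpl in Y; lra.
    destruct X as (x & (f & g & p & q & r & s & Hf & Hg & f0 & g0 & Hp & Hq & Hr & Hs
      & fp & fq & fr & fs & gp & gq & gr & gs & ->) & L).
    exists p, q, r, s.
    destruct (four_point_constraints a1 a2 b1 b2 f g p q r s) as [CA CB]; auto.
    repeat (split; [assumption|]); lra.
  destruct (exists_cis u Hu) as [t ->].
  exists (Cmult (cis t)); split; [now exists t|].
  intros w; rewrite HB; split.
  + destruct E as [[-> ->]|[-> ->]]; intros [->| ->];
      [exists a1 | exists a2 | exists a2 | exists a1]; auto.
  + intros (z & Hz & ->); apply HA in Hz.
    destruct E as [[-> ->]|[-> ->]]; destruct Hz as [->| ->]; auto.
- intros (r & (t & Ht) & Hr); symmetry; apply (rotated t).
  intros w; rewrite (Hr w); split; intros (z & Hz & ->); exists z; rewrite Ht; auto.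
- intros theta Htheta; assert (Hl := rotated theta Htheta).
  assert (main : forall phi, extremal_bidisc (cartesian A B) (RtoC 0, RtoC 0) phi <->
      exists theta', maps_onto (Cmult (cis theta')) A B /\ rotation_pair theta' phi).
    intros phi; split.
      now apply (extremal_bidisc_rotations A B a1 a2 b1 b2).
    intros (theta' & H1 & H2).
    now apply (rotation_pair_extremal A B a1 a2 theta').
  split; [exact main|]; intros Hopp phi; rewrite main; split.
  + intros (theta' & H1 & r & Hr & H2); exists r; split; [exact Hr|].
    rewrite <- (maps_onto_cis_unique A B a1 a2 theta theta'); auto.
  + intros H; now exists theta.
Qed.
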